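(* Assume access to independent samples $(x_{i+1},z_i)_{i=1}^N$, $N\ge n_z(n_z+1)/2$, with $x_{i+1}=M(z_i)w_i$, where the $z_i$ are i.i.d. copies of a random vector $z$ whose distribution is dominated by the Lebesgue measure, and where $\operatorname{rank}(M_{(3)})=\operatorname{rank}\begin{bmatrix}M_{(3)} \\ V_{(3)}\end{bmatrix}=n_w$. Let $\hat W$ be the least-squares estimate, $\beta_W=r_w^2\zeta_W\sqrt{2\log(2n_w/\delta)}$, $\underline W=\hat W-\beta_WI_{n_w}$ and $\overline W=\hat W+\beta_WI_{n_w}$. Let $H=\operatorname{blkdiag}(Q,R)\succ0$ and assume there exists $K$ such that $\rho(\mathcal E_K(W;\cdot))<1$ for all symmetric $W$ with $\underline W\preceq W\preceq\overline W$. Let $\overline K=-(R+\mathcal G^*(\overline W;\overline P))^{-1}\mathcal H^*(\overline W;\overline P)$, with $\overline P\succ0$ the solution of $\overline P=\mathcal R(\overline W;\overline P)$, denote the distributionally robust policy gain. Let $\mathcal E_\star=\mathcal E(W_\star;\cdot)$, $W_\star=\mathbb E[ww^\top]$, denote the true moment dynamics. Then with probability at least $1-\delta$: (i) $\rho(\mathcal E_\star(\Pi_{\overline K}(\cdot)))<1$; (ii) $\mathrm{Val}(\mathrm{DR})\ge\mathrm{Val}(\mathrm{LQRcp})=\mathrm{Val}(\mathrm{SLQR})$.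
   Context: Dynamics: $x_{t+1}=A(v_t)x_t+B(v_t)u_t$, $x_t\in\mathbb R^{n_x}$, $u_t\in\mathbb R^{n_u}$, $n_z=n_x+n_u$, $(v_t)$ i.i.d. in $\mathbb R^{n_v}$, $A(v)=\sum_i[v]_i\tilde A_i$, $B(v)=\sum_i[v]_i\tilde B_i$. Model matrices $M_k=[A_k,B_k]\in\mathbb R^{n_x\times n_z}$, $k=1,\dots,n_w$; $M_{(3)}$ has rows $\operatorname{vec}(M_k)^\top$, $V_{(3)}$ has rows $\operatorname{vec}([\tilde A_i,\tilde B_i])^\top$. Disturbance $w=(M_{(3)}^\top)^\dagger V_{(3)}^\top v$ with $\|w\|_2\le r_w$; $w_1,\dots,w_N$ is the noise sequence of i.i.d. copies of $w$. $M(z)=[M_1z,\dots,M_{n_w}z]$. $\delta\in(0,1)$ is a confidence parameter; $\preceq$ is the positive semidefinite order; $\dagger$ is the pseudo-inverse. For symmetric $W,Z$: $\mathcal E(W;Z)=\sum_{k,l}[W]_{kl}M_kZM_l^\top$. $\Pi_K(X)=\begin{bmatrix}I \\ K\end{bmatrix}X\begin{bmatrix}I & K^\top\end{bmatrix}$, $\mathcal E_K(W;X)=\mathcal E(W;\Pi_K(X))$; $\rho$ is the spectral radius of a linear map on symmetric matrices. $\mathcal F^*(W;P)=\sum_{k,l}[W]_{kl}A_k^\top PA_l$, $\mathcal G^*(W;P)=\sum_{k,l}[W]_{kl}B_k^\top PB_l$, $\mathcal H^*(W;P)=\sum_{k,l}[W]_{kl}B_k^\top PA_l$, $\mathcal R(W;P)=Q+\mathcal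 F^*(W;P)-\mathcal H^*(W;P)^\top(R+\mathcal G^*(W;P))^{-1}\mathcal H^*(W;P)$. Estimation: $\operatorname{svec}(X)\in\mathbb R^{d(d+1)/2}$ stacks the lower triangle of symmetric $X\in\mathbb R^{d\times d}$ column by column, off-diagonals multiplied by $\sqrt2$; $Q_d$ satisfies $Q_dQ_d^\top=I$, $Q_d\operatorname{vec}(X)=\operatorname{svec}(X)$, $Q_d^\top\operatorname{svec}(X)=\operatorname{vec}(X)$ for symmetric $X$; $U\otimes_sU=Q_m(U\otimes U)Q_n^\top$ for $U\in\mathbb R^{m\times n}$. $Y_N$ stacks $\operatorname{svec}(x_{i+1}x_{i+1}^\top)$, $\mathbf Z_N$ stacks $M(z_i)\otimes_sM(z_i)$, $i=1,\dots,N$; $\operatorname{svec}(\hat W)=\mathbf Z_N^\dagger Y_N$. $\mathbf W_i=(M(z_i)\otimes_sM(z_i))^\top(M(z_i)\otimes_sM(z_i))$, $\mathbf H_i=[\sum_j\mathbf W_j]^\dagger\mathbf W_i$, $\operatorname{svec}(\mathcal H_i(X))=\mathbf H_i\operatorname{svec}(X)$, $\|\mathcal H_i\|_2=\max\{\|\mathcal H_i(X)\|_2:X=X^\top,\|X\|_2\le1\}$, $\zeta_W^2=\sum_i\|\mathcal H_i\|_2^2$. Problems, for given initial state $x_0$ with $X_0=\mathbb E[x_0x_0^\top]$: (SLQR) minimize $\mathbb E[\sum_{t\ge0}x_t^\top Qx_t+u_t^\top Ru_t]$ over (causal, possibly randomized) inputs $u_0,u_1,\dots$ subject to the dynamics.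 (LQRcp) minimize $\sum_{t\ge0}\operatorname{tr}[Z_tH]$ over $Z_t=\begin{bmatrix}X_t & V_t \\ V_t^\top & U_t\end{bmatrix}\succeq0$ subject to $X_{t+1}=\mathcal E_\star(Z_t)$ for all $t$. (DR) minimize over $Z_t=\begin{bmatrix}X_t & V_t \\ V_t^\top & U_t\end{bmatrix}\succeq0$ (causal rules choosing $Z_t$ as a function of $X_0,\dots,X_t$), with inner maximization over $W$ satisfying $\underline W\preceq W\preceq\overline W$, the cost $\sum_{t\ge0}\operatorname{tr}[Z_tH]$ subject to $X_{t+1}=\mathcal E(W;Z_t)$ for all $t$. $\mathrm{Val}$ denotes the optimal value. *)

(* Defs.v *)
From HB Require Import structures.
From mathcomp Require Import all_boot all_order all_algebra zify ring.
From mathcomp Require Import finmap complex mxtens.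
From mathcomp Require Import all_classical all_reals all_analysis.

Set Implicit Arguments.
Unset Strict Implicit.
Unset Printing Implicit Defensive.

Import Order.TTheory GRing.Theory Num.Theory.
Import numFieldNormedType.Exports.

Local Open Scope classical_set_scope.
Local Open Scope ring_scope.

Definition qform (R : realType) n (A : 'M[R]_n) (x : 'cV[R]_n) : R :=
  (x^T *m A *m x) 0 0.

Definition psdmx (R : realType) n (A : 'M[R]_n) : Prop :=
  A^T = A /\ forall x, 0 <= qform A x.

Definition pdmx (R : realType) n (A : 'M[R]_n) : Prop :=
  A^T = A /\ forall x, x != 0 -> 0 < qform A x.

Definition loewner_le (R : realType) n (A B : 'M[R]_n) : Prop := psdmx (B - A).

Definition enorm (R : realType) n (x : 'cV[R]_n) : R :=
  Num.sqrt (\sum_i x i 0 ^+ 2).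

Definition specnorm (R : realType) m n (A : 'M[R]_(m, n)) : R :=
  sup [set enorm (A *m x) | x in [set x | enorm x <= 1]].

Definition penrose (R : realType) m n (A : 'M[R]_(m, n)) (B : 'M[R]_(n, m)) :=
  [/\ A *m B *m A = A, B *m A *m B = B,
      (A *m B)^T = A *m B & (B *m A)^T = B *m A].

(* The Moore-Penrose inverse, i.e. the only solution of the Penrose equations;
   MathComp's [pinvmx] satisfies only part of them. *)
Definition mpinv (R : realType) m n (A : 'M[R]_(m, n)) : 'M[R]_(n, m) :=
  xget 0 [set B | penrose A B].

(* Column stacking: A i j is put at position j * m + i, the indexing of the
   Kronecker product [tensmx]. *)
Definition vec (R : realType) m n (A : 'M[R]_(m, n)) : 'cV[R]_(n * m) :=
  \col_k A (mxtens_unindex k).2 (mxtens_unindex k).1.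

(* Pairs (column, row) in the lower triangle. MathComp enumerates them
   lexicographically, hence column by column. *)
Definition low (d : nat) : {set 'I_d * 'I_d} :=
  [set p : 'I_d * 'I_d | (p.1 <= p.2)%N].

Definition sdim (d : nat) : nat := #|low d|.

Lemma sdimE d : sdim d = ((d * d.+1) %/ 2)%N.
Proof.
rewrite /sdim -sum1_card.
rewrite (eq_bigl (fun p : 'I_d * 'I_d => p.1 <= p.2)%N); last first.
  by move=> p; rewrite inE.
rewrite -(pair_big_dep predT (fun i j : 'I_d => (i <= j)%N)
             (fun _ _ => 1%N)) /=.
rewrite (exchange_big_dep predT) //=.
transitivity (\sum_(j < d) j.+1)%N.
  apply: eq_bigr => j _; rewrite sum1_card -[RHS]card_ord.
  have winj : injective (widen_ord (ltn_ord j)).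
    by move=> a b /(congr1 val) /= ab; apply: val_inj.
  rewrite -(card_imset predT winj).
  apply: eq_card => i; apply/idP/imsetP => [ij|[k _ ->]].
    by exists (Ordinal (ij : (i < j.+1)%N)) => //; apply: val_inj.
  exact: (ltn_ord k).
elim: d => [|d IH]; first by rewrite big_ord0.
by rewrite big_ord_recr /= IH; nia.
Qed.

Definition svec (R : realType) d (X : 'M[R]_d) : 'cV[R]_(sdim d) :=
  \col_k (let: (j, i) := enum_val k in
          (if j == i then 1 else Num.sqrt 2) * X i j).

(* The orthonormal basis of the symmetric matrices dual to [svec]. *)
Definition symbasis (R : realType) d (k : 'I_(sdim d)) : 'M[R]_d :=
  let: (j, i) := enum_val k in
  if j == i then delta_mx i i
  else (Num.sqrt 2)^-1 *: (delta_mx i j + delta_mx j i).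

(* The inverse of [svec]; see [svecK] and [smatK]. *)
Definition smat (R : realType) d (x : 'cV[R]_(sdim d)) : 'M[R]_d :=
  \sum_k x k 0 *: symbasis R k.

(* The matrix Q_d; [Qmx_svec] alone already determines it, as [svec] is onto. *)
Definition Qmx (R : realType) d : 'M[R]_(sdim d, d * d) :=
  \matrix_(k < sdim d) (vec (symbasis R k))^T.

Definition skron (R : realType) m n (U : 'M[R]_(m, n)) :
    'M[R]_(sdim m, sdim n) :=
  Qmx R m *m tensmx U U *m (Qmx R n)^T.

Lemma sqrt2_neq0 (R : realType) : Num.sqrt (2 : R) != 0.
Proof. by rewrite sqrtr_eq0 -ltNge ltr0n. Qed.

Lemma symbasisE (R : realType) d (k : 'I_(sdim d)) i j :
  symbasis R k i j =
  if (enum_val k).1 == (enum_val k).2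
  then ((i == (enum_val k).2) && (j == (enum_val k).2))%:R
  else (Num.sqrt 2)^-1 * (((i == (enum_val k).2) && (j == (enum_val k).1))%:R
     + ((i == (enum_val k).1) && (j == (enum_val k).2))%:R).
Proof.
rewrite /symbasis; case: (enum_val k) => a b /=.
by case: eqP => _; rewrite !mxE.
Qed.

Lemma symbasis_sym (R : realType) d (k : 'I_(sdim d)) :
  (symbasis R k)^T = symbasis R k.
Proof.
apply/matrixP => i j; rewrite mxE !symbasisE.
case: ifP => _; first by rewrite andbC.
by rewrite addrC; congr (_ * (_%:R + _%:R)); rewrite andbC.
Qed.

Lemma svecE (R : realType) d (X : 'M[R]_d) k :
  svec X k 0 = (if (enum_val k).1 == (enum_val k).2 then 1 else Num.sqrt 2) *
    X (enum_val k).2 (enum_val k).1.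
Proof. by rewrite mxE; case: (enum_val k). Qed.

Lemma svec_symbasis (R : realType) d (l : 'I_(sdim d)) :
  svec (symbasis R l) = delta_mx l 0.
Proof.
apply/colP => k; rewrite svecE symbasisE [RHS]mxE andbT.
have := enum_valP k; have := enum_valP l; rewrite !inE.
rewrite -(inj_eq enum_val_inj k l).
case: (enum_val k) => a b; case: (enum_val l) => c e /= lce lab.
rewrite xpair_eqE.
have F (x y z : 'I_d) : y != z -> (x == y) && (x == z) = false.
  by move=> yz; apply: contra_neqF yz => /andP[/eqP <- /eqP <-].
have G (x y z : 'I_d) : y != z -> (y == x) && (z == x) = false.
  by move=> yz; apply: contra_neqF yz => /andP[/eqP -> /eqP ->].
have [<-|ab] := eqVneq a b.
  rewrite mul1r; have [<-|ce] := eqVneq c e; first by [].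
  by rewrite (andbC (a == e)) !F // addr0 mulr0.
have [<-|ce] := eqVneq c e.
  by rewrite andbC !G // mulr0.
have -> : (b == c) && (a == e) = false.
  apply/negP => /andP[/eqP bc /eqP ae]; subst c e.
  by move/negP: ab; apply; rewrite -val_eqE eqn_leq lab lce.
by rewrite addr0 mulrA mulfV ?sqrt2_neq0// mul1r andbC.
Qed.

Lemma svec_linear (R : realType) d (a : R) (X Y : 'M[R]_d) :
  svec (a *: X + Y) = a *: svec X + svec Y.
Proof.
by apply/colP => k; rewrite !mxE; case: (enum_val k) => i j; rewrite !mxE; ring.
Qed.

Lemma svec_sum (R : realType) d I (r : seq I) (a : I -> R) (X : I -> 'M[R]_d) :
  svec (\sum_(i <- r) a i *: X i) = \sum_(i <- r) a i *: svec (X i).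
Proof.
elim: r => [|i r IH]; last by rewrite !big_cons svec_linear IH.
by rewrite !big_nil; apply/colP => k; rewrite svecE !mxE mulr0.
Qed.

Lemma svecK (R : realType) d : cancel (@smat R d) (@svec R d).
Proof.
move=> x; rewrite svec_sum [RHS]matrix_sum_delta.
by apply: eq_bigr => k _; rewrite big_ord1 svec_symbasis.
Qed.

Lemma smat_sym (R : realType) d (x : 'cV[R]_(sdim d)) : (smat x)^T = smat x.
Proof.
rewrite linear_sum; apply: eq_bigr => k _.
by rewrite linearZ /= symbasis_sym.
Qed.

Lemma svec_inj_sym (R : realType) d (X Y : 'M[R]_d) :
  X^T = X -> Y^T = Y -> svec X = svec Y -> X = Y.
Proof.
move=> sX sY XY; have H (i j : 'I_d) : (i <= j)%N -> X j i = Y j i.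
  move=> ij; have kin : (i, j) \in low d by rewrite inE.
  move/colP/(_ (enum_rank_in kin (i, j))): XY.
  rewrite !svecE enum_rankK_in //=; apply: mulfI.
  by case: ifP => _; [exact: oner_neq0|exact: sqrt2_neq0].
apply/matrixP => i j; have [ij|/ltnW ij] := leqP j i; first exact: H.
by rewrite -sX -sY mxE [RHS]mxE; apply: H.
Qed.

Lemma smatK (R : realType) d (X : 'M[R]_d) : X^T = X -> smat (svec X) = X.
Proof.
by move=> sX; apply: svec_inj_sym => //; [exact: smat_sym|exact: svecK].
Qed.

Lemma vec_linear (R : realType) m n (a : R) (X Y : 'M[R]_(m, n)) :
  vec (a *: X + Y) = a *: vec X + vec Y.
Proof. by apply/colP => k; rewrite !mxE. Qed.

Lemma Qmx_svec (R : realType) d (X : 'M[R]_d) : X^T = X ->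
  (Qmx R d)^T *m svec X = vec X.
Proof.
move=> sX; rewrite -{2}(smatK sX); apply/colP => l.
rewrite !mxE summxE; apply: eq_bigr => k _.
by rewrite !mxE [LHS]mulrC.
Qed.

Lemma vec_dot (R : realType) m n (X Y : 'M[R]_(m, n)) :
  ((vec X)^T *m vec Y) 0 0 = \sum_i \sum_j X i j * Y i j.
Proof.
rewrite mxE exchange_big pair_big /=.
rewrite (reindex (@mxtens_index n m)) /=; last first.
  by exists (@mxtens_unindex n m) => k _;
    rewrite ?mxtens_indexK ?mxtens_unindexK.
by apply: eq_bigr => -[j i] _; rewrite !mxE mxtens_indexK.
Qed.

Lemma Qmx_vec (R : realType) d (X : 'M[R]_d) : X^T = X ->
  Qmx R d *m vec X = svec X.
Proof.
move=> sX; apply/colP => k.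
have -> : (Qmx R d *m vec X) k 0 = ((vec (symbasis R k))^T *m vec X) 0 0.
  by rewrite !mxE; apply: eq_bigr => l _; rewrite !mxE.
rewrite vec_dot svecE /symbasis; case: (enum_val k) => a b /=.
have dlt (p q : 'I_d) : \sum_i \sum_j (delta_mx p q i j : R) * X i j = X p q.
  rewrite (bigD1 p) //= (bigD1 q) //= !mxE !eqxx mul1r !big1 ?addr0 //.
    by move=> i ip; apply: big1 => j _; rewrite mxE (negbTE ip) mul0r.
  by move=> j jq; rewrite mxE (negbTE jq) andbF mul0r.
have [<-|ab] := eqVneq a b; first by rewrite mul1r dlt.
under eq_bigr do under eq_bigr do rewrite mxE -mulrA mxE mulrDl.
under eq_bigr do rewrite -mulr_sumr big_split /=.
rewrite -mulr_sumr big_split /= !dlt.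
have -> : X a b = X b a by rewrite -[in LHS]sX mxE.
rewrite -mulr2n -[X in _ * X]mulr_natl mulrA; congr (_ * _).
apply: (mulfI (sqrt2_neq0 R)); rewrite mulrA mulfV ?sqrt2_neq0// mul1r.
by rewrite -expr2 sqr_sqrtr.
Qed.

Lemma Qmx_mulT (R : realType) d : Qmx R d *m (Qmx R d)^T = 1%:M.
Proof.
apply/matrixP => k l.
have -> : (Qmx R d *m (Qmx R d)^T) k l = (Qmx R d *m vec (symbasis R l)) k 0.
  by rewrite !mxE; apply: eq_bigr => i _; rewrite !mxE.
by rewrite Qmx_vec ?symbasis_sym// svec_symbasis !mxE andbT.
Qed.

Lemma tens_vec (R : realType) m n (U : 'M[R]_(m, n)) (X : 'M[R]_n) :
  tensmx U U *m vec X = vec (U *m X *m U^T).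
Proof.
apply/colP => k; case: (mxtens_indexP k) => j i.
rewrite !mxE mxtens_indexK /=.
rewrite (reindex (@mxtens_index n n)) /=; last first.
  by exists (@mxtens_unindex n n) => l _;
    rewrite ?mxtens_indexK ?mxtens_unindexK.
under [RHS]eq_bigr do rewrite !mxE mulr_suml.
rewrite pair_big /=; apply: eq_bigr => -[a b] _.
by rewrite !mxE !mxtens_indexK /=; ring.
Qed.

Lemma skronE (R : realType) m n (U : 'M[R]_(m, n)) (X : 'M[R]_n) : X^T = X ->
  skron U *m svec X = svec (U *m X *m U^T).
Proof.
move=> sX; rewrite /skron -!mulmxA Qmx_svec // tens_vec mulmxA.
by rewrite Qmx_vec // !trmx_mul trmxK sX mulmxA.
Qed.

(* The matrix, in svec coordinates, of the restriction of L to the symmetric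
   matrices. *)
Definition sym_matrix (R : realType) d (L : 'M[R]_d -> 'M[R]_d) :
    'M[R]_(sdim d) :=
  \matrix_(k, l) svec (L (symbasis R l)) k 0.

Definition sym_specrad (R : realType) d (L : 'M[R]_d -> 'M[R]_d) : R :=
  sup [set Normc.normc a |
       a in [set a : R[i] |
             eigenvalue (map_mx (real_complex R) (sym_matrix L)) a]].

(* Operator norm induced by the spectral norm. *)
Definition sym_opnorm (R : realType) d (L : 'M[R]_d -> 'M[R]_d) : R :=
  sup [set specnorm (L X) | X in [set X | X^T = X /\ specnorm X <= 1]].

Section Dynamics.
Context {R : realType} {nx nu nw : nat}.
Variables (A : 'I_nw -> 'M[R]_nx) (B : 'I_nw -> 'M[R]_(nx, nu)).

Definition model (k : 'I_nw) : 'M[R]_(nx, nx + nu) := row_mx (A k) (B k).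

Definition model_at (z : 'cV[R]_(nx + nu)) : 'M[R]_(nx, nw) :=
  \matrix_(i, k) (model k *m z) i 0.

Definition unfold3 n m p (F : 'I_n -> 'M[R]_(m, p)) : 'M[R]_(n, p * m) :=
  \matrix_(k < n) (vec (F k))^T.

Definition moment_map (W : 'M[R]_nw) (Z : 'M[R]_(nx + nu)) : 'M[R]_nx :=
  \sum_k \sum_l W k l *: (model k *m Z *m (model l)^T).

Definition Pimx (K : 'M[R]_(nu, nx)) (X : 'M[R]_nx) : 'M[R]_(nx + nu) :=
  col_mx 1%:M K *m X *m row_mx 1%:M K^T.

Definition closed_map (K : 'M[R]_(nu, nx)) (W : 'M[R]_nw) (X : 'M[R]_nx) :
    'M[R]_nx :=
  moment_map W (Pimx K X).

Definition Fadj (W : 'M[R]_nw) (P : 'M[R]_nx) : 'M[R]_nx :=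
  \sum_k \sum_l W k l *: ((A k)^T *m P *m A l).

Definition Gadj (W : 'M[R]_nw) (P : 'M[R]_nx) : 'M[R]_nu :=
  \sum_k \sum_l W k l *: ((B k)^T *m P *m B l).

Definition Hadj (W : 'M[R]_nw) (P : 'M[R]_nx) : 'M[R]_(nu, nx) :=
  \sum_k \sum_l W k l *: ((B k)^T *m P *m A l).

Definition riccati (Q : 'M[R]_nx) (Ru : 'M[R]_nu) (W : 'M[R]_nw)
    (P : 'M[R]_nx) : 'M[R]_nx :=
  Q + Fadj W P - (Hadj W P)^T *m invmx (Ru + Gadj W P) *m Hadj W P.

Definition riccati_gain (Ru : 'M[R]_nu) (W : 'M[R]_nw) (P : 'M[R]_nx) :
    'M[R]_(nu, nx) :=
  - (invmx (Ru + Gadj W P) *m Hadj W P).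

Section Estimation.
Variables (N : nat) (zs : 'I_N -> 'cV[R]_(nx + nu)) (xs : 'I_N -> 'cV[R]_nx).

Definition ls_target := \mxcol_(i < N) svec (xs i *m (xs i)^T).

Definition ls_design := \mxcol_(i < N) skron (model_at (zs i)).

Definition W_hat : 'M[R]_nw := smat (mpinv ls_design *m ls_target).

Definition ls_gram (i : 'I_N) : 'M[R]_(sdim nw) :=
  (skron (model_at (zs i)))^T *m skron (model_at (zs i)).

Definition ls_weight (i : 'I_N) (X : 'M[R]_nw) : 'M[R]_nw :=
  smat (mpinv (\sum_j ls_gram j) *m ls_gram i *m svec X).

Definition zetaW : R := Num.sqrt (\sum_i sym_opnorm (ls_weight i) ^+ 2).

Definition betaW (rw delta : R) : R :=
  rw ^+ 2 * zetaW * Num.sqrt (2 * ln (2 * nw%:R / delta)).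

End Estimation.

Definition W_low N (zs : 'I_N -> 'cV[R]_(nx + nu)) (xs : 'I_N -> 'cV[R]_nx)
    (rw delta : R) : 'M[R]_nw :=
  W_hat zs xs - (betaW zs rw delta)%:M.

Definition W_high N (zs : 'I_N -> 'cV[R]_(nx + nu)) (xs : 'I_N -> 'cV[R]_nx)
    (rw delta : R) : 'M[R]_nw :=
  W_hat zs xs + (betaW zs rw delta)%:M.

Definition moment_cost (H : 'M[R]_(nx + nu)) (Z : nat -> 'M[R]_(nx + nu)) :
    \bar R :=
  (\sum_(0 <= t <oo) (\tr (Z t *m H))%:E)%E.

Definition moment_traj (W : 'M[R]_nw) (X0 : 'M[R]_nx)
    (X : nat -> 'M[R]_nx) (Z : nat -> 'M[R]_(nx + nu)) : Prop :=
  X 0%N = X0 /\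
  forall t, [/\ psdmx (Z t), ulsubmx (Z t) = X t &
                X t.+1 = moment_map W (Z t)].

Definition val_LQRcp (Wstar : 'M[R]_nw) (H : 'M[R]_(nx + nu))
    (X0 : 'M[R]_nx) : \bar R :=
  ereal_inf [set c | exists X Z,
    moment_traj Wstar X0 X Z /\ c = moment_cost H Z].

(* A causal rule maps a history X_0, ..., X_t to Z_t; the constraints on Z_t
   can be met exactly when X_t is positive semidefinite. *)
Definition causal_rule (pi : seq 'M[R]_nx -> 'M[R]_(nx + nu)) : Prop :=
  forall (h : seq 'M[R]_nx) (X : 'M[R]_nx), psdmx X ->
    psdmx (pi (rcons h X)) /\ ulsubmx (pi (rcons h X)) = X.

(* The rule is chosen first and W, constant in time, afterwards. A bound Wlo
   that is not positive semidefinite allows W under which some X_t leaves the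
   positive semidefinite cone, where no Z_t exists. Such W are not counted in
   the inner maximum, which gives the smallest value of the problem: charging
   them an infinite cost instead can only increase it. *)
Definition val_DR (Wlo Whi : 'M[R]_nw) (H : 'M[R]_(nx + nu))
    (X0 : 'M[R]_nx) : \bar R :=
  ereal_inf [set c | exists2 pi, causal_rule pi &
    c = ereal_sup [set J | exists W X Z,
      [/\ W^T = W, loewner_le Wlo W, loewner_le W Whi &
          [/\ moment_traj W X0 X Z,
              forall t, Z t = pi (mkseq X t.+1) &
              J = moment_cost H Z]]]].

End Dynamics.

Definition matrix_display : measure_display -> measure_display.
Proof. exact. Qed.

(* Matrices carry the sigma-algebra generated by their entries, that is, the
   Borel sigma-algebra. *)
Section MatrixMeasurable.
Context {R : realType} (m n : nat).

Definition matrix_measurable : set (set 'M[R]_(m, n)) :=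
  <<s [set S | exists i j (C : set R),
         measurable C /\ S = [set M : 'M[R]_(m, n) | C (M i j)]] >>.

Let matrix_set0 : matrix_measurable set0.
Proof. exact: sigma_algebra0. Qed.

Let matrix_setC S : matrix_measurable S -> matrix_measurable (~` S).
Proof. exact: sigma_algebraC. Qed.

Let matrix_bigcup (F : (set 'M[R]_(m, n))^nat) :
  (forall i, matrix_measurable (F i)) -> matrix_measurable (\bigcup_i (F i)).
Proof. exact: sigma_algebra_bigcup. Qed.

HB.instance Definition _ := @isMeasurable.Build
  (matrix_display default_measure_display) 'M[R]_(m, n) matrix_measurable
  matrix_set0 matrix_setC matrix_bigcup.

End MatrixMeasurable.

(* Lebesgue measure on R^n: the n-fold iterated product of the Lebesgue measure
   on R (for n = 0, the Dirac mass at the only point). *)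
Fixpoint lebesgue_cV (R : realType) (n : nat) : set 'cV[R]_n -> \bar R :=
  match n return set 'cV[R]_n -> \bar R with
  | 0%N => fun S => dirac (0 : 'cV[R]_0) S
  | n'.+1 => fun S =>
      (\int[@lebesgue_measure R]_x
         lebesgue_cV
           [set y : 'cV[R]_n' | S (col_mx (const_mx x : 'cV[R]_1) y)])%E
  end.

Section Randomness.
Context {d : measure_display} {T : measurableType d} {R : realType}.
Variable P : probability T R.

Definition same_law d' (T' : measurableType d') (X Y : T -> T') : Prop :=
  forall S, measurable S -> P (X @^-1` S) = P (Y @^-1` S).

Definition ac_lebesgue n (X : T -> 'cV[R]_n) : Prop :=
  forall S, measurable S -> lebesgue_cV S = 0%E -> P (X @^-1` S) = 0%E.

Definition mutually_independent (I : choiceType) (F : I -> set (set T)) :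
    Prop :=
  forall (J : {fset I}) (E : I -> set T), (forall i, F i (E i)) ->
    P (\bigcap_(i in [set` J]) E i) = (\prod_(i <- J) P (E i))%E.

Definition second_moment n (X : T -> 'cV[R]_n) : 'M[R]_n :=
  \matrix_(i, j) fine ('E_P[fun t => (X t i 0 * X t j 0)%R])%E.

Section Control.
Context {nx nu nv : nat}.
Variables (At : 'I_nv -> 'M[R]_nx) (Bt : 'I_nv -> 'M[R]_(nx, nu)).
Variables (x0 : T -> 'cV[R]_nx) (vs : nat -> T -> 'cV[R]_nv).
Variables (xi : nat -> T -> R).

Fixpoint state (u : nat -> T -> 'cV[R]_nu) (t : nat) (w : T) : 'cV[R]_nx :=
  if t is s.+1 then
    (\sum_i vs s w i 0 *: At i) *m state u s w +
    (\sum_i vs s w i 0 *: Bt i) *m u s w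
  else x0 w.

Definition history (u : nat -> T -> 'cV[R]_nu) (t : nat) : set (set T) :=
  <<s \bigcup_(s in [set s | (s <= t)%N])
        (g_sigma_algebra_preimage (state u s) `|`
         g_sigma_algebra_preimage (xi s)) >>.

(* u_t is a measurable function of x_0, ..., x_t and of the randomization
   variables xi_0, ..., xi_t. *)
Definition causal_input (u : nat -> T -> 'cV[R]_nu) : Prop :=
  forall t, g_sigma_algebra_preimage (u t) `<=` history u t.

Definition val_SLQR (Q : 'M[R]_nx) (Ru : 'M[R]_nu) : \bar R :=
  ereal_inf [set c | exists2 u, causal_input u &
    c = (\int[P]_w \sum_(0 <= t <oo)
           (qform Q (state u t w) + qform Ru (u t w))%:E)%E].

End Control.
End Randomness.

(* Main.v *)
Require Import Defs.
From HB Require Import structures.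
From mathcomp Require Import all_boot all_order all_algebra ring lra.
From mathcomp Require Import finmap complex mxtens polyrcf.
From mathcomp Require Import all_classical all_reals all_analysis measurable_realfun.

Set Implicit Arguments.
Unset Strict Implicit.
Unset Printing Implicit Defensive.

Import Order.TTheory GRing.Theory Num.Theory.
Import numFieldNormedType.Exports.

Local Open Scope classical_set_scope.
Local Open Scope ring_scope.

(** The least-squares error is the sum over i of the weights H_i applied to
    w_i w_i^T - W_star; given the z_i, this is a sum of independent, centred and
    bounded symmetric matrices. A matrix Hoeffding inequality with the constant
    of the statement bounds it: comparing the traces of even powers one summand
    at a time gives a Khinchine inequality with the sharp Gaussian moments, and
    these are resummed into a truncated hyperbolic cosine.

    W_star itself need not lie in the confidence interval, since the design
    matrix may fail to have full column rank. Its projection W_proj does, and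
    W_proj and W_star induce the same moment map as soon as the z_i z_i^T span
    the symmetric matrices; this holds almost surely because a proper quadric
    is Lebesgue-null. Then (i) is a Lyapunov argument with Pbar, by monotonicity
    of the moment map in W, and the inequality in (ii) holds because W_proj is
    admissible in the inner maximum of (DR). For the equality in (ii), the
    second moments of (x_t, u_t) follow the moment dynamics because v_t is
    independent of the past, and conversely a generalized Schur complement turns
    each Z_t into a linear feedback u_t = K_t x_t that is no more expensive. *)

(** * The spectral theorem for real symmetric matrices *)

(** The constant in [betaW] leaves no slack: symmetrising the summands would double the deviation.
    Instead, the trace of an even power of [S + s X] is compared, as a polynomial in [s], with the
    polynomial in which every pair of factors [X] is replaced by the square of a norm bound; what is
    left in odd order is linear in [X] and has mean zero.

    The second obstacle is that the deviation bound is itself random, through [zetaW]. The sum is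
    therefore divided by it before the Hoeffding bound is applied, which requires the weights and
    their operator norms to be measurable functions of the samples. A pseudo-inverse is
    discontinuous and an operator norm is an uncountable supremum; the first is handled by fixing
    the kernel of the Gram matrix, the second by a Lipschitz estimate. Conditioning on the samples
    is expressed by a filtration whose initial sigma-algebra already contains all of them. *)

Section Spectral.
Variable R : realType.

Lemma dot_sumE n (x y : 'cV[R]_n) : (x^T *m y) 0 0 = \sum_i x i 0 * y i 0.
Proof. by rewrite mxE; apply: eq_bigr => i _; rewrite mxE. Qed.

Lemma dot_ge0 n (x : 'cV[R]_n) : 0 <= (x^T *m x) 0 0.
Proof. by rewrite dot_sumE sumr_ge0// => i _; rewrite -expr2 sqr_ge0. Qed.

Lemma dot_eq0 n (x : 'cV[R]_n) : ((x^T *m x) 0 0 == 0) = (x == 0).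
Proof.
apply/eqP/eqP => [|->]; last by rewrite mulmx0 mxE.
rewrite dot_sumE => /psumr_eq0P x0; apply/colP => i; rewrite mxE.
by apply/eqP; rewrite -sqrf_eq0 expr2; apply/eqP/x0 => // j _; rewrite -expr2 sqr_ge0.
Qed.

Lemma dot_gt0 n (x : 'cV[R]_n) : x != 0 -> 0 < (x^T *m x) 0 0.
Proof. by move=> x0; rewrite lt_neqAle eq_sym dot_eq0 x0 dot_ge0. Qed.

Lemma dotC n (x y : 'cV[R]_n) : (x^T *m y) 0 0 = (y^T *m x) 0 0.
Proof. by rewrite !dot_sumE; apply: eq_bigr => i _; rewrite mulrC. Qed.

Lemma trmxZ m n a (M : 'M[R]_(m, n)) : (a *: M)^T = a *: M^T.
Proof. exact: linearZ. Qed.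

Lemma trmxB m n (M N : 'M[R]_(m, n)) : (M - N)^T = M^T - N^T.
Proof. exact: linearB. Qed.

Lemma trmxD m n (M N : 'M[R]_(m, n)) : (M + N)^T = M^T + N^T.
Proof. exact: linearD. Qed.

Lemma mulmx_complex_parts n (v : 'rV[R[i]]_n) (M : 'M[R]_n) :
  map_mx (@complex.Re R) (v *m map_mx (real_complex R) M) =
    map_mx (@complex.Re R) v *m M /\
  map_mx (@complex.Im R) (v *m map_mx (real_complex R) M) =
    map_mx (@complex.Im R) v *m M.
Proof.
have ReD : {morph @complex.Re R : x y / x + y} by move=> [a b] [c d].
have ImD : {morph @complex.Im R : x y / x + y} by move=> [a b] [c d].
split; apply/rowP => j; rewrite !mxE.
  rewrite (big_morph _ ReD (erefl : complex.Re 0 = 0)).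
  by apply: eq_bigr => k _; rewrite !mxE; case: (v 0 k) => a b /=; ring.
rewrite (big_morph _ ImD (erefl : complex.Im 0 = 0)).
by apply: eq_bigr => k _; rewrite !mxE; case: (v 0 k) => a b /=; ring.
Qed.

(** A complex eigenvector [p + i q] with eigenvalue [a + i b] exists by algebraic closedness.
    Symmetry of [S] equates [p S q^T] and [q S p^T], which forces [b (|p|^2 + |q|^2) = 0]: the
    eigenvalue is real, and whichever part is nonzero is a real eigenvector. *)
Lemma sym_real_eigenvector n (S : 'M[R]_n.+1) : S^T = S ->
  exists a (x : 'cV[R]_n.+1), x != 0 /\ S *m x = a *: x.
Proof.
move=> sS; have [l] := eigenvalue_closed (map_mx (real_complex R) S) (ltn0Sn n).
case/eigenvalueP => v vS v0; case: (mulmx_complex_parts v S); rewrite vS.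
set p := map_mx (@complex.Re R) v; set q := map_mx (@complex.Im R) v.
case: l {vS} => a b.
have -> : map_mx (@complex.Re R) ((a +i* b)%C *: v) = a *: p - b *: q.
  by apply/rowP => j; rewrite !mxE; case: (v 0 j).
have -> : map_mx (@complex.Im R) ((a +i* b)%C *: v) = a *: q + b *: p.
  by apply/rowP => j; rewrite !mxE; case: (v 0 j) => c d /=; ring.
move=> pS qS.
have pq0 : (p^T != 0) || (q^T != 0).
  rewrite -negb_and; apply: contra v0 => /andP[/eqP p0 /eqP q0].
  apply/eqP/rowP => j; rewrite mxE.
  move/colP/(_ j): p0; move/colP/(_ j): q0; rewrite !mxE.
  by case: (v 0 j) => c d /= -> ->.
have b0 : b = 0.
  have : (p *m S *m q^T) 0 0 = (q *m S *m p^T) 0 0.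
    transitivity ((p *m S *m q^T)^T 0 0); first by rewrite [RHS]mxE.
    by rewrite !trmx_mul trmxK sS mulmxA.
  rewrite -pS -qS !mulmxDl mulNmx -!scalemxAl !mxE.
  have := dotC p^T q^T; have := dot_ge0 p^T; have := dot_ge0 q^T.
  have : 0 < (p^T^T *m p^T) 0 0 + (q^T^T *m q^T) 0 0.
    by case/orP: pq0 => /dot_gt0 h; have := dot_ge0 p^T; have := dot_ge0 q^T; lra.
  rewrite !trmxK !mxE.
  set u := \sum_j _; set w := \sum_j _; set s := \sum_j _; set t := \sum_j _.
  move=> uw w0 u0 st h; have /eqP : b * (u + w) = 0 by rewrite st in h; lra.
  by rewrite mulf_eq0 (gt_eqF uw) orbF => /eqP.
have tr (y : 'rV[R]_n.+1) : a *: y = y *m S -> S *m y^T = a *: y^T.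
  by move=> h; rewrite -{1}sS -trmx_mul -h linearZ.
case/orP: pq0 => h; exists a; [exists p^T|exists q^T]; split=> //; apply: tr.
  by rewrite -pS b0 scale0r subr0.
by rewrite -qS b0 scale0r addr0.
Qed.

(** The Householder reflection in the hyperplane orthogonal to [u = x - e]; it is its own inverse
    and swaps [e] with the unit vector [x]. *)
Lemma reflection_exists n (x : 'cV[R]_n.+1) : (x^T *m x) 0 0 = 1 ->
  exists U : 'M[R]_n.+1, [/\ U^T = U, U *m U = 1%:M & U *m delta_mx 0 0 = x].
Proof.
move=> x1; set e : 'cV[R]_n.+1 := delta_mx 0 0.
have [xe|xe] := eqVneq x e.
  by exists 1%:M; rewrite trmx1 !mul1mx xe.
set u := x - e; have u0 : u != 0 by rewrite subr_eq0.
set s := (u^T *m u) 0 0; have s0 : 0 < s by exact: dot_gt0.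
have ee : (e^T *m e) 0 0 = 1.
  by rewrite dot_sumE (bigD1 0)//= !mxE !eqxx mulr1 big1 ?addr0// => i i0; rewrite !mxE (negbTE i0) mulr0.
have sE : s = 2 - 2 * (x^T *m e) 0 0.
  rewrite /s (_ : u^T = x^T - e^T); last exact: trmxB.
  rewrite /u mulmxBl !mulmxBr !mxE.
  move: (x1) ee (dotC e x); rewrite !mxE; lra.
have ueE : (u^T *m e) 0 0 = - (s / 2).
  rewrite sE (_ : u^T = x^T - e^T); last exact: trmxB.
  by rewrite mulmxBl [LHS]mxE [X in _ + X]mxE ee; field.
have uuT : u *m u^T *m (u *m u^T) = s *: (u *m u^T).
  rewrite mulmxA -(mulmxA u) (mx11_scalar (u^T *m u)) -/s.
  by rewrite mul_mx_scalar -scalemxAl.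
exists (1%:M - (2 / s) *: (u *m u^T)); split.
- by rewrite trmxB trmxZ trmx1 trmx_mul trmxK.
- rewrite mulmxBl mul1mx mulmxBr mulmx1 -scalemxAl -scalemxAr uuT !scalerA.
  apply/matrixP => i j; rewrite !mxE.
  by field; rewrite gt_eqF.
- rewrite mulmxBl mul1mx -scalemxAl -mulmxA (mx11_scalar (u^T *m e)) ueE.
  rewrite mul_mx_scalar scalerA (_ : _ / s * _ = -1); last by field; rewrite gt_eqF.
  by rewrite scaleN1r opprK /u addrC subrK.
Qed.

(** Deflation: conjugation by a reflection that carries the first basis vector to a unit eigenvector
    turns the first column into a multiple of that basis vector. Symmetry clears the first row as
    well, and the induction hypothesis diagonalises the remaining block. *)
Theorem sym_spectral n (S : 'M[R]_n) : S^T = S ->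
  exists (U : 'M[R]_n) (D : 'rV[R]_n),
    U^T *m U = 1%:M /\ S = U^T *m diag_mx D *m U.
Proof.
elim: n S => [|n IH] S sS.
  by exists 1%:M, 0; split; [rewrite trmx1 mul1mx|apply/matrixP => -[]].
have [a [x [x0 Sx]]] := sym_real_eigenvector sS.
pose c := Num.sqrt ((x^T *m x) 0 0).
have c0 : 0 < c by rewrite sqrtr_gt0 dot_gt0.
have [|U [sU UU Ue]] := @reflection_exists _ (c^-1 *: x).
  rewrite trmxZ -scalemxAl -scalemxAr scalerA mxE -expr2.
  rewrite -(sqr_sqrtr (dot_ge0 x)) -/c -exprMn mulVf ?expr1n//.
  by rewrite gt_eqF.
set e : 'cV[R]_n.+1 := delta_mx 0 0 in Ue.
have Uex : U *m S *m U *m e = a *: e.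
  rewrite -!mulmxA Ue -scalemxAr Sx scalerA (mulrC _ a) -scalerA -scalemxAr.
  by rewrite -Ue mulmxA UU mul1mx.
pose T : 'M[R]_(1 + n) := U *m S *m U.
have sT : T^T = T by rewrite /T !trmx_mul sU sS mulmxA.
have Tcol i : T i 0 = a * (i == 0)%:R.
  move/colP/(_ i): Uex; rewrite -/T [LHS]mxE [RHS]mxE mxE andbT => <-.
  rewrite (bigD1 0)//= [e 0 0]mxE !eqxx mulr1 big1 ?addr0// => j j0.
  by rewrite [e j 0]mxE (negbTE j0) mulr0.
have SE : S = U *m T *m U.
  by rewrite /T !mulmxA UU mul1mx -mulmxA UU mulmx1.
clearbody T; have l0 (j : 'I_1) : lshift n j = 0 :> 'I_(1 + n) by rewrite ord1; exact: val_inj.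
have Tdl : dlsubmx T = 0.
  by apply/matrixP => i j; rewrite !mxE l0 Tcol mulr0.
have Tur : ursubmx T = 0 by rewrite -[T]sT -trmx_dlsub Tdl trmx0.
have Tul : ulsubmx T = a%:M.
  by apply/matrixP => i j; rewrite !mxE !l0 Tcol mulr1 !ord1 mulr1n.
have [|V [D [VV drE]]] := IH (drsubmx T); first by rewrite trmx_drsub sT.
have TE : T = block_mx a%:M 0 0 (drsubmx T) by rewrite -[LHS]submxK Tdl Tur Tul.
pose V1 : 'M[R]_(1 + n) := block_mx 1%:M 0 0 V.
have V1T : V1^T = block_mx 1%:M 0 0 V^T.
  by rewrite /V1 tr_block_mx !trmx0 trmx1.
pose D1 : 'rV[R]_(1 + n) := row_mx (a%:M : 'M[R]_1) D.
have V1V1 : V1^T *m V1 = 1%:M.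
  rewrite V1T /V1 mulmx_block !mulmx0 !mul0mx !addr0 add0r VV mulmx1.
  by rewrite -scalar_mx_block.
have TE1 : T = V1^T *m diag_mx D1 *m V1.
  rewrite V1T /V1 /D1 TE drE diag_mx_row !mulmx_block.
  rewrite !mulmx0 !mul0mx !addr0 !add0r mul1mx mulmx1.
  rewrite !mul0mx; congr block_mx.
  by apply/matrixP => i j; rewrite !mxE !ord1.
exists (V1 *m U), D1; split.
  by rewrite trmx_mul -mulmxA (mulmxA V1^T) V1V1 mul1mx sU.
by rewrite trmx_mul SE TE1 sU !mulmxA.
Qed.

End Spectral.

(** * Quadratic forms and the positive semidefinite order *)

Section Semidefinite.
Variable R : realType.

Lemma qform_cong m n (C : 'M[R]_(m, n)) (A : 'M[R]_m) x :
  qform (C^T *m A *m C) x = qform A (C *m x).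
Proof. by rewrite /qform trmx_mul !mulmxA. Qed.

Lemma qformD n (A B : 'M[R]_n) x : qform (A + B) x = qform A x + qform B x.
Proof. by rewrite /qform mulmxDr mulmxDl mxE. Qed.

Lemma qformN n (A : 'M[R]_n) x : qform (- A) x = - qform A x.
Proof. by rewrite /qform mulmxN mulNmx mxE. Qed.

Lemma qformZ n a (A : 'M[R]_n) x : qform (a *: A) x = a * qform A x.
Proof. by rewrite /qform -scalemxAr -scalemxAl mxE. Qed.

Lemma qform_scalar n a (x : 'cV[R]_n) : qform a%:M x = a * (x^T *m x) 0 0.
Proof. by rewrite /qform mul_mx_scalar -scalemxAl mxE. Qed.

Lemma qform_addZ n (A : 'M[R]_n) s x y :
  qform A (x + s *: y) = qform A x + s * (x^T *m A *m y) 0 0 +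
    s * (y^T *m A *m x) 0 0 + s ^+ 2 * qform A y.
Proof.
rewrite /qform trmxD trmxZ mulmxDl !mulmxDr !mulmxDl -!scalemxAl -!scalemxAr.
set p := x^T *m A *m x; set q := x^T *m A *m y; set r := y^T *m A *m x.
by set t := y^T *m A *m y; clearbody p q r t; rewrite !mxE; ring.
Qed.

Lemma qform_dyad n (y x : 'cV[R]_n) : qform (y *m y^T) x = (y^T *m x) 0 0 ^+ 2.
Proof.
rewrite /qform mulmxA -(mulmxA (x^T *m y)) expr2 [LHS]mxE big_ord1.
by rewrite [in X in X * _]dotC.
Qed.

Lemma psdmx0 n : psdmx (0 : 'M[R]_n).
Proof. by split=> [|x]; rewrite ?trmx0// /qform mulmx0 mul0mx mxE. Qed.

Lemma psdmxD n (A B : 'M[R]_n) : psdmx A -> psdmx B -> psdmx (A + B).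
Proof.
case=> sA pA [sB pB]; split=> [|x]; first by rewrite trmxD sA sB.
by rewrite qformD addr_ge0.
Qed.

Lemma psdmxZ n a (A : 'M[R]_n) : 0 <= a -> psdmx A -> psdmx (a *: A).
Proof.
move=> a0 [sA pA]; split=> [|x]; first by rewrite trmxZ sA.
by rewrite qformZ mulr_ge0.
Qed.

Lemma psdmx_sum n I (r : seq I) (F : I -> 'M[R]_n) :
  (forall i, psdmx (F i)) -> psdmx (\sum_(i <- r) F i).
Proof.
move=> pF; apply: (big_ind (@psdmx R n)) => //; first exact: psdmx0.
by move=> ? ?; exact: psdmxD.
Qed.

Lemma psdmx_scalar n a : 0 <= a -> psdmx (a%:M : 'M[R]_n).
Proof.
move=> a0; split=> [|x]; first by rewrite tr_scalar_mx.
by rewrite qform_scalar mulr_ge0// dot_ge0.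
Qed.

Lemma psdmx_cong m n (C : 'M[R]_(m, n)) (A : 'M[R]_n) :
  psdmx A -> psdmx (C *m A *m C^T).
Proof.
case=> sA pA; split=> [|x]; first by rewrite !trmx_mul trmxK sA mulmxA.
by rewrite -{1}(trmxK C) qform_cong.
Qed.

Lemma psdmx_mulT m n (C : 'M[R]_(m, n)) : psdmx (C *m C^T).
Proof. by have := psdmx_cong C (psdmx_scalar n ler01); rewrite mulmx1. Qed.

Lemma pdmx_psdmx n (A : 'M[R]_n) : pdmx A -> psdmx A.
Proof.
case=> sA pA; split=> // x; have [->|/pA/ltW//] := eqVneq x 0.
by rewrite /qform mulmx0 mxE.
Qed.

Lemma loewner_refl n (A : 'M[R]_n) : loewner_le A A.
Proof. by rewrite /loewner_le subrr; exact: psdmx0. Qed.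

Lemma loewner_trans n (A B C : 'M[R]_n) :
  loewner_le A B -> loewner_le B C -> loewner_le A C.
Proof.
by rewrite /loewner_le => AB BC; rewrite -(subrK B C) -addrA; exact: psdmxD.
Qed.

Lemma psdmx_le n (A B : 'M[R]_n) : psdmx A -> loewner_le A B -> psdmx B.
Proof. by move=> A0 AB; rewrite -(subrK A B); apply: psdmxD. Qed.

Lemma qform_diag n (D : 'rV[R]_n) x :
  qform (diag_mx D) x = \sum_i D 0 i * x i 0 ^+ 2.
Proof.
rewrite /qform -mulmxA dot_sumE; apply: eq_bigr => i _.
by rewrite mul_diag_mx mxE; ring.
Qed.

(** The columns of [U^T] are eigenvectors, so any bound on the quadratic form becomes a bound on
    each diagonal entry of [D]. *)
Lemma qform_eigen n (U : 'M[R]_n) (D : 'rV[R]_n) i : U^T *m U = 1%:M ->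
  qform (U^T *m diag_mx D *m U) (U^T *m delta_mx i 0) = D 0 i.
Proof.
move=> /mulmx1C UU; rewrite -qform_cong trmxK !mulmxA UU.
rewrite mul1mx -mulmxA UU mulmx1 qform_diag (bigD1 i)//= !mxE !eqxx.
rewrite mulr1n expr1n mulr1 big1 ?addr0// => j ji.
by rewrite mxE (negbTE ji) mulr0n expr0n mulr0.
Qed.

Lemma psdmx_factor n (A : 'M[R]_n) : psdmx A ->
  exists L : 'M[R]_n, A = L *m L^T.
Proof.
case=> sA pA; have [U [D [UU AE]]] := sym_spectral sA.
have D0 i : 0 <= D 0 i.
  by have := pA (U^T *m delta_mx i 0); rewrite AE qform_eigen.
exists (U^T *m diag_mx (map_mx Num.sqrt D)).
rewrite AE trmx_mul trmxK tr_diag_mx !mulmxA; congr (_ *m _).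
rewrite -mulmxA; congr (_ *m _).
apply/matrixP => i j; rewrite mul_diag_mx !mxE.
by case: eqVneq => [->|]; rewrite ?mulr1n ?mulr0n ?mulr0// -expr2 sqr_sqrtr.
Qed.

(** With [A = L L^T], the trace is the sum of the quadratic form of [B] over the columns of [L]. *)
Lemma trace_mul_psd_ge0 n (A B : 'M[R]_n) :
  psdmx A -> psdmx B -> 0 <= \tr (A *m B).
Proof.
move=> /psdmx_factor[L ->] [_ pB]; rewrite -mulmxA mxtrace_mulC.
rewrite /mxtrace sumr_ge0// => i _.
have -> : (L^T *m B *m L) i i = qform B (col i L).
  rewrite /qform tr_col -row_mul [LHS]mxE [RHS]mxE; apply: eq_bigr => k _.
  by rewrite [row _ _ _ _]mxE [col _ _ _ _]mxE.
exact: pB.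
Qed.

Lemma finite_pos_lower_bound (I : finType) (f : I -> R) :
  (forall i, 0 < f i) -> exists2 p : R, 0 < p & forall i, p <= f i.
Proof.
(* The summand 1 keeps [s] positive when [I] is empty, and [s] dominates every [(f i)^-1]. *)
move=> f0; pose s := 1 + \sum_i (f i)^-1.
have s0 : 0 < s.
  by rewrite ltr_pwDl// sumr_ge0// => i _; rewrite invr_ge0 ltW.
exists s^-1; first by rewrite invr_gt0.
move=> i; rewrite invf_ple ?posrE// /s (bigD1 i)//=.
rewrite addrCA ler_wpDr// addr_ge0// sumr_ge0// => j _.
by rewrite invr_ge0 ltW.
Qed.

Lemma pdmx_lower_bound n (A : 'M[R]_n) : pdmx A ->
  exists2 p : R, 0 < p & loewner_le p%:M A.
Proof.
case=> sA pA; have [U [D [UU AE]]] := sym_spectral sA.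
have UU' : U *m U^T = 1%:M by exact: mulmx1C.
have D0 i : 0 < D 0 i.
  have x0 : U^T *m delta_mx i 0 != 0 :> 'cV[R]_n.
    apply/eqP => /(congr1 (mulmx U)); rewrite mulmxA UU' mul1mx mulmx0.
    by move/colP/(_ i)/eqP; rewrite !mxE !eqxx oner_eq0.
  by have := pA _ x0; rewrite AE qform_eigen.
have [p p0 pD] := finite_pos_lower_bound D0.
exists p => //; rewrite /loewner_le.
have -> : A - p%:M = U^T *m diag_mx (D - const_mx p) *m U.
  rewrite linearB /= diag_const_mx mulmxBr mulmxBl -AE.
  by rewrite mul_mx_scalar -scalemxAl UU scale_scalar_mx mulr1.
rewrite -{2}(trmxK U); apply: psdmx_cong; split=> [|x].
  by rewrite tr_diag_mx.
rewrite qform_diag sumr_ge0// => i _.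
by rewrite mulr_ge0 ?sqr_ge0// !mxE subr_ge0.
Qed.

Lemma sym_upper_bound n (A : 'M[R]_n) : A^T = A ->
  exists2 p : R, 0 < p & loewner_le A p%:M.
Proof.
move=> sA; have [U [D [UU AE]]] := sym_spectral sA.
pose p := 1 + \sum_i `|D 0 i|.
have p0 : 0 < p by rewrite ltr_pwDl// sumr_ge0.
exists p => //; rewrite /loewner_le.
have -> : p%:M - A = U^T *m diag_mx (const_mx p - D) *m U.
  rewrite linearB /= diag_const_mx mulmxBr mulmxBl -AE.
  by rewrite mul_mx_scalar -scalemxAl UU scale_scalar_mx mulr1.
rewrite -{2}(trmxK U); apply: psdmx_cong; split=> [|x].
  by rewrite tr_diag_mx.
rewrite qform_diag sumr_ge0// => i _.
rewrite mulr_ge0 ?sqr_ge0// !mxE subr_ge0 (le_trans (ler_norm _))//.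
by rewrite /p (bigD1 i)//= addrCA ler_wpDr// addr_ge0// sumr_ge0.
Qed.

Lemma psdmx_diag_ge0 n (A : 'M[R]_n) i : psdmx A -> 0 <= A i i.
Proof.
case=> _ /(_ (delta_mx i 0)); rewrite /qform -colE trmx_delta -rowE.
by rewrite !mxE.
Qed.

Lemma psdmx_entry_le n (A : 'M[R]_n) i j : psdmx A -> `|A i j| <= \tr A.
Proof.
move=> pA; have d k : 0 <= A k k := psdmx_diag_ge0 k pA.
have [ij|ij] := eqVneq i j.
  subst j; rewrite ger0_norm// /mxtrace (bigD1 i)//= lerDl.
  by rewrite sumr_ge0.
have tr : A i i + A j j <= \tr A.
  rewrite /mxtrace (bigD1 i)//= (bigD1 j) 1?eq_sym//= addrA lerDl.
  by rewrite sumr_ge0.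
have Aji : A j i = A i j by rewrite -[in LHS](proj1 pA) mxE.
(* Testing on [e_i + s e_j] with [s = 1] and [s = -1] gives [2 |A_ij| <= A_ii + A_jj]. *)
have q s : 0 <= A i i + s * A i j + s * A i j + s ^+ 2 * A j j.
  have := proj2 pA (delta_mx i 0 + s *: delta_mx j 0).
  rewrite qform_addZ /qform !trmx_delta -!rowE -!colE !mxE Aji; lra.
have := q 1; have := q (-1); rewrite ler_norml => h1 h2; apply/andP; split; lra.
Qed.

End Semidefinite.

(** * Operator norms *)

Section Norms.
Variable R : realType.

Lemma enorm_ge0 n (x : 'cV[R]_n) : 0 <= enorm x.
Proof. exact: sqrtr_ge0. Qed.

Lemma enorm_sq n (x : 'cV[R]_n) : enorm x ^+ 2 = (x^T *m x) 0 0.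
Proof.
rewrite /enorm sqr_sqrtr; last by rewrite sumr_ge0// => i _; exact: sqr_ge0.
by rewrite dot_sumE; apply: eq_bigr => i _; rewrite expr2.
Qed.

Lemma enorm0 n : enorm (0 : 'cV[R]_n) = 0.
Proof. by apply/eqP; rewrite -sqrf_eq0 enorm_sq dot_eq0. Qed.

Lemma enorm_eq0 n (x : 'cV[R]_n) : (enorm x == 0) = (x == 0).
Proof. by rewrite -sqrf_eq0 enorm_sq dot_eq0. Qed.

Lemma enormZ n a (x : 'cV[R]_n) : enorm (a *: x) = `|a| * enorm x.
Proof.
apply/eqP; rewrite -(eqrXn2 (ltn0Sn 1)) ?mulr_ge0 ?enorm_ge0//.
rewrite exprMn !enorm_sq trmxZ -scalemxAl -scalemxAr scalerA mxE.
by rewrite -expr2 -normrX ger0_norm// sqr_ge0.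
Qed.

Lemma cauchy_schwarz n (x y : 'cV[R]_n) : `|(x^T *m y) 0 0| <= enorm x * enorm y.
Proof.
rewrite -(ler_pXn2r (ltn0Sn 1)) ?nnegrE ?mulr_ge0 ?enorm_ge0//.
rewrite -normrX ger0_norm ?sqr_ge0// exprMn !enorm_sq.
set a := (x^T *m x) 0 0; set b := (y^T *m y) 0 0; set c := (x^T *m y) 0 0.
have key s t : 0 <= s ^+ 2 * a + 2 * s * t * c + t ^+ 2 * b.
  have := dot_ge0 (s *: x + t *: y).
  rewrite trmxD !trmxZ mulmxDl !mulmxDr -!scalemxAl -!scalemxAr !scalerA.
  have := dotC y x; rewrite -/c.
  set p := y^T *m x; rewrite /a /b /c.
  set q := x^T *m y; set r := x^T *m x; set u := y^T *m y.
  by clearbody p q r u; rewrite !mxE => ->; lra.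
have := key b (- c); have := key c (- a); have := dot_ge0 x; have := dot_ge0 y.
rewrite -/a -/b; have [a0 b0 a0' _ h|a0 _ _] := eqVneq a 0.
  have : 0 <= - (c ^+ 2 * (b + 1)).
    by have := key (b + 1) (- c); have := key 1 (- c); rewrite a0; nra.
  rewrite oppr_ge0 pmulr_lle0 ?ltr_wpDl// => c2.
  by rewrite a0 mul0r.
move=> h _; have a1 : 0 < a by rewrite lt_neqAle eq_sym a0 dot_ge0.
suff : 0 <= a * (a * b - c ^+ 2) by rewrite pmulr_rge0// subr_ge0.
by move: h; nra.
Qed.

Lemma enorm_triangle n (x y : 'cV[R]_n) : enorm (x + y) <= enorm x + enorm y.
Proof.
rewrite -(ler_pXn2r (ltn0Sn 1)) ?nnegrE ?addr_ge0 ?enorm_ge0//.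
have : (x + y)^T *m (x + y) = x^T *m x + x^T *m y + (y^T *m x + y^T *m y).
  by rewrite trmxD mulmxDl !mulmxDr addrACA [RHS]addrACA [in RHS]addrACA addrC !addrA.
have := le_trans (ler_norm _) (cauchy_schwarz x y); have := dotC y x.
rewrite enorm_sq => h1 h2 ->; move: h1 h2; rewrite sqrrD !enorm_sq.
set p := x^T *m x; set q := x^T *m y; set r := y^T *m x; set t := y^T *m y.
clearbody p q r t; rewrite !mxE mulr2n; lra.
Qed.

Lemma mx_bounded m n (A : 'M[R]_(m, n)) :
  exists2 c : R, 0 <= c & forall x, enorm (A *m x) <= c * enorm x.
Proof.
have [|p p0 [_ pA]] := @sym_upper_bound _ _ (A^T *m A).
  by rewrite trmx_mul trmxK.
exists (Num.sqrt p); first exact: sqrtr_ge0.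
move=> x; rewrite -(ler_pXn2r (ltn0Sn 1)) ?nnegrE ?mulr_ge0 ?enorm_ge0 ?sqrtr_ge0//.
rewrite exprMn (sqr_sqrtr (ltW p0)) !enorm_sq; have := pA x.
rewrite qformD qformN qform_scalar subr_ge0 /qform.
by rewrite trmx_mul !mulmxA.
Qed.

Lemma has_sup_specnorm m n (A : 'M[R]_(m, n)) :
  has_sup [set enorm (A *m x) | x in [set x | enorm x <= 1]].
Proof.
split; first by exists (enorm (A *m 0)), 0 => //=; rewrite enorm0 ler01.
have [c c0 cA] := mx_bounded A; exists c => _ [x /= x1 <-].
by rewrite (le_trans (cA x))// ler_piMr.
Qed.

Lemma specnorm_ge0 m n (A : 'M[R]_(m, n)) : 0 <= specnorm A.
Proof.
rewrite (@le_trans _ _ (enorm (A *m 0)))// ?enorm_ge0//.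
apply: sup_upper_bound; first exact: has_sup_specnorm.
by exists 0 => //=; rewrite enorm0 ler01.
Qed.

Lemma specnorm_bound m n (A : 'M[R]_(m, n)) x :
  enorm (A *m x) <= specnorm A * enorm x.
Proof.
have [->|x0] := eqVneq x 0; first by rewrite mulmx0 !enorm0 mulr0.
have nx : 0 < enorm x by rewrite lt_neqAle eq_sym enorm_eq0 x0 enorm_ge0.
rewrite -ler_pdivrMr//; apply: sup_upper_bound; first exact: has_sup_specnorm.
exists ((enorm x)^-1 *: x) => /=.
  by rewrite enormZ ger0_norm ?invr_ge0 ?enorm_ge0// mulVf// gt_eqF.
by rewrite -scalemxAr enormZ ger0_norm ?invr_ge0 ?enorm_ge0// mulrC.
Qed.

Lemma specnorm_le m n (A : 'M[R]_(m, n)) c : 0 <= c ->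
  (forall x, enorm (A *m x) <= c * enorm x) -> specnorm A <= c.
Proof.
move=> c0 cA; apply: ge_sup; first exact: (has_sup_specnorm A).1.
by move=> _ [x /= x1 <-]; rewrite (le_trans (cA x))// ler_piMr.
Qed.

Lemma specnormD m n (A B : 'M[R]_(m, n)) :
  specnorm (A + B) <= specnorm A + specnorm B.
Proof.
apply: specnorm_le => [|x]; first by rewrite addr_ge0 ?specnorm_ge0.
rewrite mulmxDl (le_trans (enorm_triangle _ _))// mulrDl lerD//;
exact: specnorm_bound.
Qed.

Lemma specnormZ_le m n a (A : 'M[R]_(m, n)) :
  specnorm (a *: A) <= `|a| * specnorm A.
Proof.
apply: specnorm_le => [|x]; first by rewrite mulr_ge0 ?specnorm_ge0.
by rewrite -scalemxAl enormZ -mulrA ler_wpM2l// specnorm_bound.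
Qed.

Lemma specnorm0 m n : specnorm (0 : 'M[R]_(m, n)) = 0.
Proof.
apply/eqP; rewrite eq_le specnorm_ge0 andbT; apply: specnorm_le => // x.
by rewrite mul0mx enorm0 mul0r.
Qed.

Lemma specnorm_sum m n I (r : seq I) (F : I -> 'M[R]_(m, n)) :
  specnorm (\sum_(i <- r) F i) <= \sum_(i <- r) specnorm (F i).
Proof.
elim: r => [|i r IH]; first by rewrite !big_nil specnorm0.
by rewrite !big_cons (le_trans (specnormD _ _))// lerD2l.
Qed.

Lemma entry_le_specnorm m n (A : 'M[R]_(m, n)) i j : `|A i j| <= specnorm A.
Proof.
have d k (p : 'I_k) : enorm (delta_mx p 0 : 'cV[R]_k) = 1.
  apply/eqP; rewrite -(eqrXn2 (ltn0Sn 1)) ?enorm_ge0// expr1n enorm_sq.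
  by rewrite trmx_delta mul_delta_mx mxE !eqxx.
have := cauchy_schwarz (delta_mx i 0) (A *m delta_mx j 0).
rewrite trmx_delta mulmxA -rowE -colE !mxE d mul1r => h.
by rewrite (le_trans h)// (le_trans (specnorm_bound _ _))// d mulr1.
Qed.

Lemma specnorm_eq0 m n (A : 'M[R]_(m, n)) : specnorm A = 0 -> A = 0.
Proof.
move=> A0; apply/matrixP => i j; rewrite mxE; apply/eqP.
by rewrite -normr_le0 -A0 entry_le_specnorm.
Qed.

(** For a symmetric matrix the norm is the numerical radius: testing the form at eigenvectors bounds
    all eigenvalues, and in the eigenbasis [A] multiplies by them. *)
Lemma specnorm_sym_le n (A : 'M[R]_n) c : 0 <= c -> A^T = A ->
  (forall x, `|qform A x| <= c * (x^T *m x) 0 0) -> specnorm A <= c.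
Proof.
move=> c0 sA h; have [U [D [UU AE]]] := sym_spectral sA.
have UU' : U *m U^T = 1%:M by exact: mulmx1C.
have Dc i : D 0 i ^+ 2 <= c ^+ 2.
  rewrite -[X in X <= _]ger0_norm ?sqr_ge0// normrX lerXn2r ?nnegrE//.
  have := h (U^T *m delta_mx i 0); rewrite {1}AE qform_eigen//.
  rewrite trmx_mul trmxK mulmxA -(mulmxA _ U) UU' mulmx1 trmx_delta.
  by rewrite mul_delta_mx mxE !eqxx mulr1.
apply: specnorm_le => // x.
rewrite -(ler_pXn2r (ltn0Sn 1)) ?nnegrE ?mulr_ge0 ?enorm_ge0//.
rewrite exprMn !(@enorm_sq _).
have -> : x^T *m x = (U *m x)^T *m (U *m x).
  by rewrite trmx_mul mulmxA -(mulmxA _ _ U) UU mulmx1.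
have -> : (A *m x)^T *m (A *m x) =
    (diag_mx D *m (U *m x))^T *m (diag_mx D *m (U *m x)).
  rewrite AE -!mulmxA trmx_mul -(mulmxA _ _ (U^T *m _)) trmxK.
  by rewrite (mulmxA U) UU' mul1mx.
rewrite !dot_sumE mulr_sumr ler_sum// => i _.
by rewrite mul_diag_mx mxE -!expr2 exprMn ler_wpM2r// sqr_ge0.
Qed.

End Norms.

(** * Moore-Penrose inverses *)

Section Penrose.
Variable R : realType.

Lemma gram_unit m n (C : 'M[R]_(m, n)) : row_free C -> C *m C^T \in unitmx.
Proof.
move=> fC; rewrite -row_free_unit -kermx_eq0; apply/rowV0P => v /sub_kermxP vC.
have : ((v *m C)^T^T *m (v *m C)^T) 0 0 == 0.
  by rewrite trmxK trmx_mul mulmxA -(mulmxA v) vC mul0mx mxE.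
rewrite dot_eq0 => /eqP /(congr1 trmx); rewrite trmxK trmx0 => vC0.
by apply: (row_free_inj fC); rewrite vC0 mul0mx.
Qed.

(** A full-rank factorisation [A = C D] yields the explicit inverse [D^T (D D^T)^-1 (C^T C)^-1 C^T],
    both Gram matrices being invertible. *)
Lemma penrose_exists m n (A : 'M[R]_(m, n)) : exists B, penrose A B.
Proof.
have [r [C [D [AE fD fC]]]] : exists r (C : 'M[R]_(m, r)) (D : 'M[R]_(r, n)),
    [/\ A = C *m D, row_free D & row_full C].
  exists (\rank A), (col_base A), (row_base A).
  by rewrite mulmx_base row_base_free col_base_full.
have uD : D *m D^T \in unitmx by rewrite gram_unit.
have uC : C^T *m C \in unitmx.
  by rewrite -{2}(trmxK C) gram_unit// /row_free mxrank_tr.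
exists (D^T *m invmx (D *m D^T) *m (invmx (C^T *m C) *m C^T)).
have AB : A *m (D^T *m invmx (D *m D^T) *m (invmx (C^T *m C) *m C^T)) =
    C *m invmx (C^T *m C) *m C^T.
  rewrite AE !mulmxA -(mulmxA C D) -(mulmxA C (D *m _)).
  by rewrite mulmxV// mulmx1.
have BA : D^T *m invmx (D *m D^T) *m (invmx (C^T *m C) *m C^T) *m A =
    D^T *m invmx (D *m D^T) *m D.
  rewrite AE -!mulmxA; congr (_ *m (_ *m _)).
  by rewrite (mulmxA C^T) mulmxA mulVmx// mul1mx.
have symV k (M : 'M[R]_k) : M^T = M -> (invmx M)^T = invmx M.
  by move=> sM; rewrite trmx_inv sM.
split.
- rewrite AB AE -!mulmxA (mulmxA C^T) (mulmxA _ (C^T *m C)) mulVmx//.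
  by rewrite mul1mx.
- rewrite BA -!mulmxA; congr (_ *m (_ *m _)).
  by rewrite (mulmxA D) (mulmxA (D *m D^T)) mulmxV// mul1mx.
- by rewrite AB !trmx_mul trmxK symV ?mulmxA// trmx_mul trmxK.
- by rewrite BA !trmx_mul trmxK symV ?mulmxA// trmx_mul trmxK.
Qed.

Lemma penrose_unique m n (A : 'M[R]_(m, n)) B C :
  penrose A B -> penrose A C -> B = C.
Proof.
move=> [a1 a2 a3 a4] [b1 b2 b3 b4].
have AA : A *m B = A *m C.
  have e : A *m B = A *m C *m (A *m B) by rewrite mulmxA b1.
  by rewrite -a3 e trmx_mul a3 b3 mulmxA a1.
have BB : B *m A = C *m A.
  have e : B *m A = B *m A *m (C *m A) by rewrite -(mulmxA B) (mulmxA A) b1.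
  by rewrite -a4 e trmx_mul b4 a4 -(mulmxA C) (mulmxA A) a1.
by rewrite -a2 -mulmxA AA mulmxA BB b2.
Qed.

Lemma mpinvP m n (A : 'M[R]_(m, n)) : penrose A (mpinv A).
Proof.
by have [B AB] := penrose_exists A; apply: (@xgetPex _ 0 [set B | penrose A B]); exists B.
Qed.

Lemma mpinv_eq m n (A : 'M[R]_(m, n)) B : penrose A B -> mpinv A = B.
Proof. by move=> AB; apply: penrose_unique AB; exact: mpinvP. Qed.

Lemma mpinv_sym n (A : 'M[R]_n) : A^T = A -> (mpinv A)^T = mpinv A.
Proof.
move=> sA; apply/esym/mpinv_eq; have [a1 a2 a3 a4] := mpinvP A.
split.
- by rewrite -{1 3}sA -!trmx_mul mulmxA a1.
- by rewrite -{2}sA -!trmx_mul mulmxA a2.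
- by rewrite trmx_mul trmxK sA -a4 trmx_mul sA.
- by rewrite trmx_mul trmxK sA -a3 trmx_mul sA.
Qed.

(** The crux is [Z *m mpinv G *m G = Z]: the difference [E] of the two sides satisfies [E^T E = 0],
    hence vanishes column by column. The least-squares estimate is thereby expressed by the Gram
    matrix, in which the samples enter as a sum. *)
Lemma mpinv_gram m n (Z : 'M[R]_(m, n)) :
  mpinv Z = mpinv (Z^T *m Z) *m Z^T.
Proof.
set G := Z^T *m Z; have sG : G^T = G by rewrite trmx_mul trmxK.
have [g1 g2 g3 g4] := mpinvP G; have sg := mpinv_sym sG.
have comm : G *m mpinv G = mpinv G *m G by rewrite -g4 trmx_mul sG sg.
have ZG : Z *m mpinv G *m G = Z.
  apply/eqP; rewrite -subr_eq0; apply/eqP.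
  set E := _ - Z; have E0 : E^T *m E = 0.
    have EE : E = Z *m (mpinv G *m G - 1%:M) by rewrite mulmxBr mulmx1 mulmxA.
    rewrite EE trmx_mul trmxB g4 trmx1 mulmxA -(mulmxA _ Z^T Z) -/G.
    by rewrite -(mulmxA _ G) (mulmxBr G) mulmx1 (mulmxA G) g1 subrr mulmx0.
  apply/matrixP => i j; rewrite [RHS]mxE.
  have /eqP : ((col j E)^T *m col j E) 0 0 = 0.
    have -> : (col j E)^T *m col j E = col j (row j (E^T *m E)).
      by rewrite tr_col row_mul !colE mulmxA.
    by rewrite E0 !mxE.
  by rewrite dot_eq0 => /eqP/colP/(_ i); rewrite !mxE.
apply: mpinv_eq; split.
- by rewrite -mulmxA -(mulmxA (mpinv G)) -/G mulmxA ZG.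
- by rewrite -(mulmxA _ Z^T) -/G mulmxA g2.
- by rewrite mulmxA !trmx_mul trmxK sg mulmxA.
- by rewrite -mulmxA -/G g4.
Qed.

(** [Pi] is the orthogonal projector onto the kernel of [G], and [G + Pi] is inverted by
    [mpinv G + Pi]. As long as [Pi] stays fixed, the pseudo-inverse is thus an ordinary inverse up
    to a constant. *)
Lemma mpinv_kernel n (G Pi : 'M[R]_n) : G^T = G -> Pi^T = Pi ->
    Pi *m Pi = Pi -> mpinv G *m G = 1%:M - Pi ->
  G + Pi \in unitmx /\ mpinv G = invmx (G + Pi) - Pi.
Proof.
move=> sG sPi PP GP; have [g1 g2 g3 g4] := mpinvP G.
have sg := mpinv_sym sG.
have comm : G *m mpinv G = mpinv G *m G by rewrite -g4 trmx_mul sG sg.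
have GPi : G *m Pi = 0.
  have -> : Pi = 1%:M - G *m mpinv G by rewrite comm GP opprB addrC subrK.
  by rewrite mulmxBr mulmx1 comm mulmxA g1 subrr.
have Pig : Pi *m mpinv G = 0.
  have -> : Pi = 1%:M - mpinv G *m G by rewrite GP opprB addrC subrK.
  by rewrite mulmxBl mul1mx g2 subrr.
have inv : (G + Pi) *m (mpinv G + Pi) = 1%:M.
  by rewrite mulmxDl !mulmxDr GPi Pig PP comm GP addr0 add0r subrK.
have [u1 u2] := mulmx1_unit inv; split=> //.
by rewrite -[X in X - Pi]mulmx1 -inv mulmxA mulVmx// mul1mx addrK.
Qed.

End Penrose.

(** * Linear maps on symmetric matrices in [svec] coordinates *)

Section SymOperators.
Variable R : realType.

(** [ls_weight] is an instance by conversion. Allowing an arbitrary coordinate matrix makes it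
    possible to compare the operator norms of nearby maps. *)
Definition svec_map d (G : 'M[R]_(sdim d)) (X : 'M[R]_d) : 'M[R]_d :=
  smat (G *m svec X).

Lemma smat_linear d a (x y : 'cV[R]_(sdim d)) :
  smat (a *: x + y) = a *: smat x + smat y.
Proof.
rewrite /smat scaler_sumr -big_split; apply: eq_bigr => k _ /=.
by rewrite !mxE scalerDl scalerA.
Qed.

Lemma smatZ d a (x : 'cV[R]_(sdim d)) : smat (a *: x) = a *: smat x.
Proof. by rewrite /smat scaler_sumr; apply: eq_bigr => k _; rewrite mxE scalerA. Qed.

Lemma smatB d (x y : 'cV[R]_(sdim d)) : smat (x - y) = smat x - smat y.
Proof. by rewrite addrC -scaleN1r smat_linear scaleN1r addrC. Qed.

Lemma svecZ d a (X : 'M[R]_d) : svec (a *: X) = a *: svec X.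
Proof. by apply/colP => k; rewrite svecE mxE [RHS]mxE svecE mulrCA. Qed.

Lemma svecB d (X Y : 'M[R]_d) : svec (X - Y) = svec X - svec Y.
Proof. by rewrite addrC -scaleN1r svec_linear scaleN1r addrC. Qed.

Lemma svec_mapZ d G a (X : 'M[R]_d) : svec_map G (a *: X) = a *: svec_map G X.
Proof. by rewrite /svec_map svecZ -scalemxAr smatZ. Qed.

Lemma svec_entry_le d (X : 'M[R]_d) k : `|svec X k 0| <= 2 * specnorm X.
Proof.
rewrite svecE normrM ler_pM// ?entry_le_specnorm//; case: ifP => _.
  by rewrite normr1 ler1n.
rewrite ger0_norm ?sqrtr_ge0// -(ler_pXn2r (ltn0Sn 1)) ?nnegrE ?sqrtr_ge0//.
by rewrite sqr_sqrtr// expr2 ler_peMl// ler1n.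
Qed.

Lemma specnorm_smat_le d (x : 'cV[R]_(sdim d)) :
  specnorm (smat x) <= \sum_k `|x k 0| * specnorm (symbasis R k).
Proof.
rewrite (le_trans (specnorm_sum _ _))// ler_sum// => k _; exact: specnormZ_le.
Qed.

(** A crude upper bound for the operator norm, with 2 in place of the factor [sqrt 2] of [svec]. It
    makes the suprema finite and is controlled by the entries of [G]. *)
Definition smat_gain d (G : 'M[R]_(sdim d)) : R :=
  \sum_k (\sum_l `|G k l| * 2) * specnorm (symbasis R k : 'M[R]_d).

Lemma specnorm_svec_map_le d G (X : 'M[R]_d) :
  specnorm (svec_map G X) <= smat_gain G * specnorm X.
Proof.
rewrite (le_trans (specnorm_smat_le _))// /smat_gain mulr_suml ler_sum// => k _.
rewrite mulrAC ler_wpM2r ?specnorm_ge0// mxE (le_trans (ler_norm_sum _ _ _))//.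
rewrite mulr_suml ler_sum// => l _.
by rewrite normrM -mulrA ler_wpM2l// svec_entry_le.
Qed.

Lemma smat_gain_ge0 d (G : 'M[R]_(sdim d)) : 0 <= smat_gain G.
Proof.
by rewrite sumr_ge0// => k _; rewrite mulr_ge0 ?specnorm_ge0// sumr_ge0.
Qed.

Lemma has_sup_sym_opnorm d (G : 'M[R]_(sdim d)) :
  has_sup [set specnorm (svec_map G X) | X in [set X | X^T = X /\ specnorm X <= 1]].
Proof.
split; first by exists (specnorm (svec_map G 0)), 0 => //=; rewrite trmx0 specnorm0 ler01.
exists (smat_gain G) => _ [X /= [_ X1] <-].
by rewrite (le_trans (specnorm_svec_map_le _ _))// ler_piMr// smat_gain_ge0.
Qed.

Lemma sym_opnorm_ge0 d (G : 'M[R]_(sdim d)) : 0 <= sym_opnorm (svec_map G).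
Proof.
rewrite (@le_trans _ _ (specnorm (svec_map G 0)))// ?specnorm_ge0//.
apply: sup_upper_bound; first exact: has_sup_sym_opnorm.
by exists 0 => //=; rewrite trmx0 specnorm0 ler01.
Qed.

Lemma sym_opnorm_bound d (G : 'M[R]_(sdim d)) X : X^T = X ->
  specnorm (svec_map G X) <= sym_opnorm (svec_map G) * specnorm X.
Proof.
move=> sX; have [X0|X0] := eqVneq (specnorm X) 0.
  rewrite X0 mulr0 (specnorm_eq0 X0) -(scale0r 0) svec_mapZ scale0r.
  by rewrite specnorm0.
have nX : 0 < specnorm X by rewrite lt_neqAle eq_sym X0 specnorm_ge0.
set Y := (specnorm X)^-1 *: X.
have YX : svec_map G X = specnorm X *: svec_map G Y.
  by rewrite -svec_mapZ scalerA mulfV// scale1r.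
rewrite YX (le_trans (specnormZ_le _ _))// gtr0_norm// mulrC (ler_wpM2r (ltW nX))//.
apply: sup_upper_bound; first exact: has_sup_sym_opnorm.
exists Y => //=; split; first by rewrite trmxZ sX.
rewrite (le_trans (specnormZ_le _ _))// gtr0_norm ?invr_gt0//.
by rewrite mulVf.
Qed.

Lemma sym_opnorm_le d (G : 'M[R]_(sdim d)) c : 0 <= c ->
  (forall X, X^T = X -> specnorm (svec_map G X) <= c * specnorm X) ->
  sym_opnorm (svec_map G) <= c.
Proof.
move=> c0 h; apply: ge_sup; first exact: (has_sup_sym_opnorm G).1.
move=> _ [X /= [sX X1] <-]; rewrite (le_trans (h _ sX))//.
by rewrite ler_piMr.
Qed.

(** Applied in both directions, this is the Lipschitz estimate that makes the operator norm a
    measurable function of the matrix. *)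
Lemma sym_opnorm_triangle d (G H : 'M[R]_(sdim d)) :
  sym_opnorm (svec_map G) <= sym_opnorm (svec_map H) + smat_gain (G - H).
Proof.
apply: sym_opnorm_le => [|X sX]; first by rewrite addr_ge0 ?sym_opnorm_ge0 ?smat_gain_ge0.
have -> : svec_map G X = svec_map H X + svec_map (G - H) X.
  by rewrite /svec_map mulmxBl smatB addrC subrK.
rewrite (le_trans (specnormD _ _))// mulrDl lerD ?sym_opnorm_bound//.
exact: specnorm_svec_map_le.
Qed.

End SymOperators.

(** * Trace inequalities *)

Section Trace.
Variable R : realType.

Lemma mx_exprS_diag n (U : 'M[R]_n) (D : 'rV[R]_n) k : U^T *m U = 1%:M ->
  (U^T *m diag_mx D *m U) ^+ k = U^T *m diag_mx (map_mx (fun x => x ^+ k) D) *m U.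
Proof.
move=> UU; have UU' := mulmx1C UU.
elim: k => [|k IH].
  rewrite expr0 (_ : map_mx _ _ = const_mx 1); last by apply/rowP => i; rewrite !mxE.
  by rewrite diag_const_mx mulmx1 UU.
rewrite exprS IH -mulmxE !mulmxA -(mulmxA _ U) UU' mulmx1; congr (_ *m _).
rewrite -!mulmxA; congr (_ *m _); apply/matrixP => i j.
rewrite mul_diag_mx !mxE; case: eqVneq => [->|]; first by rewrite !mulr1n exprS.
by rewrite !mulr0n mulr0.
Qed.

Lemma trace_diag_words n (X : 'M[R]_n) (d e : 'rV[R]_n) :
  \tr (X *m diag_mx d *m X *m diag_mx e) =
  \sum_i \sum_j X i j * X j i * (d 0 j * e 0 i).
Proof.
apply: eq_bigr => i _; rewrite mul_mx_diag mxE [X in X * _]mxE mulr_suml.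
by apply: eq_bigr => j _; rewrite mul_mx_diag mxE; ring.
Qed.

(** Both powers increase on the nonnegative reals, so [(x^i - y^i) (x^j - y^j)] is nonnegative. *)
Lemma chebyshev_powers (x y : R) i j : 0 <= x -> 0 <= y ->
  x ^+ i * y ^+ j + y ^+ i * x ^+ j <= x ^+ (i + j) + y ^+ (i + j).
Proof.
move=> x0 y0; rewrite -subr_ge0 !exprD.
rewrite (_ : _ - _ = (x ^+ i - y ^+ i) * (x ^+ j - y ^+ j)); last by ring.
have [xy|/ltW yx] := leP x y.
  by rewrite mulr_le0// subr_le0 lerXn2r.
by rewrite mulr_ge0// subr_ge0 lerXn2r.
Qed.

(** In an eigenbasis of [Y] with eigenvalues [l_p], the trace is the sum of [X'_pq^2 l_q^i l_p^j].
    Symmetrising in [p] and [q], [chebyshev_powers] replaces the product by powers of a single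
    eigenvalue, and each row of [X'] has squared norm at most [a^2]. Evenness of [i + j] identifies
    the sum of the [|l_p|^(i + j)] with a trace. *)
Lemma trace_word_le n (X Y : 'M[R]_n) a i j : X^T = X -> Y^T = Y ->
    0 <= a -> specnorm X <= a -> ~~ odd (i + j) ->
  \tr (X *m Y ^+ i *m X *m Y ^+ j) <= a ^+ 2 * \tr (Y ^+ (i + j)).
Proof.
move=> sX sY a0 Xa eij; have [U [D [UU YE]]] := sym_spectral sY.
have UU' := mulmx1C UU; set X' := U *m X *m U^T.
have sX' : X'^T = X' by rewrite /X' !trmx_mul trmxK sX mulmxA.
pose pw k : 'rV[R]_n := map_mx (fun x => x ^+ k) D.
have YE' k : Y ^+ k = U^T *m diag_mx (pw k) *m U by rewrite YE mx_exprS_diag.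
have -> : \tr (X *m Y ^+ i *m X *m Y ^+ j) =
    \tr (X' *m diag_mx (pw i) *m X' *m diag_mx (pw j)).
  by rewrite !YE' /X' !mulmxA mxtrace_mulC !mulmxA.
have -> : \tr (Y ^+ (i + j)) = \sum_p `|D 0 p| ^+ (i + j).
  rewrite YE' mxtrace_mulC mulmxA UU' mul1mx mxtrace_diag.
  by apply: eq_bigr => p _; rewrite mxE -normrX ger0_norm// exprn_even_ge0.
have row_le p : \sum_q X' p q ^+ 2 <= a ^+ 2.
  have -> : \sum_q X' p q ^+ 2 = enorm (X' *m delta_mx p 0) ^+ 2.
    rewrite enorm_sq dot_sumE; apply: eq_bigr => q _.
    by rewrite -colE [col _ _ _ _]mxE -expr2 -[in LHS]sX' [in LHS]mxE.
  have e1 : enorm (U^T *m delta_mx p 0) = 1.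
    apply/eqP; rewrite -(eqrXn2 (ltn0Sn 1)) ?enorm_ge0// expr1n enorm_sq.
    rewrite trmx_mul trmxK mulmxA -(mulmxA _ U) UU' mulmx1 trmx_delta.
    by rewrite mul_delta_mx mxE !eqxx.
  have -> : enorm (X' *m delta_mx p 0) = enorm (X *m (U^T *m delta_mx p 0)).
    apply/eqP; rewrite -(eqrXn2 (ltn0Sn 1)) ?enorm_ge0// !enorm_sq /X' -!mulmxA.
    by rewrite trmx_mul -mulmxA (mulmxA U^T) UU mul1mx.
  rewrite lerXn2r ?nnegrE ?enorm_ge0// (le_trans (specnorm_bound _ _))//.
  by rewrite e1 mulr1.
rewrite trace_diag_words.
have sq p q : X' p q * X' q p = X' p q ^+ 2.
  by rewrite expr2; congr (_ * _); rewrite -[in LHS]sX' [LHS]mxE.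
pose m := (i + j)%N; pose ab p : R := `|D 0 p|.
rewrite (@le_trans _ _ (\sum_p \sum_q X' p q ^+ 2 * (ab q ^+ i * ab p ^+ j)))//.
  apply: ler_sum => p _; apply: ler_sum => q _; rewrite sq ler_wpM2l ?sqr_ge0//.
  by rewrite (le_trans (ler_norm _))// normrM !mxE !normrX.
have symm (f : 'I_n -> 'I_n -> R) :
    \sum_p \sum_q X' p q ^+ 2 * f p q = \sum_p \sum_q X' p q ^+ 2 * f q p.
  rewrite exchange_big; apply: eq_bigr => p _; apply: eq_bigr => q _.
  by rewrite -{1}sX' [X'^T _ _]mxE.
(* Both sides are doubled so that [p] and [q] can be exchanged in one of the two copies. *)
rewrite -(@ler_pM2l _ 2)// !mulr_natl !mulr2n {2}symm -big_split /=.
rewrite (@le_trans _ _ (\sum_p \sum_q X' p q ^+ 2 * (ab q ^+ m + ab p ^+ m)))//.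
  apply: ler_sum => p _; rewrite -big_split; apply: ler_sum => q _ /=.
  by rewrite -mulrDr ler_wpM2l ?sqr_ge0//; apply: chebyshev_powers; exact: normr_ge0.
have -> : \sum_p \sum_q X' p q ^+ 2 * (ab q ^+ m + ab p ^+ m) =
    \sum_p \sum_q X' p q ^+ 2 * ab q ^+ m + \sum_p \sum_q X' p q ^+ 2 * ab p ^+ m.
  rewrite -big_split; apply: eq_bigr => p _ /=.
  by rewrite -big_split; apply: eq_bigr => q _; exact: mulrDr.
rewrite (symm (fun p q => ab q ^+ m)).
have h : \sum_p \sum_q X' p q ^+ 2 * ab p ^+ m <= a ^+ 2 * \sum_p `|D 0 p| ^+ (i + j).
  rewrite mulr_sumr; apply: ler_sum => p _; rewrite -mulr_suml.
  by apply: ler_wpM2r (row_le p); rewrite exprn_ge0 ?normr_ge0.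
exact: lerD.
Qed.

(** Outside the order interval some eigenvalue has modulus above [b], and in an even power all the
    other eigenvalues contribute nonnegatively. *)
Lemma trace_even_ge n (S : 'M[R]_n) b k : S^T = S -> 0 <= b ->
  ~ (loewner_le (- b%:M) S /\ loewner_le S b%:M) -> b ^+ k.*2 <= \tr (S ^+ k.*2).
Proof.
move=> sS b0 notb; have [U [D [UU SE]]] := sym_spectral sS.
have UU' := mulmx1C UU.
have -> : \tr (S ^+ k.*2) = \sum_p `|D 0 p| ^+ k.*2.
  rewrite SE mx_exprS_diag// mxtrace_mulC mulmxA UU' mul1mx mxtrace_diag.
  apply: eq_bigr => p _; rewrite mxE -normrX ger0_norm// exprn_even_ge0//.
  by rewrite odd_double.
have [/forallP h|] := boolP [forall p, `|D 0 p| <= b]; last first.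
  rewrite negb_forall => /existsP[p]; rewrite -ltNge => /ltW bp.
  rewrite (bigD1 p)//= ler_wpDr ?lerXn2r// ?nnegrE//.
  by rewrite sumr_ge0// => q _; rewrite exprn_ge0.
exfalso; apply: notb; split; rewrite /loewner_le.
  have -> : S - - b%:M = U^T *m diag_mx (D + const_mx b) *m U.
    rewrite linearD /= diag_const_mx mulmxDr mulmxDl -SE opprK.
    by rewrite mul_mx_scalar -scalemxAl UU scale_scalar_mx mulr1.
  rewrite -{2}(trmxK U); apply: psdmx_cong; split=> [|x]; first by rewrite tr_diag_mx.
  rewrite qform_diag sumr_ge0// => i _; rewrite mulr_ge0 ?sqr_ge0// !mxE.
  by have := h i; rewrite ler_norml => /andP[]; lra.
have -> : b%:M - S = U^T *m diag_mx (const_mx b - D) *m U.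
  rewrite linearB /= diag_const_mx mulmxBr mulmxBl -SE.
  by rewrite mul_mx_scalar -scalemxAl UU scale_scalar_mx mulr1.
rewrite -{2}(trmxK U); apply: psdmx_cong; split=> [|x]; first by rewrite tr_diag_mx.
rewrite qform_diag sumr_ge0// => i _; rewrite mulr_ge0 ?sqr_ge0// !mxE.
by have := h i; rewrite ler_norml => /andP[]; lra.
Qed.

End Trace.

(** * Moment dynamics *)

Lemma block_mx_sum (R : realType) m1 m2 n1 n2 (I : Type) (r : seq I)
    (a : I -> 'M[R]_(m1, n1)) (b : I -> 'M[R]_(m1, n2)) (c : I -> 'M[R]_(m2, n1))
    (d : I -> 'M[R]_(m2, n2)) :
  \sum_(i <- r) block_mx (a i) (b i) (c i) (d i) =
  block_mx (\sum_(i <- r) a i) (\sum_(i <- r) b i)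
           (\sum_(i <- r) c i) (\sum_(i <- r) d i).
Proof.
elim: r => [|i r IH]; first by rewrite !big_nil block_mx0.
by rewrite !big_cons IH add_block_mx.
Qed.

Section MomentMap.
Context {R : realType} {nx nu nw : nat}.
Variables (A : 'I_nw -> 'M[R]_nx) (B : 'I_nw -> 'M[R]_(nx, nu)).
Local Notation mom := (moment_map A B).

Lemma moment_mapDZ W Z Z' c : mom W (c *: Z + Z') = c *: mom W Z + mom W Z'.
Proof.
rewrite /moment_map scaler_sumr -big_split; apply: eq_bigr => k _ /=.
rewrite scaler_sumr -big_split; apply: eq_bigr => l _ /=.
by rewrite mulmxDr mulmxDl scalerDr -scalemxAr -scalemxAl !scalerA mulrC.
Qed.

Lemma moment_mapBZ W Z Z' : mom W (Z - Z') = mom W Z - mom W Z'.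
Proof. by rewrite addrC -scaleN1r moment_mapDZ scaleN1r addrC. Qed.

Lemma moment_mapBW W W' Z : mom (W - W') Z = mom W Z - mom W' Z.
Proof.
rewrite /moment_map -sumrB; apply: eq_bigr => k _.
by rewrite -sumrB; apply: eq_bigr => l _; rewrite !mxE scalerBl.
Qed.

(** A factorisation of [W] brings the moment map into Kraus form, a sum of congruences. Positivity
    follows, and by bilinearity also monotonicity in both arguments. *)
Lemma moment_map_factor (L : 'M[R]_nw) Z : mom (L *m L^T) Z =
  \sum_j (\sum_k L k j *: model A B k) *m Z *m (\sum_k L k j *: model A B k)^T.
Proof.
rewrite /moment_map.
transitivity (\sum_j \sum_k \sum_l (L k j * L l j) *: (model A B k *m Z *m (model A B l)^T)).
  rewrite [RHS]exchange_big; apply: eq_bigr => k _.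
  rewrite [RHS]exchange_big; apply: eq_bigr => l _.
  by rewrite mxE scaler_suml; apply: eq_bigr => j _; rewrite [L^T _ _]mxE.
apply: eq_bigr => j _; rewrite mulmx_suml mulmx_suml; apply: eq_bigr => k _.
rewrite linear_sum mulmx_sumr; apply: eq_bigr => l _ /=.
by rewrite trmxZ -!scalemxAl -scalemxAr scalerA.
Qed.

Lemma moment_map_psd W Z : psdmx W -> psdmx Z -> psdmx (mom W Z).
Proof.
move=> /psdmx_factor[L ->] pZ; rewrite moment_map_factor.
by apply: psdmx_sum => j; exact: psdmx_cong.
Qed.

Lemma moment_map_le W Z Z' : psdmx W -> loewner_le Z Z' ->
  loewner_le (mom W Z) (mom W Z').
Proof. by rewrite /loewner_le -moment_mapBZ; exact: moment_map_psd. Qed.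

Lemma moment_map_leW W W' Z : loewner_le W W' -> psdmx Z ->
  loewner_le (mom W Z) (mom W' Z).
Proof. by rewrite /loewner_le -moment_mapBW; exact: moment_map_psd. Qed.

(** The adjoint of the moment map for the trace pairing; its blocks are the maps that occur in the
    Riccati equation. *)
Definition moment_adj (W : 'M[R]_nw) (P : 'M[R]_nx) : 'M[R]_(nx + nu) :=
  \sum_k \sum_l W k l *: ((model A B l)^T *m P *m model A B k).

Lemma moment_adjP W P Z : \tr (P *m mom W Z) = \tr (moment_adj W P *m Z).
Proof.
rewrite /moment_map /moment_adj mulmx_sumr mulmx_suml !linear_sum.
apply: eq_bigr => k _ /=; rewrite mulmx_sumr mulmx_suml !linear_sum.
apply: eq_bigr => l _ /=; rewrite -scalemxAr -scalemxAl !linearZ /=.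
by rewrite mulmxA mxtrace_mulC !mulmxA.
Qed.

Lemma moment_adj_block W P : W^T = W -> P^T = P ->
  moment_adj W P = block_mx (Fadj A W P) (Hadj A B W P)^T (Hadj A B W P) (Gadj B W P).
Proof.
move=> sW sP; rewrite /moment_adj exchange_big.
have sWE k l : W l k = W k l by rewrite -[in LHS]sW mxE.
transitivity (\sum_k \sum_l W k l *: block_mx ((A k)^T *m P *m A l)
   ((A k)^T *m P *m B l) ((B k)^T *m P *m A l) ((B k)^T *m P *m B l)).
  apply: eq_bigr => k _; apply: eq_bigr => l _; rewrite sWE; congr (_ *: _).
  by rewrite /model tr_row_mx mul_col_mx mul_col_row.
have -> : (Hadj A B W P)^T = \sum_k \sum_l W k l *: ((A k)^T *m P *m B l).
  rewrite /Hadj linear_sum exchange_big; apply: eq_bigr => k _ /=.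
  rewrite linear_sum /=; apply: eq_bigr => l _ /=.
  by rewrite trmxZ !trmx_mul trmxK sP sWE mulmxA.
rewrite /Fadj /Hadj /Gadj -block_mx_sum; apply: eq_bigr => k _.
by rewrite -block_mx_sum; apply: eq_bigr => l _; rewrite scale_block_mx.
Qed.

End MomentMap.

(** * The Riccati equation as a Bellman equation, and the contraction it implies *)

Section RiccatiAlgebra.
Context {R : realType} {nx nu nw : nat}.
Variables (A : 'I_nw -> 'M[R]_nx) (B : 'I_nw -> 'M[R]_(nx, nu)).
Variables (Q : 'M[R]_nx) (Ru : 'M[R]_nu).

Lemma pdmx_unit n (S : 'M[R]_n) : pdmx S -> S \in unitmx.
Proof.
case=> sS pS; rewrite -row_free_unit -kermx_eq0; apply/rowV0P => v /sub_kermxP vS.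
apply/eqP/negPn/negP => v0; have := pS v^T.
by rewrite /qform trmxK vS mul0mx mxE ltxx -trmx0 (inj_eq trmx_inj) => /(_ v0).
Qed.

Lemma trace_dyad n (S : 'M[R]_n) x : \tr (S *m (x *m x^T)) = qform S x.
Proof. by rewrite mulmxA mxtrace_mulC mulmxA /qform [LHS]big_ord1. Qed.

Lemma psdmx_dyad n (x : 'cV[R]_n) : psdmx (x *m x^T).
Proof. exact: psdmx_mulT. Qed.

Lemma Pimx_psd K (X : 'M[R]_nx) : psdmx X -> psdmx (Pimx (nu := nu) K X).
Proof.
move=> pX; have := psdmx_cong (col_mx 1%:M K) pX.
by rewrite tr_col_mx trmx1.
Qed.

Lemma Pimx_le (K : 'M[R]_(nu, nx)) (X Y : 'M[R]_nx) :
  loewner_le X Y -> loewner_le (Pimx K X) (Pimx K Y).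
Proof.
rewrite /loewner_le => /(@Pimx_psd K).
by rewrite /Pimx -mulmxBl -mulmxBr.
Qed.

(** Completing the square: the quadratic expression of stage cost plus adjoint map, evaluated at
    [(1, K)] with the Riccati gain [K], is exactly the right-hand side of the Riccati equation. In
    trace form this is a Bellman equation: the cost-to-go is the stage cost plus the cost-to-go of
    the next moment. *)
Lemma riccati_trace W P : W^T = W -> P^T = P -> Q^T = Q -> Ru^T = Ru ->
    Ru + Gadj B W P \in unitmx -> P = riccati A B Q Ru W P ->
  forall X, \tr (P *m X) =
    \tr (block_mx Q 0 0 Ru *m Pimx (riccati_gain A B Ru W P) X) +
    \tr (P *m moment_map A B W (Pimx (riccati_gain A B Ru W P) X)).
Proof.
move=> sW sP sQ sR uS PE X.
rewrite moment_adjP -mxtraceD -mulmxDl moment_adj_block// add_block_mx !add0r.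
set F := Fadj A W P in PE *; set G := Gadj B W P in uS PE *.
set Hm := Hadj A B W P in PE *; set K := riccati_gain _ _ _ _ _.
have -> : \tr (block_mx (Q + F) Hm^T Hm (Ru + G) *m Pimx K X) =
    \tr (row_mx 1%:M K^T *m block_mx (Q + F) Hm^T Hm (Ru + G) *m col_mx 1%:M K *m X).
  by rewrite /Pimx !mulmxA mxtrace_mulC !mulmxA.
congr (\tr (_ *m _)); rewrite {1}PE /riccati -/F -/G -/Hm.
rewrite mul_row_block mul_row_col !mul1mx mulmx1.
have KE : K = - (invmx (Ru + G) *m Hm) by [].
have KS : (Ru + G) *m K = - Hm by rewrite KE mulmxN mulmxA mulmxV// mul1mx.
rewrite mulmxDl -[K^T *m _ *m K]mulmxA KS mulmxN KE mulmxN mulmxA.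
by rewrite addrACA subrr addr0.
Qed.

Lemma pdmx_block_ul : pdmx (block_mx Q 0 0 Ru) -> pdmx Q.
Proof.
case=> s p; split.
  by move: s; rewrite tr_block_mx => /eq_block_mx[].
move=> x x0; have := p (col_mx x 0); rewrite /qform tr_col_mx mul_row_block.
rewrite !mulmx0 trmx0 !mul0mx !addr0 mul_row_col mulmx0 addr0; apply.
by rewrite col_mx_eq0 negb_and x0.
Qed.

Lemma pdmx_block_dr : pdmx (block_mx Q 0 0 Ru) -> pdmx Ru.
Proof.
case=> s p; split.
  by move: s; rewrite tr_block_mx => /eq_block_mx[].
move=> x x0; have := p (col_mx 0 x); rewrite /qform tr_col_mx mul_row_block.
rewrite !mulmx0 trmx0 !mul0mx !add0r mul_row_col mulmx0 add0r; apply.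
by rewrite col_mx_eq0 negb_and x0 orbT.
Qed.

(* With [c = 1 - h / p], where [h] bounds the stage cost from below and [p]
   bounds [P] from above. *)
Lemma riccati_contraction Wst W P : W^T = W ->
    (forall Z, psdmx Z -> psdmx (moment_map A B Wst Z)) ->
    (forall Z, psdmx Z -> loewner_le (moment_map A B Wst Z) (moment_map A B W Z)) ->
    pdmx (block_mx Q 0 0 Ru) -> pdmx P -> P = riccati A B Q Ru W P ->
  exists2 c, 0 < c < 1 & forall X, psdmx X ->
    \tr (P *m moment_map A B Wst (Pimx (riccati_gain A B Ru W P) X)) <=
    c * \tr (P *m X).
Proof.
move=> sW pst dom pH pP PE; set K := riccati_gain _ _ _ _ _.
have [sQ pQ] := pdmx_block_ul pH; have [sR pR] := pdmx_block_dr pH.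
have sP := pP.1.
(* [W] may be indefinite. Its adjoint map is nonetheless positive, because its moment map dominates
   the positive one of [Wst]; [Gadj] is the lower right block, tested on [(0, u)]. *)
have uS : Ru + Gadj B W P \in unitmx.
  have adj0 Z : psdmx Z -> 0 <= \tr (moment_adj A B W P *m Z).
    move=> pZ; rewrite -moment_adjP; apply: trace_mul_psd_ge0.
      exact: pdmx_psdmx.
    by apply: psdmx_le (dom Z pZ); exact: pst.
  apply: pdmx_unit; split.
    rewrite trmxD sR; congr (_ + _); rewrite /Gadj linear_sum exchange_big /=.
    apply: eq_bigr => k _; rewrite linear_sum; apply: eq_bigr => l _ /=.
    by rewrite trmxZ !trmx_mul trmxK sP mulmxA -[in LHS]sW mxE.
  move=> u u0; rewrite qformD ltr_pwDl//; first exact: pR.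
  have := adj0 _ (psdmx_dyad (col_mx 0 u)); rewrite trace_dyad moment_adj_block//.
  rewrite /qform tr_col_mx mul_row_block trmx0 !mul0mx !add0r mul_row_col.
  by rewrite mulmx0 add0r.
have [h h0 hH] := pdmx_lower_bound pH.
have [q q0 qP] := sym_upper_bound sP.
(* Adding [h] to an upper bound of [P] ensures [h / p < 1], hence a positive factor. *)
pose p := q + h; have p0 : 0 < p by rewrite addr_gt0.
exists (1 - h / p).
  by rewrite subr_gt0 ltr_pdivrMr// mul1r ltrDr q0 gtrBl divr_gt0.
move=> X pX; rewrite mulrBl mul1r lerBrDr.
rewrite [leRHS](riccati_trace sW sP sQ sR uS PE) addrC lerD//; last first.
  have := trace_mul_psd_ge0 (pdmx_psdmx pP) (dom _ (Pimx_psd K pX)).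
  by rewrite mulmxBr linearB subr_ge0.
have trX : 0 <= \tr X by have := trace_mul_psd_ge0 (psdmx_scalar _ ler01) pX; rewrite mul1mx.
apply: (@le_trans _ _ (h * \tr X)).
  rewrite mulrAC ler_pdivrMr// -mulrA (ler_wpM2l (ltW h0))//.
  have := trace_mul_psd_ge0 qP pX; rewrite mulmxBl linearB subr_ge0 mul_scalar_mx linearZ /=.
  by move/le_trans; apply; rewrite mulrC (ler_wpM2l trX)// lerDl (ltW h0).
have := trace_mul_psd_ge0 hH (Pimx_psd K pX).
rewrite mulmxBl linearB subr_ge0 mul_scalar_mx linearZ /=.
apply: le_trans; rewrite (ler_wpM2l (ltW h0))//.
rewrite /Pimx mul_col_mx mul_col_row mxtrace_block mul1mx mulmx1 lerDl.
rewrite -mulmxA; have := trace_mul_psd_ge0 (psdmx_scalar _ ler01) (psdmx_cong K pX).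
by rewrite mul1mx mulmxA.
Qed.

End RiccatiAlgebra.

(** * Spectral radius of maps preserving the semidefinite cone *)

Section SpectralRadius.
Variable R : realType.

Lemma normc_ge0 (z : R[i]) : 0 <= Normc.normc z.
Proof. by case: z => a b; exact: sqrtr_ge0. Qed.

Lemma normc_real (x : R) : Normc.normc (real_complex R x) = `|x|.
Proof. by rewrite /Normc.normc /= expr0n addr0 sqrtr_sqr. Qed.

Lemma normcX (z : R[i]) n : Normc.normc (z ^+ n) = Normc.normc z ^+ n.
Proof.
elim: n => [|n IH]; first by rewrite !expr0 Normc.normc1.
by rewrite !exprS Normc.normcM IH.
Qed.

Lemma normc_sum I (r : seq I) (F : I -> R[i]) :
  Normc.normc (\sum_(i <- r) F i) <= \sum_(i <- r) Normc.normc (F i).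
Proof.
elim: r => [|i r IH]; first by rewrite !big_nil Normc.normc0.
by rewrite !big_cons (le_trans (le_normcD _ _))// lerD2l.
Qed.

(** If [x > c], Bernoulli's inequality makes [(x / c) ^+ n] grow at least linearly, against the
    uniform bound [C / K]. *)
Lemma geometric_bound_le (x c K C : R) : 0 <= x -> 0 < c -> 0 < K ->
  (forall n, x ^+ n * K <= c ^+ n * C) -> x <= c.
Proof.
move=> x0 c0 K0 h; rewrite leNgt; apply/negP => cx.
pose e := x / c - 1; have e0 : 0 < e by rewrite subr_gt0 ltr_pdivlMr// mul1r.
have bern n : 1 + n%:R * e <= (x / c) ^+ n.
  rewrite -[x / c](subrK 1) -/e; elim: n => [|n IH]; first by rewrite expr0 mul0r addr0.
  rewrite exprS; apply: le_trans (ler_wpM2l _ IH); last by rewrite addr_ge0 ?ltW.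
  have : 0 <= n%:R * e * e by rewrite !mulr_ge0 ?ler0n// (ltW e0).
  by rewrite -natr1; lra.
have bd n : (1 + n%:R * e) * K <= C.
  apply: (le_trans (ler_wpM2r (ltW K0) (bern n))).
  by rewrite expr_div_n mulrAC ler_pdivrMr ?exprn_gt0// [leRHS]mulrC h.
have := bd (Num.truncn (C / (e * K))).+1; rewrite leNgt => /negP; apply.
have := truncnS_gt (C / (e * K)); rewrite ltr_pdivrMr ?mulr_gt0// => /lt_le_trans; apply.
by rewrite [leRHS]mulrDl mul1r mulrA lerDr ltW.
Qed.

Lemma sym_matrix_svec d (L : 'M[R]_d -> 'M[R]_d) :
    (forall c X Y, L (c *: X + Y) = c *: L X + L Y) ->
  forall X, X^T = X -> sym_matrix L *m svec X = svec (L X).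
Proof.
move=> Llin X sX; have L0 : L 0 = 0.
  by have := Llin (-1) 0 0; rewrite scaleN1r addNr => ->; rewrite scaleN1r addNr.
have Lsum (r : seq 'I_(sdim d)) (a : 'I_(sdim d) -> R) (F : 'I_(sdim d) -> 'M[R]_d) :
    L (\sum_(k <- r) a k *: F k) = \sum_(k <- r) a k *: L (F k).
  by elim: r => [|k r IH]; rewrite ?big_nil ?L0// !big_cons Llin IH.
rewrite -[in RHS](smatK sX) /smat Lsum svec_sum; apply/colP => k.
by rewrite mxE summxE; apply: eq_bigr => l _; rewrite [RHS]mxE mxE mulrC.
Qed.

(** A left eigenvector of [sym_matrix L] is a functional [f] with [f (L X) = a f X]. On the
    semidefinite cone [f] is dominated by the trace against [P], which contracts by [c]; iterating
    gives [|a|^n |f X| <= c^n C], hence [|a| <= c]. *)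
Lemma sym_specrad_lt1 d (L : 'M[R]_d -> 'M[R]_d) (P : 'M[R]_d) c :
    (forall c X Y, L (c *: X + Y) = c *: L X + L Y) -> pdmx P ->
    (forall X, psdmx X -> psdmx (L X)) -> 0 < c < 1 ->
    (forall X, psdmx X -> \tr (P *m L X) <= c * \tr (P *m X)) ->
  sym_specrad L < 1.
Proof.
move=> Llin pP Lpsd /andP[c0 c1] Lc.
rewrite /sym_specrad; set S := (X in sup X); suff Sc x : S x -> x <= c.
  (* The spectrum is empty for [d = 0], and [sup] then takes the value 0. *)
  have [->|/set0P S0] := eqVneq S set0; first by rewrite sup0 ltr01.
  by apply: le_lt_trans c1; apply: ge_sup => // x; exact: Sc.
case=> a /= /eigenvalueP[v vL v0] <-.
pose f (X : 'M[R]_d) := (v *m map_mx (real_complex R) (svec X)) 0 0.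
have fL X : psdmx X -> f (L X) = a * f X.
  case=> sX _; rewrite /f -(sym_matrix_svec Llin sX) map_mxM mulmxA vL.
  by rewrite -scalemxAl mxE.
have psdL n X : psdmx X -> psdmx (iter n L X).
  by move=> pX; elim: n => [//|n IH] /=; exact: Lpsd.
have fLn n X : psdmx X -> f (iter n L X) = a ^+ n * f X.
  move=> pX; elim: n => [|n IH]; first by rewrite mul1r.
  by rewrite /= fL ?IH ?exprS ?mulrA//; exact: psdL.
have trLn n X : psdmx X -> \tr (P *m iter n L X) <= c ^+ n * \tr (P *m X).
  move=> pX; elim: n => [|n IH]; first by rewrite mul1r.
  rewrite /= (le_trans (Lc _ _))//; first exact: psdL.
  by rewrite exprS -mulrA ler_wpM2l// ltW.
have [p p0 pP'] := pdmx_lower_bound pP.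
pose V := \sum_k Normc.normc (v 0 k).
have V0 : 0 <= V by apply: sumr_ge0 => k _; exact: normc_ge0.
have tr0 (X : 'M[R]_d) : psdmx X -> 0 <= \tr X.
  by move=> pX; have := trace_mul_psd_ge0 (psdmx_scalar _ ler01) pX; rewrite mul1mx.
have trP X : psdmx X -> p * \tr X <= \tr (P *m X).
  move=> pX; have := trace_mul_psd_ge0 pP' pX.
  by rewrite mulmxBl linearB subr_ge0 mul_scalar_mx linearZ.
have fb X : psdmx X -> Normc.normc (f X) <= 2 * V / p * \tr (P *m X).
  move=> pX; apply: (@le_trans _ _ (2 * V * \tr X)); last first.
    rewrite [leRHS]mulrAC ler_pdivlMr//.
    rewrite (_ : _ * p = 2 * V * (p * \tr X)); last by ring.
    by rewrite ler_wpM2l ?mulr_ge0// trP.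
  rewrite /f mxE (le_trans (normc_sum _ _))// mulrAC mulrC mulr_suml.
  apply: ler_sum => k _; rewrite Normc.normcM ler_wpM2l ?normc_ge0//.
  rewrite mxE normc_real svecE normrM ler_pM ?psdmx_entry_le//.
  case: ifP => _; first by rewrite normr1 ler1n.
  rewrite ger0_norm ?sqrtr_ge0// -(ler_pXn2r (ltn0Sn 1)) ?nnegrE ?sqrtr_ge0//.
  by rewrite sqr_sqrtr// expr2 ler_peMl// ler1n.
(* The cone spans the symmetric matrices: [symbasis R k] is the difference of [t%:M] and
   [t%:M - symbasis R k], both positive semidefinite for large [t], so [f] is nonzero on one of
   them. *)
have [X [pX fX]] : exists X, psdmx X /\ f X != 0.
  have [k vk] : exists k, v 0 k != 0 by apply/rV0Pn.
  have fk : f (symbasis R k) = v 0 k.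
    rewrite /f svec_symbasis mxE (bigD1 k)//= !mxE !eqxx mulr1.
    by rewrite big1 ?addr0// => l lk; rewrite !mxE (negbTE lk) mulr0.
  have [t t0 pt] := sym_upper_bound (symbasis_sym R k).
  have [ft|ft] := eqVneq (f t%:M) 0; last first.
    by exists t%:M; split=> //; apply: psdmx_scalar; exact: ltW.
  exists (t%:M - symbasis R k); split=> //.
  have -> : f (t%:M - symbasis R k) = f t%:M - f (symbasis R k).
    by rewrite /f svecB map_mxB mulmxBr mxE [X in _ + X]mxE.
  by rewrite ft sub0r oppr_eq0 fk.
apply: (@geometric_bound_le _ _ (Normc.normc (f X)) (2 * V / p * \tr (P *m X))) => //.
- exact: normc_ge0.
- rewrite lt_neqAle normc_ge0 andbT eq_sym; apply: contra fX => /eqP.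
  by move/Normc.eq0_normc => ->.
- move=> n; rewrite -normcX -Normc.normcM -fLn//.
  rewrite (le_trans (fb _ (psdL n _ pX)))// mulrCA ler_wpM2l ?trLn//.
  by rewrite divr_ge0 ?mulr_ge0// ltW.
Qed.

End SpectralRadius.

(** * Closed-loop stability, the comparison with (DR), and feedback gains *)

Section Relaxation.
Context {R : realType} {nx nu nw : nat}.
Variables (A : 'I_nw -> 'M[R]_nx) (B : 'I_nw -> 'M[R]_(nx, nu)).
Implicit Types (W : 'M[R]_nw) (H : 'M[R]_(nx + nu)).

Lemma closed_loop_stable (Q : 'M[R]_nx) (Ru : 'M[R]_nu) Wst W P : W^T = W ->
    (forall Z, psdmx Z -> psdmx (moment_map A B Wst Z)) ->
    (forall Z, psdmx Z -> loewner_le (moment_map A B Wst Z) (moment_map A B W Z)) ->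
    pdmx (block_mx Q 0 0 Ru) -> pdmx P -> P = riccati A B Q Ru W P ->
  sym_specrad (fun X => moment_map A B Wst (Pimx (riccati_gain A B Ru W P) X)) < 1.
Proof.
move=> sW pst dom pH pP PE.
have [c c01 hc] := riccati_contraction sW pst dom pH pP PE.
apply: (sym_specrad_lt1 _ pP _ c01 hc) => [e X Y|X pX].
  by rewrite /Pimx mulmxDr mulmxDl -scalemxAr -scalemxAl moment_mapDZ.
by apply: pst; exact: Pimx_psd.
Qed.

(* [Wp] need not be the true second moment, only induce the same moment map. *)
Lemma val_LQRcp_le_DR Wst Wp Wlo Whi H (X0 : 'M[R]_nx) : psdmx Wst -> psdmx X0 ->
    Wp^T = Wp -> loewner_le Wlo Wp -> loewner_le Wp Whi ->
    (forall Z, Z^T = Z -> moment_map A B Wp Z = moment_map A B Wst Z) ->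
  (val_LQRcp A B Wst H X0 <= val_DR A B Wlo Whi H X0)%E.
Proof.
move=> pW pX0 sWp lo hi same; apply: le_ereal_inf_tmp => _ [pi cpi ->].
(* The history that arises when the rule meets the constant adversary [Wp]. *)
pose hist := fix hist t : seq 'M[R]_nx := if t is s.+1
  then rcons (hist s) (moment_map A B Wp (pi (hist s))) else [:: X0].
pose X t := last 0 (hist t); pose Z t := pi (hist t).
have XS t : X t.+1 = moment_map A B Wp (Z t) by rewrite /X /= last_rcons.
have histE t : hist t = mkseq X t.+1.
  elim: t => [//|t IH]; rewrite [LHS]/= -XS IH.
  by rewrite /mkseq -[in RHS]addn1 iotaD map_cat add0n cats1.
have ZE t : Z t = pi (rcons (mkseq X t) (X t)).
  by rewrite /Z histE /mkseq -[in LHS]addn1 iotaD map_cat add0n cats1.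
(* Positivity is propagated through [Wst], since [Wp] itself may be indefinite. *)
have pX t : psdmx (X t).
  elim: t => [//|t IH]; rewrite XS; have [pZ _] := cpi (mkseq X t) _ IH.
  by rewrite -ZE in pZ; rewrite same ?pZ.1//; exact: moment_map_psd.
(* The same pair is feasible for both matrices: with [Wst] it bounds the value of (LQRcp) from
   above, with [Wp] it competes in the inner maximum. *)
have traj Wq : (forall Z, Z^T = Z -> moment_map A B Wp Z = moment_map A B Wq Z) ->
    moment_traj A B Wq X0 X Z.
  move=> hq; split=> // t; have [pZ uZ] := cpi (mkseq X t) _ (pX t).
  by rewrite -ZE in pZ uZ; split=> //; rewrite XS hq// pZ.1.
apply: (@le_trans _ _ (moment_cost H Z)).
  by apply: ereal_inf_lbound; exists X, Z; split=> //; exact: traj.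
apply: ereal_sup_ubound; exists Wp, X, Z; split=> //; split=> //.
  exact: traj.
by move=> t; rewrite /Z histE.
Qed.

(* The generalized Schur complement: positive semidefiniteness of [Z] puts the
   off-diagonal block in the row space of the upper left one. *)
Lemma psdmx_gain (Z : 'M[R]_(nx + nu)) : psdmx Z ->
  exists K : 'M[R]_(nu, nx), loewner_le (Pimx K (ulsubmx Z)) Z.
Proof.
case=> sZ pZ; set X := ulsubmx Z; set V := ursubmx Z; set U := drsubmx Z.
have ZE : Z = block_mx X V V^T U.
  by rewrite -[LHS]submxK /V trmx_ursub sZ.
have sX : X^T = X by rewrite /X trmx_ulsub sZ.
have sU : U^T = U by rewrite /U trmx_drsub sZ.
have qZ a b : qform Z (col_mx a b) = qform X a + (a^T *m V *m b) 0 0 +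
    (a^T *m V *m b) 0 0 + qform U b.
  rewrite /qform {1}ZE tr_col_mx mul_row_block mul_row_col !mulmxDl.
  have -> : b^T *m V^T *m a = (a^T *m V *m b)^T by rewrite !trmx_mul trmxK mulmxA.
  set p := a^T *m X *m a; set q := a^T *m V *m b; set r := b^T *m U *m b.
  by clearbody p q r; rewrite !mxE; lra.
(* For [a] in the kernel of [X], the form at [(a, s b)] equals [2 s |b|^2 + s^2 qform U b]; a small
   negative [s] makes it negative unless [b = 0]. *)
have kerV (a : 'cV[R]_nx) : X *m a = 0 -> V^T *m a = 0.
  move=> Xa; apply/eqP; rewrite -dot_eq0; set b := V^T *m a.
  have ab : (a^T *m V *m b) 0 0 = (b^T *m b) 0 0.
    by rewrite /b trmx_mul trmxK.
  have h s : 0 <= 2 * s * (b^T *m b) 0 0 + s ^+ 2 * qform U b.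
    have := pZ (col_mx a (s *: b)); rewrite qZ /qform -(mulmxA _ X) Xa mulmx0.
    rewrite -scalemxAr !linearZ /= -!scalemxAl -?scalemxAr.
    set q := a^T *m V *m b; set r := b^T *m U *m b; rewrite -ab -/q.
    by clearbody q r; rewrite !mxE; lra.
  have u0 : 0 <= qform U b.
    by have := pZ (col_mx 0 b); rewrite qZ /qform trmx0 !mul0mx mxE !add0r.
  rewrite eq_le dot_ge0 andbT leNgt; apply/negP => bb.
  have := h (- ((b^T *m b) 0 0 / (qform U b + 1))).
  set y := (b^T *m b) 0 0 in bb *; set u := qform U b in u0 *.
  have -> : 2 * - (y / (u + 1)) * y + (- (y / (u + 1))) ^+ 2 * u =
      - (y ^+ 2 * (u + 2) / (u + 1) ^+ 2).
    by field; rewrite gt_eqF// ltr_wpDl.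
  by rewrite oppr_ge0 leNgt divr_gt0// ?mulr_gt0 ?exprn_gt0// ltr_wpDl.
have /submxP[K KE] : (V^T <= X)%MS.
  rewrite submxE; apply/eqP/matrixP => i j.
  have h : X *m (cokermx X *m (delta_mx j 0 : 'cV[R]_nx)) = 0.
    by rewrite mulmxA mulmx_coker mul0mx.
  have := kerV _ h; rewrite mulmxA -colE => /colP/(_ i).
  by rewrite mxE => ->; rewrite !mxE.
have XK : X *m K^T = V by rewrite -[RHS]trmxK KE trmx_mul sX.
exists K; split.
  rewrite trmxB sZ; congr (_ - _).
  by rewrite /Pimx !trmx_mul tr_row_mx tr_col_mx trmx1 trmxK sX mulmxA.
move=> x; rewrite -(vsubmxK x); set a := usubmx x; set b := dsubmx x.
rewrite qformD qformN qZ.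
have -> : qform (Pimx K X) (col_mx a b) = qform X (a + K^T *m b).
  rewrite /Pimx; have := qform_cong (row_mx 1%:M K^T) X (col_mx a b).
  by rewrite tr_row_mx trmx1 trmxK mul_row_col mul1mx.
(* This test vector gives [qform X (K^T b) <= qform U b], which is all that the goal amounts to once
   the square is completed. *)
have := pZ (col_mx (- (K^T *m b)) b); rewrite qZ.
have trN (y : 'cV[R]_nx) : (- y)^T = - y^T by exact: linearN.
have -> : qform X (- (K^T *m b)) = qform X (K^T *m b).
  by rewrite /qform trN !mulNmx mulmxN opprK.
have -> : ((- (K^T *m b))^T *m V *m b) 0 0 = - qform X (K^T *m b).
  by rewrite -XK /qform trN !mulNmx mxE !mulmxA.
have := qform_addZ X 1 a (K^T *m b); rewrite scale1r expr1n !mul1r => ->.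
have -> : (a^T *m X *m (K^T *m b)) 0 0 = (a^T *m V *m b) 0 0.
  by rewrite -XK !mulmxA.
have -> : ((K^T *m b)^T *m X *m a) 0 0 = (a^T *m V *m b) 0 0.
  rewrite -[in RHS]XK; have -> : a^T *m (X *m K^T) *m b = ((K^T *m b)^T *m X *m a)^T.
    by rewrite !trmx_mul !trmxK sX !mulmxA.
  by rewrite [RHS]mxE.
lra.
Qed.

End Relaxation.

(** * Independence *)

Section Independence.
Context {d : measure_display} {T : measurableType d} {R : realType}.
Variable P : probability T R.

Definition indep (F G : set (set T)) : Prop :=
  forall A B, F A -> G B -> P (A `&` B) = (P A * P B)%E.

Lemma sub_sigma_measurable (F : set (set T)) : F `<=` measurable -> <<s F >> `<=` measurable.
Proof. by move=> mF; apply: smallest_sub => //; exact: sigma_algebra_measurable. Qed.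

Lemma indep_sym F G : indep F G -> indep G F.
Proof. by move=> FG A B GA FB; rewrite setIC muleC; exact: FG. Qed.

Lemma indep_sub F G F' G' : F `<=` F' -> G `<=` G' -> indep F' G' -> indep F G.
Proof. by move=> FF GG h A B /FF FA /GG GB; exact: h. Qed.

(** For fixed [B], the finite measures sending [A] to [P (A & B)] and to [P A * P B] agree on a
    pi-system, hence on the sigma-algebra it generates. *)
Lemma indep_sigma_left F G : setI_closed F -> F `<=` measurable ->
  G `<=` measurable -> indep F G -> indep <<s F >> G.
Proof.
move=> cF mF mG FG A B sA GB; have mB := mG _ GB.
(* With the full set added, the generators cover the space and still form a pi-system. *)
pose F' := F `|` [set setT].
pose m := mscale (NngNum (fine_ge0 (measure_ge0 P B))) P.
have mE C : m C = (P C * P B)%E.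
  by rewrite /m /mscale /= fineK ?fin_num_measure// muleC.
rewrite -mE -[LHS]/(mrestr P mB A).
apply: (g_sigma_algebra_measure_unique F' _ (fun=> setT)) => //.
- by move=> C [/mF//|->]; exact: measurableT.
- by move=> _; right.
- by apply/seteqP; split => // t _; exists 0%N.
- move=> C D [FC [FD|->]|->]; rewrite ?setIT ?setTI; last by [].
  + by left; exact: cF.
  + by left.
- move=> C FC; rewrite -[RHS]/(m C) mE -[LHS]/(P (C `&` B)).
  case: FC => [FC|->]; first exact: FG.
  by rewrite setTI probability_setT mul1e.
- move=> _; rewrite -[X in (X < _)%E]/(P (setT `&` B)) setTI.
  by rewrite ltey_eq fin_num_measure.
- apply: sub_smallest2r sA; first exact: smallest_sigma_algebra.
  by move=> C FC; left.
Qed.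

Lemma indep_sigma F G : setI_closed F -> setI_closed G ->
  F `<=` measurable -> G `<=` measurable -> indep F G ->
  indep <<s F >> <<s G >>.
Proof.
move=> cF cG mF mG FG; apply/indep_sym/indep_sigma_left => //.
  exact: sub_sigma_measurable.
by apply/indep_sym/indep_sigma_left.
Qed.

Section Grouping.
Context {I : choiceType} (F : I -> set (set T)).
Hypotheses (indF : mutually_independent P F)
  (sF : forall i, sigma_algebra setT (F i)) (mF : forall i, F i `<=` measurable).

(** These finite intersections form a pi-system generating the joint sigma-algebra of the indices in
    [J], and mutual independence is stated precisely for them. *)
Definition cylinders (J : set I) : set (set T) :=
  [set A | exists (K : {fset I}) (E : I -> set T), [/\ [set` K] `<=` J,
     forall i, F i (E i) & A = \bigcap_(i in [set` K]) E i]].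

Lemma sigma_algebraTT i : F i setT.
Proof. by have [F0 FC _] := sF i; rewrite -(setD0 setT); exact: FC. Qed.

Lemma sigma_algebraI2 i A B : F i A -> F i B -> F i (A `&` B).
Proof.
have [F0 FC FU] := sF i; move=> FA FB.
have -> : A `&` B = setT `\` (\bigcup_k (if k == 0%N then setT `\` A else setT `\` B)).
  apply/seteqP; split=> t.
    by move=> [At Bt]; split=> // -[[|k] _ [_]].
  move=> [_ h]; split; apply: contrapT => nt; apply: h.
    by exists 0%N.
  by exists 1%N.
by apply: (FC); apply: (FU) => k; case: ifP => _; exact: FC.
Qed.

Lemma cylindersI J : setI_closed (cylinders J).
Proof.
move=> A B [K1 [E1 [KJ1 FE1 ->]]] [K2 [E2 [KJ2 FE2 ->]]].
exists (K1 `|` K2)%fset, (fun i => (if i \in K1 then E1 i else setT) `&`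
   (if i \in K2 then E2 i else setT)); split.
- by move=> i /=; rewrite inE => /orP[/KJ1|/KJ2].
- by move=> i; apply: sigma_algebraI2; case: ifP => _ //; exact: sigma_algebraTT.
- apply/seteqP; split=> t /=.
    move=> [h1 h2] i /= iK; split; case: ifPn => // iK'; [exact: h1|exact: h2].
  move=> h; split=> i /= iK.
    by have [] := h i; rewrite /= ?inE ?iK// ?orbT.
  by have [] := h i; rewrite /= ?inE ?iK ?orbT.
Qed.

Lemma cylinders_measurable J : cylinders J `<=` measurable.
Proof.
move=> _ [K [E [_ FE ->]]]; apply: fin_bigcap_measurable => //.
by move=> i _; exact: mF.
Qed.

Lemma sub_cylinders J i : J i -> F i `<=` cylinders J.
Proof.
move=> Ji A FA; exists [fset i]%fset, (fun j => if j == i then A else setT); split.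
- by move=> j /=; rewrite inE => /eqP ->.
- by move=> j; case: eqP => [->//|_]; exact: sigma_algebraTT.
- apply/seteqP; split=> t /=.
    by move=> At j /=; rewrite inE => ->.
  by move/(_ i); rewrite /= inE eqxx; apply.
Qed.

Lemma cylinders_indep J1 J2 : J1 `&` J2 = set0 ->
  indep (cylinders J1) (cylinders J2).
Proof.
move=> J12 _ _ [K1 [E1 [KJ1 FE1 ->]]] [K2 [E2 [KJ2 FE2 ->]]].
have K12 i : i \in K1 -> i \in K2 -> False.
  by move=> /KJ1 i1 /KJ2 i2; have : (J1 `&` J2) i by []; rewrite J12.
pose E i := if i \in K1 then E1 i else E2 i.
have EK1 i : i \in K1 -> E i = E1 i by rewrite /E => ->.
have EK2 i : i \in K2 -> E i = E2 i.
  by rewrite /E => i2; case: ifPn => // i1; case: (K12 i).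
have -> : \bigcap_(i in [set` K1]) E1 i `&` \bigcap_(i in [set` K2]) E2 i =
    \bigcap_(i in [set` (K1 `|` K2)%fset]) E i.
  apply/seteqP; split=> t /=.
    move=> [h1 h2] i /=; rewrite inE => /orP[iK|iK].
      by rewrite EK1//; exact: h1.
    by rewrite EK2//; exact: h2.
  move=> h; split=> i /= iK.
    by rewrite -EK1//; apply: h; rewrite /= inE iK.
  by rewrite -EK2//; apply: h; rewrite /= inE iK orbT.
rewrite !indF//; last by move=> i; rewrite /E; case: ifP.
rewrite (perm_big (K1 ++ K2)) /=.
  rewrite big_cat /=; congr (_ * _)%E; apply: eq_big_seq => i iK.
    by rewrite EK1.
  by rewrite EK2.
apply: uniq_perm => //.
  rewrite cat_uniq !fset_uniq /= andbT; apply/hasPn => i i2.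
  by apply/negP => i1; exact: (K12 i).
by move=> i; rewrite inE mem_cat.
Qed.

Lemma mutual_indep_group J1 J2 : J1 `&` J2 = set0 ->
  indep <<s \bigcup_(i in J1) F i >> <<s \bigcup_(i in J2) F i >>.
Proof.
move=> J12; apply: (@indep_sub _ _ <<s cylinders J1 >> <<s cylinders J2 >>).
- apply: sub_smallest2r; first exact: smallest_sigma_algebra.
  by move=> A [i Ji FA]; exact: sub_cylinders FA.
- apply: sub_smallest2r; first exact: smallest_sigma_algebra.
  by move=> A [i Ji FA]; exact: sub_cylinders FA.
- by apply: indep_sigma; [exact: cylindersI|exact: cylindersI|
    exact: cylinders_measurable|exact: cylinders_measurable|exact: cylinders_indep].
Qed.

End Grouping.

(** By uniqueness of product measures, independence makes the joint law a product. The inner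
    integral is the expectation with the value of [X] frozen, a substitute for conditioning. *)
Lemma indep_fubini_tonelli d1 d2 (T1 : measurableType d1) (T2 : measurableType d2)
    (X : {RV P >-> T1}) (Y : {RV P >-> T2}) (f : T1 * T2 -> \bar R) :
    (forall A B, measurable A -> measurable B ->
      P (X @^-1` A `&` Y @^-1` B) = (P (X @^-1` A) * P (Y @^-1` B))%E) ->
    measurable_fun [set: T1 * T2] f -> (forall z, (0 <= f z)%E) ->
  (\int[P]_t f (X t, Y t) = \int[P]_t \int[P]_s f (X t, Y s))%E.
Proof.
move=> XY mf f0; pose XY' t := (X t, Y t).
have mXY : measurable_fun setT XY' by apply/measurable_fun_pairP.
transitivity (\int[pushforward P XY']_z f z)%E.
  by rewrite ge0_integral_pushforward.
transitivity (\int[distribution P X \x distribution P Y]_z f z)%E.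
  apply: eq_measure_integral => A mA _; apply/esym.
  apply: product_measure_unique => // B C mB mC; exact: XY.
rewrite fubini_tonelli1//.
rewrite (ge0_integral_distribution X (measurable_fun_fubini_tonelli_F f mf f0))//.
  apply: eq_integral => t _ /=; rewrite /fubini_F.
  rewrite (ge0_integral_distribution Y)//.
  exact: measurableT_comp.
by move=> x; apply: integral_ge0.
Qed.

End Independence.

(** * Expectations of real random variables *)

Section Expectation.
Context {d : measure_display} {T : measurableType d} {R : realType}.
Variable P : probability T R.
Local Notation Ex f := (Rintegral P setT f).
Local Notation intg f := (P.-integrable setT (EFin \o f)).

Lemma Ex_eq (f g : T -> R) : f =1 g -> Ex f = Ex g.
Proof. by move=> fg; apply: eq_Rintegral => t _. Qed.

Lemma eq_intg (f g : T -> R) : f =1 g -> intg f -> intg g.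
Proof. by move=> /funext ->. Qed.

Lemma ExD (f g : T -> R) : intg f -> intg g -> Ex (fun t => f t + g t) = Ex f + Ex g.
Proof. by move=> fi gi; rewrite RintegralD. Qed.

Lemma ExZ c (f : T -> R) : intg f -> Ex (fun t => c * f t) = c * Ex f.
Proof. by move=> fi; rewrite RintegralZl. Qed.

Lemma intgD (f g : T -> R) : intg f -> intg g -> intg (fun t => f t + g t).
Proof. by move=> fi gi; exact: (integrableD measurableT fi gi). Qed.

Lemma intgZ c (f : T -> R) : intg f -> intg (fun t => c * f t).
Proof. by move=> fi; exact: (integrableZl measurableT c fi). Qed.

Lemma intg_cst c : intg (fun=> c).
Proof. by apply: (finite_measure_integrable_cst P c). Qed.

Lemma intg_sum I (r : seq I) (f : I -> T -> R) :
  (forall i, intg (f i)) -> intg (fun t => \sum_(i <- r) f i t).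
Proof.
move=> fi; elim: r => [|i r IH].
  by under [fun t => _]eq_fun do rewrite big_nil; exact: intg_cst.
by under [fun t => _]eq_fun do rewrite big_cons; apply: intgD.
Qed.

Lemma Ex_cst c : Ex (fun=> c) = c.
Proof. by rewrite Rintegral_cst//= probability_setT mulr1. Qed.

Lemma Ex_sum I (r : seq I) (f : I -> T -> R) : (forall i, intg (f i)) ->
  Ex (fun t => \sum_(i <- r) f i t) = \sum_(i <- r) Ex (f i).
Proof.
move=> fi; elim: r => [|i r IH].
  by rewrite big_nil (Ex_eq (g := fun=> 0)) ?Ex_cst// => t; rewrite big_nil.
rewrite big_cons -IH -ExD//; last exact: intg_sum.
by apply: Ex_eq => t; rewrite big_cons.
Qed.

Lemma Ex_le (f g : T -> R) : intg f -> intg g -> (forall t, f t <= g t) -> Ex f <= Ex g.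
Proof. by move=> fi gi fg; apply: le_Rintegral. Qed.

Lemma Ex_fin (f : T -> R) : intg f -> (\int[P]_t (f t)%:E = (Ex f)%:E)%E.
Proof. by move=> fi; rewrite /Rintegral fineK//; exact: integrable_fin_num. Qed.

Lemma markov_ge (f : T -> R) c : intg f -> 0 < c -> (forall t, 0 <= f t) ->
  (P [set t | c <= f t]%R <= (Ex f / c)%:E)%E.
Proof.
move=> fi c0 f0; have mf : measurable_fun setT f.
  by apply/measurable_EFinP; exact: measurable_int fi.
have mA : measurable [set t | c <= f t].
  by rewrite -[X in measurable X]setTI; exact: measurable_fun_ler.
rewrite -[P _]fineK ?fin_num_measure// lee_fin ler_pdivlMr//.
have -> : fine (P [set t | c <= f t]) = Ex \1_[set t | c <= f t].
  by rewrite /Rintegral integral_indic// setIT.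
rewrite mulrC -ExZ; last exact: integrable_indic.
apply: Ex_le => //; first by apply: intgZ; exact: integrable_indic.
move=> t; rewrite indicE; case: (boolP (t \in _)) => [|_].
  by rewrite inE /= mulr1.
by rewrite mulr0.
Qed.

(** This class is closed under sums and products and consists of integrable functions, which settles
    the integrability conditions of the polynomial expansions in the concentration argument. *)
Definition bmeas (f : T -> R) :=
  measurable_fun setT f /\ exists M, forall t, `|f t| <= M.

Lemma bmeas_intg f : bmeas f -> intg f.
Proof.
case=> mf [M fM]; apply: (measurable_bounded_integrable measurableT) => //.
  by rewrite ltey_eq fin_num_measure.
exists M; split; first exact: num_real.
by move=> x Mx t _; exact: le_trans (fM t) (ltW Mx).
Qed.

Lemma bmeas_cst c : bmeas (fun=> c).
Proof. by split=> //; exists `|c|. Qed.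

Lemma bmeasD f g : bmeas f -> bmeas g -> bmeas (fun t => f t + g t).
Proof.
move=> [mf [M fM]] [mg [N gN]]; split; first exact: measurable_funD.
by exists (M + N) => t; rewrite (le_trans (ler_normD _ _))// lerD.
Qed.

Lemma bmeasM f g : bmeas f -> bmeas g -> bmeas (fun t => f t * g t).
Proof.
move=> [mf [M fM]] [mg [N gN]]; split; first exact: measurable_funM.
by exists (M * N) => t; rewrite normrM ler_pM.
Qed.

Lemma bmeasZ c f : bmeas f -> bmeas (fun t => c * f t).
Proof. exact: bmeasM (bmeas_cst c). Qed.

Lemma bmeasX f n : bmeas f -> bmeas (fun t => f t ^+ n).
Proof.
move=> bf; elim: n => [|n IH]; first by under eq_fun do rewrite expr0; exact: bmeas_cst.
by under [X in bmeas X]eq_fun do rewrite exprS; exact: bmeasM.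
Qed.

Lemma bmeas_sum I (r : seq I) (f : I -> T -> R) :
  (forall i, bmeas (f i)) -> bmeas (fun t => \sum_(i <- r) f i t).
Proof.
move=> bf; elim: r => [|i r IH].
  by under eq_fun do rewrite big_nil; exact: bmeas_cst.
by under [X in bmeas X]eq_fun do rewrite big_cons; exact: bmeasD.
Qed.

(** The factors may be unbounded, and integrability of their product is part of the claim: both are
    split into positive and negative parts, and Tonelli is applied to the four products. *)
Lemma indep_Ex_mul (F G : set (set T)) (f g : T -> R) :
    F `<=` measurable -> G `<=` measurable -> indep P F G ->
    g_sigma_algebra_preimage f `<=` F -> g_sigma_algebra_preimage g `<=` G ->
    intg f -> intg g ->
  intg (fun t => f t * g t) /\ Ex (fun t => f t * g t) = Ex f * Ex g.
Proof.
move=> mF mG FG fF gG fi gi.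
have mf : measurable_fun setT f by apply/measurable_EFinP; exact: measurable_int fi.
have mg : measurable_fun setT g by apply/measurable_EFinP; exact: measurable_int gi.
pose X : {RV P >-> R} := HB.pack f (isMeasurableFun.Build _ _ _ _ _ mf).
pose Y : {RV P >-> R} := HB.pack g (isMeasurableFun.Build _ _ _ _ _ mg).
have fgi : forall A B, measurable A -> measurable B ->
    P (X @^-1` A `&` Y @^-1` B) = (P (X @^-1` A) * P (Y @^-1` B))%E.
  move=> A B mA mB; apply: FG.
    by apply: fF; exists A => //; rewrite setTI.
  by apply: gG; exists B => //; rewrite setTI.
have tonelli (h k : R -> R) : measurable_fun setT h -> measurable_fun setT k ->
    (forall x, 0 <= h x) -> (forall x, 0 <= k x) ->
    (\int[P]_t (h (f t) * k (g t))%:E = \int[P]_t (h (f t))%:E * \int[P]_t (k (g t))%:E)%E.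
  move=> mh mk h0 k0.
  have := @indep_fubini_tonelli _ _ _ P _ _ _ _ X Y (fun z => (h z.1 * k z.2)%:E) fgi.
  rewrite /= => ->; last 2 first.
  - apply/measurable_EFinP; apply: measurable_funM.
      exact: measurableT_comp.
    exact: measurableT_comp.
  - by move=> z; rewrite lee_fin mulr_ge0.
  rewrite -ge0_integralZr//; last 3 first.
  - by apply/measurable_EFinP; exact: measurableT_comp.
  - by move=> t _; rewrite lee_fin.
  - by apply: integral_ge0 => t _; rewrite lee_fin.
  apply: eq_integral => t _; rewrite -ge0_integralZl ?lee_fin//.
    by apply/measurable_EFinP; exact: measurableT_comp.
  by move=> s _; rewrite lee_fin.
have pos (x : R) : x = Num.max x 0 - Num.max (- x) 0 by rewrite /Num.max; case: ifP; case: ifP; lra.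
pose p (x : R) := Num.max x 0; pose q (x : R) := Num.max (- x) 0.
have mp : measurable_fun setT p by apply: measurable_maxr.
have mq : measurable_fun setT q by apply: measurable_maxr => //; exact: oppr_measurable.
have p0 x : 0 <= p x by rewrite le_max lexx orbT.
have q0 x : 0 <= q x by rewrite le_max lexx orbT.
have ple x : p x <= `|x| by rewrite ge_max ler_norm normr_ge0.
have qle x : q x <= `|x| by rewrite ge_max -normrN ler_norm normr_ge0.
have part (u : T -> R) (k : R -> R) : measurable_fun setT k -> (forall x, 0 <= k x) ->
    (forall x, k x <= `|x|) -> intg u -> intg (fun t => k (u t)).
  move=> mk k0 kle ui; apply: (le_integrable measurableT _ _ ui).
    apply/measurable_EFinP; apply: measurableT_comp => //.
    by apply/measurable_EFinP; exact: measurable_int ui.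
  by move=> t _ /=; rewrite lee_fin ger0_norm.
have prod (h k : R -> R) : measurable_fun setT h -> measurable_fun setT k ->
    (forall x, 0 <= h x) -> (forall x, 0 <= k x) ->
    (forall x, h x <= `|x|) -> (forall x, k x <= `|x|) ->
    intg (fun t => h (f t) * k (g t)) /\
    Ex (fun t => h (f t) * k (g t)) = Ex (fun t => h (f t)) * Ex (fun t => k (g t)).
  move=> mh mk h0 k0 hle kle.
  have hi := part f h mh h0 hle fi; have ki := part g k mk k0 kle gi.
  have := tonelli h k mh mk h0 k0; rewrite (Ex_fin hi) (Ex_fin ki) -EFinM => E.
  split; last by rewrite /Rintegral E.
  apply/integrableP; split.
    by apply/measurable_EFinP; apply: measurable_funM; exact: measurableT_comp.
  rewrite (eq_integral (fun t => (h (f t) * k (g t))%:E)).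
    by rewrite E ltry.
  by move=> t _ /=; rewrite ger0_norm// mulr_ge0.
have [ipp Epp] := prod p p mp mp p0 p0 ple ple.
have [ipq Epq] := prod p q mp mq p0 q0 ple qle.
have [iqp Eqp] := prod q p mq mp q0 p0 qle ple.
have [iqq Eqq] := prod q q mq mq q0 q0 qle qle.
have fgE t : f t * g t = (p (f t) * p (g t) + -1 * (p (f t) * q (g t))) +
    (-1 * (q (f t) * p (g t)) + q (f t) * q (g t)).
  by rewrite [in LHS](pos (f t)) [in LHS](pos (g t)) -/(p _) -/(q _) -/(p _) -/(q _); ring.
have i1 := intgD ipp (intgZ (-1) ipq); have i2 := intgD (intgZ (-1) iqp) iqq.
split; first by apply: (eq_intg _ (intgD i1 i2)) => t; rewrite fgE.
rewrite (Ex_eq fgE) ExD// !ExD ?ExZ//; try exact: intgZ.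
rewrite Epp Epq Eqp Eqq.
have Ef (u : T -> R) : intg u -> Ex u = Ex (fun t => p (u t)) - Ex (fun t => q (u t)).
  move=> ui; have pi := part u p mp p0 ple ui; have qi := part u q mq q0 qle ui.
  rewrite -[X in _ = _ + X]mulN1r -ExZ// -ExD//; last exact: intgZ.
  by apply: Ex_eq => t; rewrite mulN1r; exact: pos.
by rewrite (Ef f)// (Ef g)//; ring.
Qed.

End Expectation.

(** * A noncommutative Khinchine inequality *)

Section TraceTaylor.
Variable R : realType.

(** Used twice in a row, it integrates an inequality between second derivatives from the origin. *)
Lemma poly_ge0_of_deriv (q : {poly R}) : q.[0] = 0 ->
  (forall s, 0 <= s -> 0 <= q^`().[s]) -> forall s, 0 <= s -> 0 <= q.[s].
Proof.
move=> q0 dq s; rewrite le_eqVlt => /orP[/eqP <-|s0]; first by rewrite q0.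
have [c] := poly_mvt q s0; rewrite q0 subr0 in_itv /= => /andP[c0 cs] ->.
by rewrite subr0 mulr_ge0 ?dq// ltW.
Qed.

Lemma trace_cycle n (S : comNzRingType) (X Y : 'M[S]_n) i j :
  \tr (Y ^+ i *m X *m Y ^+ j) = \tr (X *m Y ^+ (i + j)).
Proof. by rewrite mxtrace_mulC mulmxA mxtrace_mulC mulmxE -exprD addnC. Qed.

Section Derivative.
Variable n : nat.
Implicit Types (S X : 'M[R]_n) (M : 'M[{poly R}]_n).

Definition dermx M : 'M[{poly R}]_n := map_mx deriv M.

Lemma dermxM M M' : dermx (M *m M') = dermx M *m M' + M *m dermx M'.
Proof.
apply/matrixP => i j; rewrite !mxE raddf_sum -big_split; apply: eq_bigr => k _ /=.
by rewrite derivM !mxE.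
Qed.

Lemma dermx_trace M : (\tr M)^`() = \tr (dermx M).
Proof. by rewrite /mxtrace raddf_sum; apply: eq_bigr => i _; rewrite mxE. Qed.

Lemma dermxX M k :
  dermx (M ^+ k) = \sum_(i < k) M ^+ i *m dermx M *m M ^+ (k - i.+1).
Proof.
elim: k => [|k IH].
  rewrite big_ord0 expr0; apply/matrixP => i j; rewrite !mxE.
  by case: (i == j); rewrite ?mulr1n ?mulr0n derivC.
rewrite exprS -mulmxE dermxM IH big_ord_recl expr0 mul1mx subn1 /=; congr (_ + _).
rewrite mulmx_sumr; apply: eq_bigr => i _.
by rewrite /bump /= add1n subSS exprS -mulmxE !mulmxA.
Qed.

(** The path [S + s X] as a matrix of polynomials in [s]; differentiation becomes formal, and
    cyclicity of the trace holds over the polynomial ring. *)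
Definition pencil S X : 'M[{poly R}]_n := map_mx polyC S + 'X *: map_mx polyC X.

Lemma dermx_const X : dermx (map_mx polyC X) = 0.
Proof. by apply/matrixP => i j; rewrite !mxE derivC. Qed.

Lemma dermx_pencil S X : dermx (pencil S X) = map_mx polyC X.
Proof.
apply/matrixP => i j; rewrite !mxE derivD derivC add0r derivM derivX derivC.
by rewrite mulr0 addr0 mul1r.
Qed.

Definition evmx s M : 'M[R]_n := map_mx (horner_eval s) M.

Lemma evmxM s M M' : evmx s (M *m M') = evmx s M *m evmx s M'.
Proof. exact: map_mxM. Qed.

Lemma evmxX s M k : evmx s (M ^+ k) = evmx s M ^+ k.
Proof.
elim: k => [|k IH]; last by rewrite !exprS -!mulmxE evmxM IH.
apply/matrixP => i j; rewrite !expr0 !mxE.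
by case: (i == j); rewrite ?mulr1n ?mulr0n /horner_eval hornerC.
Qed.

Lemma evmx_trace s M : (\tr M).[s] = \tr (evmx s M).
Proof.
by rewrite /mxtrace horner_sum; apply: eq_bigr => i _; rewrite mxE.
Qed.

Lemma evmx_const s X : evmx s (map_mx polyC X) = X.
Proof. by apply/matrixP => i j; rewrite !mxE /horner_eval hornerC. Qed.

Lemma evmx_pencil s S X : evmx s (pencil S X) = S + s *: X.
Proof.
by apply/matrixP => i j; rewrite !mxE /horner_eval hornerD hornerM hornerX !hornerC.
Qed.

Lemma trace_power_deriv S X k :
  (\tr (pencil S X ^+ k))^`() =
  \tr (map_mx polyC X *m pencil S X ^+ k.-1) *+ k.
Proof.
rewrite dermx_trace dermxX linear_sum /=.
transitivity (\sum_(i < k) \tr (map_mx polyC X *m pencil S X ^+ k.-1)); last first.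
  by rewrite sumr_const card_ord.
apply: eq_bigr => i _; rewrite trace_cycle dermx_pencil; congr (\tr (_ *m _ ^+ _)).
by case: k i => [[]//|k] i; rewrite subSS /= subnKC// -ltnS.
Qed.

Lemma trace_word_deriv S X k :
  (\tr (map_mx polyC X *m pencil S X ^+ k))^`() =
  \sum_(i < k) \tr (map_mx polyC X *m pencil S X ^+ i *m map_mx polyC X
                    *m pencil S X ^+ (k - i.+1)).
Proof.
rewrite dermx_trace dermxM dermx_const mul0mx add0r dermxX mulmx_sumr linear_sum.
by apply: eq_bigr => i _; rewrite /= dermx_pencil !mulmxA.
Qed.

(** The second derivative is [k.+2] times the sum of the traces of the [k.+1] words
    [X Y^i X Y^(k - i)], to each of which [trace_word_le] applies. *)
Lemma trace_power_deriv2_le S X a k s : S^T = S -> X^T = X -> 0 <= a ->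
    specnorm X <= a -> ~~ odd k ->
  (\tr (pencil S X ^+ k.+2))^`()^`().[s] <=
    (k.+2 * k.+1)%:R * (a ^+ 2 * \tr ((S + s *: X) ^+ k)).
Proof.
move=> sS sX a0 Xa ek; rewrite trace_power_deriv derivMn /= hornerMn.
rewrite -mulr_natl natrM -mulrA ler_wpM2l// trace_word_deriv horner_sum.
rewrite -[X in X%:R]card_ord mulr_natl -sumr_const; apply: ler_sum => i _.
rewrite evmx_trace !evmxM !evmxX evmx_const evmx_pencil subSS.
have ik : (i + (k - i))%N = k by rewrite subnKC// -ltnS.
have sY : (S + s *: X)^T = S + s *: X by rewrite trmxD trmxZ sS sX.
by have := @trace_word_le _ _ _ _ _ i (k - i) sX sY a0 Xa; rewrite ik; apply.
Qed.

(** The trace of [X^m S^r] with each pair of factors [X] replaced by the scalar [a^2]; for odd [m]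
    one factor [X] survives. *)
Definition taylor_coef S X a m r : R :=
  if odd m then a ^+ m.-1 * \tr (X *m S ^+ r) else a ^+ m * \tr (S ^+ r).

Definition taylor_poly S X a k : {poly R} :=
  \poly_(m < k.+1) ('C(k, m)%:R * taylor_coef S X a m (k - m)).

Lemma taylor_coefSS S X a m r :
  taylor_coef S X a m.+2 r = a ^+ 2 * taylor_coef S X a m r.
Proof.
rewrite /taylor_coef /= negbK; case: ifPn => [om|_]; rewrite mulrA -exprD add2n//.
by case: m om.
Qed.

Lemma taylor_poly_deriv2 S X a k :
  (taylor_poly S X a k.+2)^`()^`() =
  ((k.+2 * k.+1)%:R * a ^+ 2) *: taylor_poly S X a k.
Proof.
apply/polyP => m; rewrite !coef_deriv coefZ !coef_poly !ltnS.
case: ifP => mk; last by rewrite mulr0 !mul0rn.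
rewrite taylor_coefSS !subSS -!mulrnA -mulr_natr.
have /(congr1 (fun x => x%:R : R)) e :
    ('C(k.+2, m.+2) * (m.+2 * m.+1) = (k.+2 * k.+1) * 'C(k, m))%N.
  have h1 := mul_bin_diag k.+2 m.+1; have h2 := mul_bin_diag k.+1 m.
  by rewrite mulnA (mulnC _ m.+2) -h1 /= -mulnA (mulnC _ m.+1) -h2 /= mulnA.
rewrite !natrM in e *.
transitivity ('C(k.+2, m.+2)%:R * (m.+2%:R * m.+1%:R) * (a ^+ 2 * taylor_coef S X a m (k - m)) : R).
  by ring.
by rewrite e; ring.
Qed.

(** Induction on [k]. Both sides have the same value and the same slope at 0, and their second
    derivatives compare by [trace_power_deriv2_le] and the previous case. *)
Lemma trace_power_le_taylor S X a k s : S^T = S -> X^T = X -> 0 <= a ->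
    specnorm X <= a -> 0 <= s ->
  (\tr (pencil S X ^+ k.*2)).[s] <= (taylor_poly S X a k.*2).[s].
Proof.
move=> sS sX a0 Xa; move: s.
suff h s : 0 <= s -> 0 <= (taylor_poly S X a k.*2 - \tr (pencil S X ^+ k.*2)).[s].
  by move=> s s0; rewrite -subr_ge0 -hornerN -hornerD h.
elim: k s => [|k IH] s s0.
  rewrite hornerD hornerN.
  rewrite evmx_trace evmxX evmx_pencil /taylor_poly horner_poly big_ord1.
  by rewrite /= /taylor_coef /= !expr0 bin0 !mul1r mulr1 subrr.
rewrite doubleS; move: s s0; apply: poly_ge0_of_deriv.
  rewrite hornerD hornerN evmx_trace evmxX evmx_pencil scale0r addr0.
  rewrite horner_coef0 coef_poly /= bin0 /taylor_coef /= mul1r expr0 mul1r.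
  by rewrite subn0 subrr.
rewrite derivB; apply: poly_ge0_of_deriv.
  rewrite hornerD hornerN trace_power_deriv hornerMn evmx_trace evmxM evmxX.
  rewrite evmx_const evmx_pencil scale0r addr0 horner_coef0 coef_deriv coef_poly /=.
  by rewrite bin1 /taylor_coef /= expr0 mul1r mulr1n mulr_natl subn1 subrr.
move=> s s0; rewrite derivB taylor_poly_deriv2 hornerD hornerN hornerZ.
have := IH s s0; rewrite hornerD hornerN !subr_ge0 => h.
apply: (le_trans (trace_power_deriv2_le _ sS sX a0 Xa _)); first by rewrite odd_double.
rewrite mulrA ler_wpM2l//; first by rewrite mulr_ge0// sqr_ge0.
by move: h; rewrite evmx_trace evmxX evmx_pencil.
Qed.

Lemma trace_power_add_le S X a k : S^T = S -> X^T = X -> 0 <= a ->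
    specnorm X <= a ->
  \tr ((S + X) ^+ k.*2) <=
  \sum_(m < k.*2.+1) 'C(k.*2, m)%:R * taylor_coef S X a m (k.*2 - m).
Proof.
move=> sS sX a0 Xa; have := trace_power_le_taylor k sS sX a0 Xa ler01.
rewrite evmx_trace evmxX evmx_pencil scale1r => /le_trans; apply.
rewrite /taylor_poly horner_poly le_eqVlt; apply/orP; left; apply/eqP.
by apply: eq_bigr => m _; rewrite expr1n mulr1.
Qed.

End Derivative.

Lemma sum_even_ord (f : nat -> R) k :
  \sum_(m < k.*2.+1) (if odd m then 0 else f m) = \sum_(j < k.+1) f j.*2.
Proof.
elim: k => [|k IH]; first by rewrite !big_ord1.
rewrite doubleS big_ord_recr /= big_ord_recr /= IH [RHS]big_ord_recr /=.
by rewrite odd_double addr0.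
Qed.

(** The double factorial [(2k - 1)!!], that is, the moment of order [2k] of a standard Gaussian
    variable. *)
Definition khinchine_const k : R := (k.*2)`!%:R / (2 ^+ k * k`!%:R).

Lemma khinchine_const_gt0 k : 0 < khinchine_const k.
Proof. by rewrite divr_gt0 ?mulr_gt0 ?exprn_gt0 ?ltr0n ?fact_gt0. Qed.

Lemma double_fact_ge k : (2 ^ k * k`! <= (k.*2)`!)%N.
Proof.
elim: k => [//|k IH]; rewrite doubleS !factS expnS mulnACA mulnA.
by rewrite -mulnA leq_mul ?mul2n ?doubleS// (leq_trans IH)// leq_pmull.
Qed.

(** A further factor [(2j - 1)!!] on the left would give equality, the binomial identity for
    Gaussian moments; by [double_fact_ge] this factor is at least 1. *)
Lemma khinchine_binomial k j : (j <= k)%N ->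
  'C(k.*2, j.*2)%:R * khinchine_const (k - j) <= khinchine_const k * 'C(k, j)%:R.
Proof.
move=> jk; have f0 m : (m`!%:R : R) != 0 by rewrite pnatr_eq0 -lt0n fact_gt0.
have p0 m : (2 ^+ m : R) != 0 by rewrite expf_neq0// pnatr_eq0.
have jk2 : (j.*2 <= k.*2)%N by rewrite leq_double.
have b1 : ('C(k.*2, j.*2)%:R : R) = (k.*2)`!%:R / ((j.*2)`!%:R * ((k - j).*2)`!%:R).
  by rewrite -natrM doubleB -(bin_fact jk2) natrM mulfK// natrM mulf_neq0.
have b2 : ('C(k, j)%:R : R) = k`!%:R / (j`!%:R * (k - j)`!%:R).
  by rewrite -natrM -(bin_fact jk) natrM mulfK// natrM mulf_neq0.
rewrite b1 b2 /khinchine_const.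
have -> : (2 ^+ k : R) = 2 ^+ j * 2 ^+ (k - j) by rewrite -exprD subnKC.
rewrite [leLHS](_ : _ = (k.*2)`!%:R / (2 ^+ (k - j) * (k - j)`!%:R) / (j.*2)`!%:R); last first.
  by field; rewrite !f0 !p0.
rewrite [leRHS](_ : _ =
  (k.*2)`!%:R / (2 ^+ (k - j) * (k - j)`!%:R) / (2 ^+ j * j`!%:R)); last first.
  by field; rewrite !f0 !p0.
rewrite ler_wpM2l//.
rewrite lef_pV2 ?posrE ?mulr_gt0 ?exprn_gt0 ?ltr0n ?fact_gt0//.
by rewrite -natrX -natrM ler_nat double_fact_ge.
Qed.

End TraceTaylor.

(** * Partial sums of the exponential and of the hyperbolic cosine *)

Section ExponentialSums.
Variable R : realType.

Lemma exp_partial_le (x : R) K : 0 <= x ->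
  \sum_(k < K) x ^+ k / k`!%:R <= expR x.
Proof.
move=> x0; rewrite -(big_mkord predT (fun k => x ^+ k / k`!%:R)).
apply: (@nondecreasing_cvgn_le _ (series (exp_coeff x))).
  by apply/nondecreasing_series => k _ _; rewrite /exp_coeff /= divr_ge0 ?exprn_ge0.
exact: is_cvg_series_exp_coeff.
Qed.

(** The sum is kept finite so that expectations pass through it by linearity. Since
    [expR x + expR (- x)] strictly exceeds [expR x], some partial sum of twice the hyperbolic cosine
    already does. *)
Lemma cosh_partial_ge (x : R) : exists K,
  expR x / 2 <= \sum_(k < K) x ^+ k.*2 / (k.*2)`!%:R.
Proof.
pose u m : R := series (exp_coeff x) m + series (exp_coeff (- x)) m.
have cu : u @ \oo --> expR x + expR (- x).
  by apply: cvgD; exact: is_cvg_series_exp_coeff.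
have lt : expR x < expR x + expR (- x) by rewrite ltrDl expR_gt0.
have [N _ hN] := cvgr_gt _ cu _ lt; exists N.
have uE K : u K.*2 = 2 * \sum_(k < K) x ^+ k.*2 / (k.*2)`!%:R.
  elim: K => [|K IH].
    by rewrite /u /series /= !big_geq// big_ord0 addr0 mulr0.
  rewrite big_ord_recr /= mulrDr -IH doubleS /u /series /= !big_nat_recr//=.
  have e1 : exp_coeff (- x) K.*2 = exp_coeff x K.*2.
    by rewrite /exp_coeff /= exprNn -signr_odd odd_double expr0 mul1r.
  have e2 : exp_coeff (- x) K.*2.+1 = - exp_coeff x K.*2.+1.
    by rewrite /exp_coeff /= exprNn -signr_odd /= odd_double expr1 mulN1r mulNr.
  by rewrite e1 e2 -[x ^+ K.*2 / _]/(exp_coeff x K.*2); ring.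
have /= := hN N.*2; rewrite uE => /(_ _) h; rewrite ler_pdivrMr// mulrC ltW//.
by apply: h; rewrite /= -addnn leq_addl.
Qed.

End ExponentialSums.

Section BoundedMatrices.
Context {d : measure_display} {T : measurableType d} {R : realType}.

Definition mxb m n (M : T -> 'M[R]_(m, n)) : Prop :=
  forall i j, bmeas (fun t => M t i j).

Lemma eq_bmeas (f g : T -> R) : f =1 g -> bmeas f -> bmeas g.
Proof. by move=> /funext ->. Qed.

Lemma mxb_cst m n (M : 'M[R]_(m, n)) : mxb (fun=> M).
Proof. by move=> i j; exact: bmeas_cst. Qed.

Lemma mxbM m n p (M : T -> 'M[R]_(m, n)) (N : T -> 'M[R]_(n, p)) :
  mxb M -> mxb N -> mxb (fun t => M t *m N t).
Proof.
move=> bM bN i j.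
apply: (eq_bmeas (f := fun t => \sum_k M t i k * N t k j)) => [t|].
  by rewrite mxE.
by apply: bmeas_sum => k; exact: bmeasM.
Qed.

Lemma mxbX n (M : T -> 'M[R]_n) k : mxb M -> mxb (fun t => M t ^+ k).
Proof.
move=> bM; elim: k => [|k IH]; first exact: mxb_cst.
by under eq_fun do rewrite exprS; exact: mxbM.
Qed.

Lemma bmeas_trace n (M : T -> 'M[R]_n) : mxb M -> bmeas (fun t => \tr (M t)).
Proof. by move=> bM; apply: bmeas_sum => i; exact: bM. Qed.

End BoundedMatrices.

(** * Functions measurable for a sub-sigma-algebra *)

Section SubSigma.
Context {d : measure_display} {T : measurableType d} {R : realType}.

Definition bmeasG (G : set (set T)) (f : T -> R) : Prop :=
  @bmeas _ (g_sigma_algebraType G) R f.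

Lemma measurable_funG_sub (G G' : set (set T)) (f : T -> R) :
    <<s G >> `<=` <<s G' >> ->
    measurable_fun (setT : set (g_sigma_algebraType G)) f ->
  measurable_fun (setT : set (g_sigma_algebraType G')) f.
Proof.
by move=> GG mf _ B mB; apply: GG; exact: (mf measurableT B mB).
Qed.

Lemma measurable_funG (G : set (set T)) (f : T -> R) : <<s G >> `<=` measurable ->
    measurable_fun (setT : set (g_sigma_algebraType G)) f ->
  measurable_fun setT f.
Proof.
by move=> GG mf _ B mB; apply: GG; exact: (mf measurableT B mB).
Qed.

Lemma bmeasG_sub G G' f : <<s G >> `<=` <<s G' >> -> bmeasG G f -> bmeasG G' f.
Proof. by move=> GG [mf bf]; split=> //; exact: measurable_funG_sub mf. Qed.

Lemma bmeasG_bmeas G f : <<s G >> `<=` measurable -> bmeasG G f -> bmeas f.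
Proof. by move=> GG [mf bf]; split=> //; exact: measurable_funG mf. Qed.

End SubSigma.

Lemma trace_even_ge0 (R : realType) n (S : 'M[R]_n) k : S^T = S ->
  0 <= \tr (S ^+ k.*2).
Proof.
move=> sS; have sSk : (S ^+ k)^T = S ^+ k.
  elim: k => [|k IH]; first by rewrite expr0 trmx1.
  by rewrite [in RHS]exprSr exprS -!mulmxE trmx_mul IH sS.
have -> : S ^+ k.*2 = S ^+ k *m (S ^+ k)^T by rewrite sSk mulmxE -exprD addnn.
by apply: sumr_ge0 => i _; apply: psdmx_diag_ge0; exact: psdmx_mulT.
Qed.

(** * Matrix martingale differences with bounds known in advance *)

Section MatrixMartingale.
Context {d : measure_display} {T : measurableType d} {R : realType}.
Variables (P : probability T R) (n : nat).
Variables (G : nat -> set (set T)) (X : nat -> T -> 'M[R]_n) (a : nat -> T -> R).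
Local Notation Ex f := (Rintegral P setT f).
(** [X0] expresses a vanishing conditional expectation given [G i] by testing against bounded
    functions. The norm bounds [a i] may be random, but are known at time 0. *)
Hypotheses (GS : forall i, <<s G i >> `<=` <<s G i.+1 >>)
  (mG : forall i, <<s G i >> `<=` measurable)
  (bX : forall i p q, bmeasG (G i.+1) (fun t => X i t p q))
  (sX : forall i t, (X i t)^T = X i t)
  (ba : forall i, bmeasG (G 0%N) (a i))
  (Xa : forall i t, specnorm (X i t) <= a i t)
  (X0 : forall i g p q, bmeasG (G i) g -> Ex (fun t => g t * X i t p q) = 0).

Let S N t : 'M[R]_n := \sum_(i < N) X i t.
Let V N t := \sum_(i < N) a i t ^+ 2.

Let GSle i j : (i <= j)%N -> <<s G i >> `<=` <<s G j >>.
Proof.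
move=> /subnK <-; elim: (j - i)%N => [//|k IH].
by rewrite addSn; apply: subset_trans IH _; exact: GS.
Qed.

Let bS N : @mxb _ (g_sigma_algebraType (G N)) R _ _ (S N).
Proof.
move=> p q; apply: (@eq_bmeas _ (g_sigma_algebraType (G N)) R (fun t => \sum_(i < N) X i t p q)) => [t|].
  by rewrite summxE.
by apply: bmeas_sum => i; apply: bmeasG_sub (bX i p q); exact: GSle.
Qed.

Let sS N t : (S N t)^T = S N t.
Proof. by rewrite /S linear_sum; apply: eq_bigr => i _; rewrite /= sX. Qed.

Let a0 i t : 0 <= a i t. Proof. exact: le_trans (specnorm_ge0 _) (Xa i t). Qed.

Let bV N : bmeasG (G 0%N) (V N).
Proof. by apply: bmeas_sum => i; apply: bmeasX; exact: ba. Qed.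

Let bb i (f : T -> R) : bmeasG (G i) f -> bmeas f. Proof. exact: bmeasG_bmeas. Qed.

Let b0 i (f : T -> R) : bmeasG (G 0%N) f -> bmeasG (G i) f.
Proof. by apply: bmeasG_sub; exact: GSle. Qed.

Let cross N c m r : bmeasG (G 0%N) c ->
  Ex (fun t => c t * (a N t ^+ m * \tr (X N t *m S N t ^+ r))) = 0.
Proof.
move=> bc; have bSr : @mxb _ (g_sigma_algebraType (G N)) R _ _ (fun t => S N t ^+ r).
  exact: mxbX.
have bg p q : bmeasG (G N) (fun t => c t * a N t ^+ m * (S N t ^+ r) q p).
  apply: bmeasM; last exact: bSr.
  by apply: bmeasM; [exact: b0|apply: bmeasX; exact: b0].
have bprod p q : bmeas (fun t => c t * a N t ^+ m * (S N t ^+ r) q p * X N t p q).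
  by apply: bmeasM; [exact: bb (bg p q)|exact: bb (bX N p q)].
rewrite (@Ex_eq _ _ _ _ _ (fun t =>
    \sum_p \sum_q c t * a N t ^+ m * (S N t ^+ r) q p * X N t p q)); last first.
  move=> t; rewrite mulrA /mxtrace mulr_sumr; apply: eq_bigr => p _.
  by rewrite mxE mulr_sumr; apply: eq_bigr => q _; ring.
rewrite Ex_sum => [|p]; last by apply: intg_sum => q; exact: bmeas_intg.
rewrite big1 // => p _; rewrite Ex_sum => [|q]; last exact: bmeas_intg.
by rewrite big1 // => q _; exact: X0 (bg p q).
Qed.

(** The weight [c] serves the induction on [N]: expanding in the last summand produces even powers
    of [a N], which are known at time 0 and are absorbed into the weight. *)
Lemma matrix_khinchine N k c : bmeasG (G 0%N) c -> (forall t, 0 <= c t) ->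
  Ex (fun t => c t * \tr (S N t ^+ k.*2)) <=
  n%:R * khinchine_const R k * Ex (fun t => c t * V N t ^+ k).
Proof.
elim: N k c => [|N IH] k c bc c0.
  have S0 t : S 0 t = 0 by rewrite /S big_ord0.
  have V0 t : V 0 t = 0 by rewrite /V big_ord0.
  case: k => [|k].
    rewrite -ExZ; last by apply: bmeas_intg; apply: bmeasM; [exact: bb bc|exact: bmeasX (bb (bV 0))].
    rewrite le_eqVlt; apply/orP; left; apply/eqP/Ex_eq => t.
    have k0 : khinchine_const R 0 = 1.
      by rewrite /khinchine_const double0 fact0 expr0 mul1r divr1.
    by rewrite k0 double0 !expr0 mxtrace1 !mulr1 mulrC.
  rewrite (@Ex_eq _ _ _ _ _ (fun=> 0)) ?Ex_cst; last first.
    by move=> t; rewrite S0 doubleS expr0n /= linear0 mulr0.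
  rewrite (@Ex_eq _ _ _ _ _ (fun=> 0)) ?Ex_cst ?mulr0// => t.
  by rewrite V0 expr0n mulr0.
have bSr r : bmeas (fun t => \tr (S N t ^+ r)).
  by apply: (@bb N _ _); apply: bmeas_trace; exact: mxbX.
have baN := bb (b0 0 (ba N)); have bc' := bb bc.
have bXS r : bmeas (fun t => \tr (X N t *m S N t ^+ r)).
  apply: bmeas_trace; apply: mxbM => [p q|]; first exact: bb (bX N p q).
  by apply: mxbX => p q; exact: bb (bS N p q).
have btc m r : bmeas (fun t => taylor_coef (S N t) (X N t) (a N t) m r).
  by rewrite /taylor_coef; case: (odd m); apply: bmeasM => //; exact: bmeasX.
have bSS : bmeas (fun t => \tr (S N.+1 t ^+ k.*2)).
  by apply: bmeas_trace; apply: mxbX => p q; exact: bb (bS N.+1 p q).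
apply: (@le_trans _ _ (Ex (fun t => \sum_(m < k.*2.+1)
    'C(k.*2, m)%:R * (c t * taylor_coef (S N t) (X N t) (a N t) m (k.*2 - m))))).
  apply: Ex_le => [||t].
  - by apply: bmeas_intg; exact: bmeasM.
  - by apply: intg_sum => m; apply: bmeas_intg; apply: bmeasZ; exact: bmeasM.
  rewrite (_ : \sum_(m < _) _ = c t * \sum_(m < k.*2.+1)
    'C(k.*2, m)%:R * taylor_coef (S N t) (X N t) (a N t) m (k.*2 - m)); last first.
    by rewrite mulr_sumr; apply: eq_bigr => m _; rewrite mulrCA.
  rewrite ler_wpM2l// /S big_ord_recr /=.
  by apply: trace_power_add_le => //; exact: (sS N t).
rewrite Ex_sum => [|m]; last by apply: bmeas_intg; apply: bmeasZ; exact: bmeasM.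
(* Odd terms contain [X N] exactly once and average to zero. *)
rewrite (eq_bigr (fun m : 'I_k.*2.+1 => if odd m then 0 else 'C(k.*2, m)%:R *
    Ex (fun t => c t * a N t ^+ m * \tr (S N t ^+ (k.*2 - m))))); last first.
  move=> m _; rewrite ExZ; last by apply: bmeas_intg; exact: bmeasM.
  case: ifPn => om; rewrite /taylor_coef ?om ?(negbTE om).
    by rewrite cross ?mulr0.
  by congr (_ * _); apply: Ex_eq => t; rewrite mulrA.
rewrite (sum_even_ord (fun m => 'C(k.*2, m)%:R *
    Ex (fun t => c t * a N t ^+ m * \tr (S N t ^+ (k.*2 - m))))).
apply: (@le_trans _ _ (\sum_(j < k.+1) n%:R * khinchine_const R k * ('C(k, j)%:R *
    Ex (fun t => c t * (a N t ^+ 2) ^+ j * V N t ^+ (k - j))))).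
  apply: ler_sum => j _; have jk : (j <= k)%N by rewrite -ltnS.
  have bcj : bmeasG (G 0%N) (fun t => c t * a N t ^+ j.*2).
    by apply: bmeasM => //; apply: bmeasX; exact: ba.
  have cj0 t : 0 <= c t * a N t ^+ j.*2 by rewrite mulr_ge0// exprn_ge0.
  rewrite -doubleB; apply: (le_trans (ler_wpM2l _ (IH (k - j)%N _ bcj cj0))) => //.
  have E0 : 0 <= Ex (fun t => c t * (a N t ^+ 2) ^+ j * V N t ^+ (k - j)).
    apply: Rintegral_ge0 => t _; rewrite mulr_ge0 ?exprn_ge0 ?mulr_ge0 ?exprn_ge0//.
    by apply: sumr_ge0 => i _; exact: sqr_ge0.
  rewrite (@Ex_eq _ _ _ _ _ (fun t => c t * (a N t ^+ 2) ^+ j * V N t ^+ (k - j))); last first.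
    by move=> t; rewrite -exprM mul2n.
  rewrite (_ : _ * (n%:R * _ * _) = n%:R * (('C(k.*2, j.*2)%:R * khinchine_const R (k - j)) *
    Ex (fun t => c t * (a N t ^+ 2) ^+ j * V N t ^+ (k - j)))); last by ring.
  rewrite -[leRHS]mulrA; apply: ler_wpM2l => //.
  by rewrite [leRHS]mulrA; apply: ler_wpM2r E0 _ _ _; exact: khinchine_binomial.
rewrite -mulr_sumr; have bterm (j : nat) : bmeas (fun t => c t * (a N t ^+ 2) ^+ j * V N t ^+ (k - j)).
  apply: bmeasM; last exact: bmeasX (bb (bV N)).
  by apply: bmeasM => //; do 2 apply: bmeasX.
rewrite ler_wpM2l//; first by rewrite mulr_ge0// ltW// khinchine_const_gt0.
rewrite (eq_bigr (fun j : 'I_k.+1 => Ex (fun t => 'C(k, j)%:R * (c t * (a N t ^+ 2) ^+ j * V N t ^+ (k - j))))); last first.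
  by move=> j _; rewrite ExZ//; exact: bmeas_intg.
rewrite -Ex_sum => [|j]; last by apply: bmeas_intg; exact: bmeasZ.
rewrite le_eqVlt; apply/orP; left; apply/eqP/Ex_eq => t.
have -> : V N.+1 t = V N t + a N t ^+ 2 by rewrite /V big_ord_recr.
rewrite exprDn mulr_sumr; apply: eq_bigr => j _.
by rewrite -mulr_natr; ring.
Qed.

(** The test function [F] is a truncation of the trace of [cosh (b S)]. With [q = 2n / delta] its
    mean is at most [n e^(b^2 / 2) = n q], while on the failure set it is at least
    [e^(b^2) / 2 = q^2 / 2]; Markov's inequality bounds the probability of failure by
    [2n / q = delta]. *)
Lemma matrix_hoeffding N delta : (0 < n)%N -> 0 < delta < 1 ->
    (forall t, V N t <= 1) ->
  let b := Num.sqrt (2 * ln (2 * n%:R / delta)) in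
  exists E : set T, [/\ measurable E, ((1 - delta)%:E <= P E)%E &
    forall t, E t -> loewner_le (- b%:M) (S N t) /\ loewner_le (S N t) b%:M].
Proof.
move=> n0 /andP[d0 d1] V1 b; set q := 2 * n%:R / delta.
have n1 : (1 : R) <= n%:R by rewrite ler1n.
have q1 : 1 <= q by rewrite /q ler_pdivlMr// mul1r; lra.
have q0 : 0 < q by exact: lt_le_trans q1.
have b0' : 0 <= b by exact: sqrtr_ge0.
have b2 : b ^+ 2 = 2 * ln q by rewrite sqr_sqrtr// mulr_ge0// ln_ge0.
have eb2 : expR (b ^+ 2 / 2) = q by rewrite b2 mulrC mulKf// lnK.
have eb : expR (b ^+ 2) = q ^+ 2 by rewrite b2 expRM_natl lnK.
have [K hK] := cosh_partial_ge (b ^+ 2); rewrite eb in hK.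
set C := \sum_(k < K) _ in hK.
have C0 : 0 < C by apply: lt_le_trans hK; rewrite divr_gt0// exprn_gt0.
pose F t := \sum_(k < K) b ^+ k.*2 / (k.*2)`!%:R * \tr (S N t ^+ k.*2).
have bT k : bmeas (fun t => \tr (S N t ^+ k.*2)).
  by apply: (@bb N _ _); apply: bmeas_trace; exact: mxbX.
have bF : bmeas F by apply: bmeas_sum => k; exact: bmeasZ.
have FE : Rintegral P setT F <= n%:R * q.
  rewrite Ex_sum => [|k]; last by apply: bmeas_intg; exact: bmeasZ.
  apply: (@le_trans _ _ (n%:R * \sum_(k < K) (b ^+ 2 / 2) ^+ k / k`!%:R)); last first.
    rewrite ler_wpM2l// -eb2; apply: exp_partial_le.
    by rewrite divr_ge0// sqr_ge0.
  rewrite mulr_sumr; apply: ler_sum => k _; rewrite ExZ; last exact: bmeas_intg.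
  have := @matrix_khinchine N k (fun=> 1) (@bmeas_cst _ _ _ 1) (fun=> ler01).
  rewrite (@Ex_eq _ _ _ _ _ (fun t => \tr (S N t ^+ k.*2))); last by move=> t; rewrite mul1r.
  have V0 t : 0 <= V N t by apply: sumr_ge0 => i _; exact: sqr_ge0.
  have : Ex (fun t => 1 * V N t ^+ k) <= 1.
    rewrite -[leRHS](Ex_cst P); apply: Ex_le => [||t].
    - by apply: bmeas_intg; apply: bmeasZ; apply: bmeasX; exact: bb (bV N).
    - exact: intg_cst.
    - by rewrite mul1r exprn_ile1.
  move=> Vk h; have nk0 : 0 <= n%:R * khinchine_const R k.
    by rewrite mulr_ge0// ltW// khinchine_const_gt0.
  have := le_trans h (ler_wpM2l nk0 Vk); rewrite mulr1 => h'.
  have c0 : 0 <= b ^+ k.*2 / (k.*2)`!%:R by rewrite divr_ge0// exprn_ge0.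
  apply: (le_trans (ler_wpM2l c0 h')); rewrite /khinchine_const.
  have f0 m : (m`!%:R : R) != 0 by rewrite pnatr_eq0 -lt0n fact_gt0.
  (* The Gaussian constant turns the series of cosh into that of the exponential: [(2k - 1)!! b^(2k)
     / (2k)! = (b^2 / 2)^k / k!]. *)
  rewrite le_eqVlt; apply/orP; left; apply/eqP.
  rewrite -mul2n exprM expr_div_n; field.
  by rewrite !f0 expf_neq0// pnatr_eq0.
have T0 t k : 0 <= \tr (S N t ^+ k.*2) by apply: trace_even_ge0; exact: sS.
have F0 t : 0 <= F t.
  apply: sumr_ge0 => k _; rewrite mulr_ge0// divr_ge0// exprn_ge0//.
have mbad : measurable [set t | C <= F t].
  by rewrite -[X in measurable X]setTI; apply: measurable_fun_ler => //; case: bF.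
exists (~` [set t | C <= F t]); split.
- exact: measurableC.
- rewrite probability_setC// EFinB leeB//.
  apply: (le_trans (markov_ge (bmeas_intg P bF) C0 F0)); rewrite lee_fin.
  rewrite ler_pdivrMr//; apply: (le_trans FE).
  apply: (@le_trans _ _ (delta * (q ^+ 2 / 2))); last by rewrite ler_wpM2l// ltW.
  rewrite le_eqVlt; apply/orP; left; apply/eqP; rewrite /q; field.
  by rewrite gt_eqF.
- move=> t /negP; rewrite -ltNge => FC; apply: contrapT => bad.
  move: FC; rewrite ltNge => /negP; apply; apply: ler_sum => k _.
  rewrite mulrAC ler_wpM2r ?invr_ge0//.
  rewrite -exprM mul2n -addnn exprD ler_wpM2l ?exprn_ge0//.
  by apply: trace_even_ge => //; exact: sS.
Qed.

End MatrixMartingale.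

(** * Measurable matrix-valued functions *)

Section MatrixFunctions.
Context {d : measure_display} {T : measurableType d} {R : realType}.

Definition mxmeas m n (X : T -> 'M[R]_(m, n)) : Prop :=
  forall i j, measurable_fun setT (fun t => X t i j).

Lemma measurable_mxP m n (X : T -> 'M[R]_(m, n)) : measurable_fun setT X <-> mxmeas X.
Proof.
split=> [mX i j _ B mB|mX].
  rewrite setTI.
  have := mX measurableT [set M | B (M i j)]; rewrite setTI; apply.
  by apply: sub_sigma_algebra; exists i, j, B.
apply: (@measurability _ _ _ _ _ _ ([set S | exists i j (C : set R),
         measurable C /\ S = [set M : 'M[R]_(m, n) | C (M i j)]])) => //.
move=> _ [_ [i [j [C [mC ->]]]] <-].
exact: mX.
Qed.

Lemma eq_mxmeas m n (X Y : T -> 'M[R]_(m, n)) : X =1 Y -> mxmeas X -> mxmeas Y.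
Proof. by move=> /funext ->. Qed.

Lemma eq_measurable (f g : T -> R) : f =1 g -> measurable_fun setT f -> measurable_fun setT g.
Proof. by move=> /funext ->. Qed.

Lemma mxmeas_cst m n (M : 'M[R]_(m, n)) : mxmeas (fun=> M).
Proof. by move=> i j; exact: measurable_cst. Qed.

Lemma mxmeasD m n (X Y : T -> 'M[R]_(m, n)) : mxmeas X -> mxmeas Y ->
  mxmeas (fun t => X t + Y t).
Proof.
move=> mX mY i j; apply: (eq_measurable (f := fun t => X t i j + Y t i j)).
  by move=> t; rewrite mxE.
exact: measurable_funD.
Qed.

Lemma mxmeasZ m n (f : T -> R) (X : T -> 'M[R]_(m, n)) : measurable_fun setT f ->
  mxmeas X -> mxmeas (fun t => f t *: X t).
Proof.
move=> mf mX i j; apply: (eq_measurable (f := fun t => f t * X t i j)).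
  by move=> t; rewrite mxE.
exact: measurable_funM.
Qed.

Lemma mxmeasB m n (X Y : T -> 'M[R]_(m, n)) : mxmeas X -> mxmeas Y ->
  mxmeas (fun t => X t - Y t).
Proof.
move=> mX mY; apply: mxmeasD => //; apply: (eq_mxmeas (X := fun t => -1 *: Y t)).
  by move=> t; rewrite scaleN1r.
exact: mxmeasZ.
Qed.

Lemma mxmeasM m n p (X : T -> 'M[R]_(m, n)) (Y : T -> 'M[R]_(n, p)) :
  mxmeas X -> mxmeas Y -> mxmeas (fun t => X t *m Y t).
Proof.
move=> mX mY i j; apply: (eq_measurable (f := fun t => \sum_k X t i k * Y t k j)).
  by move=> t; rewrite mxE.
by apply: measurable_sum => k; exact: measurable_funM.
Qed.

Lemma mxmeas_tr m n (X : T -> 'M[R]_(m, n)) : mxmeas X -> mxmeas (fun t => (X t)^T).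
Proof.
move=> mX i j; apply: (eq_measurable (f := fun t => X t j i)) => // t.
by rewrite mxE.
Qed.

Lemma mxmeas_sum m n I (r : seq I) (X : I -> T -> 'M[R]_(m, n)) :
  (forall i, mxmeas (X i)) -> mxmeas (fun t => \sum_(i <- r) X i t).
Proof.
move=> mX i j; apply: (eq_measurable (f := fun t => \sum_(k <- r) X k t i j)).
  by move=> t; rewrite summxE.
by apply: measurable_sum => k; exact: mX.
Qed.

Lemma measurable_det n (X : T -> 'M[R]_n) : mxmeas X -> measurable_fun setT (fun t => \det (X t)).
Proof.
move=> mX; apply: measurable_sum => s; apply: measurable_funM => //.
by apply: measurable_prod => i _; exact: mX.
Qed.

Lemma mxmeas_adj n (X : T -> 'M[R]_n) : mxmeas X -> mxmeas (fun t => \adj (X t)).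
Proof.
move=> mX i j; apply: (eq_measurable (f := fun t => cofactor (X t) j i)).
  by move=> t; rewrite mxE.
apply: measurable_funM => //; apply: measurable_det => k l.
apply: (eq_measurable (f := fun t => X t (lift j k) (lift i l))) => // t.
by rewrite !mxE.
Qed.

Lemma measurable_inv (f : T -> R) : measurable_fun setT f ->
  measurable_fun setT (fun t => (f t)^-1).
Proof.
(* The real power is applied to the nonnegative [f ^ 2]; at a zero of [f] both sides vanish, as
   [0^-1 = 0]. *)
move=> mf; apply: (eq_measurable (f := fun t => f t * (f t ^+ 2) `^ (-1))).
  move=> t; rewrite powR_inv1 ?sqr_ge0//; have [->|f0] := eqVneq (f t) 0.
    by rewrite mul0r invr0.
  by rewrite expr2 invfM mulrA mulfV// mul1r.
apply: measurable_funM => //.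
exact: (measurableT_comp (measurable_powR (-1)) (measurable_funX 2 mf)).
Qed.

Lemma mxmeas_inv n (X : T -> 'M[R]_n) : mxmeas X -> (forall t, X t \in unitmx) ->
  mxmeas (fun t => invmx (X t)).
Proof.
move=> mX uX; apply: (eq_mxmeas (X := fun t => (\det (X t))^-1 *: \adj (X t))).
  by move=> t; rewrite /invmx uX.
apply: mxmeasZ; last exact: mxmeas_adj.
by apply: measurable_inv; exact: measurable_det.
Qed.

(* A Lipschitz function is the limit of its compositions with the roundings to
   finer and finer grids, and these take countably many values. *)
Lemma measurable_lipschitz_mx m n (f : 'M[R]_(m, n) -> R) C (X : T -> 'M[R]_(m, n)) :
    0 <= C ->
    (forall M N, `|f M - f N| <= C * \sum_i \sum_j `|M i j - N i j|) ->
  mxmeas X -> measurable_fun setT (fun t => f (X t)).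
Proof.
move=> C0 fC mX.
pose grid k (q : 'M[int]_(m, n)) : 'M[R]_(m, n) := map_mx (fun z => z%:~R / k.+1%:R) q.
pose rd k t : 'M[int]_(m, n) := map_mx (fun x => Num.floor (x * k.+1%:R)) (X t).
apply: (measurable_fun_cvg (h := fun k t => f (grid k (rd k t)))) => [k|t _].
  move=> _ B mB; rewrite setTI.
  have -> : (fun t => f (grid k (rd k t))) @^-1` B =
      \bigcup_(q in [set: 'M[int]_(m, n)]) (if `[< B (f (grid k q)) >] then
        [set t | rd k t = q] else set0).
    apply/seteqP; split=> t /=.
      by move=> Bt; exists (rd k t) => //; case: asboolP.
    by move=> [q _]; case: asboolP => // Bq /= ->.
  apply: countable_bigcupT_measurable => [|q]; first exact: countableP.
  case: ifP => _ //.
  have -> : [set t | rd k t = q] = \bigcap_(i in [set: 'I_m]) \bigcap_(j in [set: 'I_n])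
      [set t | (q i j)%:~R <= X t i j * k.+1%:R < (q i j + 1)%:~R].
    apply/seteqP; split=> t /=.
      by move=> <- i _ j _ /=; rewrite mxE; exact: floor_itv.
    move=> h; apply/matrixP => i j; rewrite mxE; apply: floor_def.
    exact: h.
  apply: fin_bigcap_measurable => [|i _]; first exact: finite_finset.
  apply: fin_bigcap_measurable => [|j _]; first exact: finite_finset.
  have mf : measurable_fun setT (fun t => X t i j * k.+1%:R) by apply: measurable_funM.
  rewrite (_ : mkset _ = (fun t => X t i j * k.+1%:R) @^-1` `[(q i j)%:~R, (q i j + 1)%:~R[).
    by rewrite -[X in measurable X]setTI; apply: mf.
  by apply/seteqP; split=> s /=; rewrite in_itv.
apply/cvgrPdist_le => e e0.
have [K _ hK] : \forall k \near \oo, C * (m * n)%:R / k.+1%:R <= e.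
  have := @cvg_harmonic R => /cvgrPdist_le /(_ (e / (C * (m * n)%:R + 1))) [].
    by rewrite divr_gt0// ltr_wpDl// mulr_ge0.
  move=> K _ hK; exists K => // k /= Kk; have := hK k Kk.
  rewrite /= sub0r normrN ger0_norm ?invr_ge0// ler_pdivlMr ?ltr_wpDl ?mulr_ge0//.
  move=> h; apply: le_trans h; rewrite [leRHS]mulrC ler_wpM2r ?invr_ge0//.
  by rewrite lerDl.
exists K => // k /= /hK; apply: le_trans; apply: (le_trans (fC _ _)).
rewrite -mulrA ler_wpM2l//.
rewrite (@le_trans _ _ (\sum_(i < m) \sum_(j < n) k.+1%:R^-1))//.
  apply: ler_sum => i _; apply: ler_sum => j _; rewrite !mxE.
  have /andP[h1 h2] := floor_itv (X t i j * k.+1%:R).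
  have k0 : 0 < k.+1%:R :> R by rewrite ltr0n.
  have -> : X t i j - (Num.floor (X t i j * k.+1%:R))%:~R / k.+1%:R =
      (X t i j * k.+1%:R - (Num.floor (X t i j * k.+1%:R))%:~R) / k.+1%:R.
    by rewrite mulrBl mulfK// gt_eqF.
  rewrite ger0_norm; last by rewrite divr_ge0// subr_ge0.
  rewrite ler_pdivrMr// mulVf ?gt_eqF// lerBlDl ltW//.
  by rewrite intrD in h2.
rewrite sumr_const sumr_const !card_ord -mulrnA -[X in X <= _]mulr_natr mulrC.
by rewrite mulnC.
Qed.

Lemma mxmeas_tens m n p q (X : T -> 'M[R]_(m, n)) (Y : T -> 'M[R]_(p, q)) :
  mxmeas X -> mxmeas Y -> mxmeas (fun t => tensmx (X t) (Y t)).
Proof.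
move=> mX mY i j.
apply: (eq_measurable (f := fun t => X t (mxtens_unindex i).1 (mxtens_unindex j).1 *
   Y t (mxtens_unindex i).2 (mxtens_unindex j).2)) => [t|]; first by rewrite mxE.
exact: measurable_funM.
Qed.

Lemma mxmeas_skron m n (X : T -> 'M[R]_(m, n)) : mxmeas X ->
  mxmeas (fun t => skron (X t)).
Proof.
move=> mX; apply: mxmeasM; last exact: mxmeas_cst.
by apply: mxmeasM; [exact: mxmeas_cst|exact: mxmeas_tens].
Qed.

Lemma mxmeas_svec n (X : T -> 'M[R]_n) : mxmeas X -> mxmeas (fun t => svec (X t)).
Proof.
move=> mX k j.
apply: (eq_measurable (f := fun t => (if (enum_val k).1 == (enum_val k).2 then 1 else Num.sqrt 2) *
    X t (enum_val k).2 (enum_val k).1)) => [t|]; first by rewrite ord1 svecE.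
exact: measurable_funM.
Qed.

Lemma mxmeas_smat n (x : T -> 'cV[R]_(sdim n)) : mxmeas x -> mxmeas (fun t => smat (x t)).
Proof.
move=> mx; apply: mxmeas_sum => k; apply: mxmeasZ; first exact: mx.
exact: mxmeas_cst.
Qed.

End MatrixFunctions.

(** Measurability for the sigma-algebra generated by [U]; it records on which random variables a
    random matrix depends. *)
Notation mxmeas_on U X := (@mxmeas _ (g_sigma_algebraType U) _ _ _ X).

Lemma mxmeas_id (R : realType) m n : mxmeas (fun M : 'M[R]_(m, n) => M).
Proof. by apply/measurable_mxP; exact: measurable_id. Qed.

Lemma measurable_quadric (R : realType) n (S : 'M[R]_n) :
  measurable [set y : 'cV[R]_n | qform S y = 0].
Proof.
rewrite (_ : [set y | _] = setT `&` (fun y => qform S y) @^-1` [set 0]); last by rewrite setTI.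
have mi := @mxmeas_id R n 1.
by apply: (mxmeasM (mxmeasM (mxmeas_tr mi) (mxmeas_cst S)) mi).
Qed.

(** * Genericity of samples with a density *)

Section QuadricNull.
Variable R : realType.

Lemma lebesgue_cV_ge0 n (S : set 'cV[R]_n) : (0 <= lebesgue_cV S)%E.
Proof.
elim: n S => [|n IH] S /=; first exact: measure_ge0.
by apply: integral_ge0 => x _; exact: IH.
Qed.

(** [f] is carried by a finite set, which is null and all of whose subsets are measurable; so [f]
    may be any nonnegative function, such as the measure of the slices of a set. *)
Lemma integral0_off_roots (p : {poly R}) (f : R -> \bar R) : p != 0 ->
  (forall x, ~~ root p x -> f x = 0%E) -> (forall x, (0 <= f x)%E) ->
  (\int[@lebesgue_measure R]_x f x = 0)%E.
Proof.
move=> p0 f0 fge0.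
pose Z : set R := [set x | root p x].
have finZ : finite_set Z.
  apply: (@sub_finite_set _ _ [set` rootsR p]); last exact: finite_seq.
  move=> x /= px; have := roots_on_rootsR p0 x.
  by rewrite [root p x]px in_itv /= => <-.
have cZ : countable Z by exact: finite_set_countable.
have mZ (B : set R) : B `<=` Z -> measurable B.
  move=> BZ; apply: countable_measurable => //.
  by apply: sub_countable cZ; apply: subset_card_le.
have fE : f = f \_ Z.
  apply/funext => x; rewrite patchE; case: ifPn => // /negP xZ.
  by apply: f0; apply/negP => px; apply: xZ; rewrite inE.
rewrite fE -integral_mkcond; apply: null_set_integral.
- exact: mZ.
- by move=> _ B mB; apply: mZ => x [].
- exact: countable_lebesgue_measure0.
Qed.

Lemma qform_block n (x : R) (y : 'cV[R]_n) (S : 'M[R]_(1 + n)) : S^T = S ->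
  qform S (col_mx (const_mx x : 'cV[R]_1) y) =
  x ^+ 2 * S (lshift n 0) (lshift n 0) + 2 * x * (ursubmx S *m y) 0 0 +
  qform (drsubmx S) y.
Proof.
move=> sS; rewrite /qform -{1}[S]submxK tr_col_mx mul_row_block mul_row_col.
have -> : (const_mx x : 'cV[R]_1) = x%:M.
  by apply/matrixP => i j; rewrite !mxE !ord1 mulr1n.
rewrite tr_scalar_mx !mul_scalar_mx !mul_mx_scalar mulmxDl -scalemxAl scalerDr.
have -> : y^T *m dlsubmx S = (ursubmx S *m y)^T.
  by rewrite trmx_mul trmx_ursub sS.
set u := ursubmx S *m y; set w := y^T *m drsubmx S *m y.
by clearbody u w; rewrite !mxE; ring.
Qed.

(** Induction on the dimension. Slicing at the first coordinate [x] leaves a quadric with linear and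
    constant terms depending on [x], hence the inhomogeneous form of the statement; a slice
    degenerates only at the roots of a nonzero polynomial in [x]. *)
Lemma quadric_lebesgue0 n (S : 'M[R]_n) (b : 'cV[R]_n) (c : R) : S^T = S ->
    ~ [/\ S = 0, b = 0 & c = 0] ->
  lebesgue_cV [set y | qform S y + (b^T *m y) 0 0 + c = 0] = 0%E.
Proof.
elim: n S b c => [|n IH] S b c sS nz.
  have S0 : S = 0 by apply/matrixP => -[].
  have b0 : b = 0 by apply/matrixP => -[].
  rewrite /= diracE (_ : _ \in _ = false)//; apply/negP; rewrite inE /=.
  rewrite /qform mulmx0 mxE add0r mulmx0 mxE add0r => c0; exact: nz.
pose S1 : 'M[R]_(1 + n) := S; pose b1 : 'cV[R]_(1 + n) := b.
pose s := S1 (lshift n 0) (lshift n 0); pose r := (ursubmx S1)^T.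
pose S' := drsubmx S1; pose b' := dsubmx b1; pose b0 := b1 (lshift n 0) 0.
have sS' : S'^T = S' by rewrite /S' trmx_drsub -[in LHS]/(S1) [S1^T]sS.
have slice x (y : 'cV[R]_n) :
    qform S (col_mx (const_mx x : 'cV[R]_1) y) +
      (b^T *m (col_mx (const_mx x : 'cV[R]_1) y : 'cV[R]_(1 + n))) 0 0 + c =
    qform S' y + ((b' + (2 * x) *: r)^T *m y) 0 0 + (c + b0 * x + s * x ^+ 2).
  have -> := @qform_block n x y S1 sS.
  have -> : (b^T *m (col_mx (const_mx x : 'cV[R]_1) y : 'cV[R]_(1 + n))) 0 0 =
      b0 * x + (b'^T *m y) 0 0.
    have -> : b^T = row_mx (usubmx b1)^T b'^T by rewrite -tr_col_mx vsubmxK.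
    rewrite (mul_row_col (usubmx b1)^T b'^T) mxE; congr (_ + _).
    by rewrite mxE big_ord1 !mxE.
  rewrite trmxD trmxZ trmxK mulmxDl -scalemxAl -/S' -/s.
  set u := ursubmx S1 *m y; set w := b'^T *m y.
  by clearbody u w; rewrite !mxE; ring.
(* [p] is constant if a quadratic part in [y] remains, an entry of the linear part [b' + 2 x r] if
   one is not identically zero, and the constant term otherwise. *)
have [p p0 hp] : exists2 p : {poly R}, p != 0 & forall x, ~~ root p x ->
    ~ [/\ S' = 0, b' + (2 * x) *: r = 0 & c + b0 * x + s * x ^+ 2 = 0].
  have [S'0|S'0] := eqVneq S' 0; last first.
    by exists 1; [exact: oner_neq0|move=> x _ [/eqP]; rewrite (negbTE S'0)].
  have [/existsP[i bri]|] := boolP [exists i, (b' i 0 != 0) || (r i 0 != 0)].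
    exists ((b' i 0)%:P + (2 * r i 0)%:P * 'X).
      apply/eqP => /polyP pz; have := pz 0%N; have := pz 1%N.
      rewrite !coefD !coefC !coefCM !coefX /= mulr0 mulr1 addr0 add0r => /eqP h1 h0.
      by move: bri h1; rewrite h0 eqxx /= mulf_eq0 pnatr_eq0 /= => /negPf ->.
    move=> x; rewrite rootE !hornerE => /eqP nr [_ /colP/(_ i) e _]; apply: nr.
    by move: e; rewrite !mxE; lra.
  rewrite negb_exists => /forallP br0.
  have b'0 : b' = 0.
    by apply/colP => i; rewrite [RHS]mxE; have := br0 i; rewrite negb_or !negbK => /andP[/eqP].
  have r0 : r = 0.
    by apply/colP => i; rewrite [RHS]mxE; have := br0 i; rewrite negb_or !negbK => /andP[_ /eqP].
  exists (c%:P + b0%:P * 'X + s%:P * 'X ^+ 2).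
    apply/eqP => /polyP pz; apply: nz.
    have := pz 0%N; have := pz 1%N; have := pz 2%N.
    rewrite !coefD !coefC !coefCM !coefX !coefXn /= !mulr0 !mulr1 !addr0 !add0r => s0 b00 c0.
    have S0 : S1 = 0.
      rewrite -[S1]submxK -/S' S'0.
      have -> : ursubmx S1 = 0 by rewrite -[LHS]trmxK -/r r0 trmx0.
      have -> : dlsubmx S1 = 0.
        have -> : dlsubmx S1 = r by rewrite /r trmx_ursub [S1^T]sS.
        exact: r0.
      have -> : ulsubmx S1 = 0 by apply/matrixP => i j; rewrite !mxE !ord1.
      exact: block_mx0.
    split=> //; rewrite -[b]/b1 -[b1]vsubmxK -/b' b'0.
    have -> : usubmx b1 = 0 by apply/matrixP => i j; rewrite !mxE !ord1.
    exact: (@col_mx0 R 1 n 1).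
  move=> x; rewrite rootE !hornerE => /eqP nr [_ _ e]; apply: nr.
  by rewrite -e; ring.
rewrite /=; apply: (integral0_off_roots p0) => [x px|x]; last exact: lebesgue_cV_ge0.
rewrite -[RHS](IH S' (b' + (2 * x) *: r) (c + b0 * x + s * x ^+ 2) sS' (hp x px)).
by congr lebesgue_cV; apply/seteqP; split=> y /=; rewrite slice.
Qed.

End QuadricNull.

Section Genericity.
Context {d : measure_display} {T : measurableType d} {R : realType}.
Variables (P : probability T R) (n : nat) (Z : nat -> {RV P >-> 'cV[R]_n}).
Let F k := \bigcup_(i in [set i | (i < k)%N]) g_sigma_algebra_preimage (Z i).
Hypotheses (indZ : forall k, (k < sdim n)%N ->
    indep P <<s F k >> (g_sigma_algebra_preimage (Z k)))
  (nullZ : forall k (S : 'M[R]_n), (k < sdim n)%N -> S^T = S -> S != 0 ->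
    P (Z k @^-1` [set y | qform S y = 0]) = 0%E).

Definition dyad_rows (z : nat -> 'cV[R]_n) k : 'M[R]_(k, sdim n) :=
  \matrix_(i < k) (svec (z i *m (z i)^T))^T.

(** Linear independence of the rows becomes the nonvanishing of a polynomial in the entries, hence a
    measurable condition. *)
Lemma row_free_gram m p (V : 'M[R]_(m, p)) : row_free V = (\det (V *m V^T) != 0).
Proof.
rewrite -unitfE -/(unitmx _); apply/idP/idP; first exact: gram_unit.
move=> u; rewrite -kermx_eq0; apply/rowV0P => v /sub_kermxP vV.
apply: (row_free_inj (A := V *m V^T)); first by rewrite row_free_unit.
by rewrite mulmxA vV !mul0mx.
Qed.

Lemma svec_dot (S X : 'M[R]_n) : S^T = S -> X^T = X ->
  ((svec S)^T *m svec X) 0 0 = \tr (S *m X).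
Proof.
move=> sS sX; have -> : (svec S)^T *m svec X = (vec S)^T *m vec X.
  by rewrite -(Qmx_vec sS) trmx_mul -mulmxA Qmx_svec.
rewrite vec_dot /mxtrace; apply: eq_bigr => i _; rewrite mxE; apply: eq_bigr => j _.
by congr (_ * _); rewrite -[in LHS]sX mxE.
Qed.

Lemma measurable_not_row_free d' (T' : measurableType d') m p (V : T' -> 'M[R]_(m, p)) :
  mxmeas V -> measurable [set t | ~~ row_free (V t)].
Proof.
move=> mV; have -> : [set t | ~~ row_free (V t)] = setT `&` (fun t => \det (V t *m (V t)^T)) @^-1` [set 0].
  by rewrite setTI; apply/seteqP; split=> t /=; rewrite row_free_gram negbK => /eqP.
exact: (measurable_det (mxmeasM mV (mxmeas_tr mV))).
Qed.

Lemma mxmeas_dyad_rows d' (T' : measurableType d') (z : nat -> T' -> 'cV[R]_n) k :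
  (forall i, (i < k)%N -> mxmeas (z i)) -> mxmeas (fun t => dyad_rows (fun i => z i t) k).
Proof.
move=> mz i j; apply: (eq_measurable (f := fun t => svec (z i t *m (z i t)^T) j 0)).
  by move=> t; rewrite !mxE.
have mi := mz i (ltn_ord i).
by apply: mxmeas_svec; apply: mxmeasM => //; exact: mxmeas_tr.
Qed.

Lemma dyad_sym (z : 'cV[R]_n) : (z *m z^T)^T = z *m z^T.
Proof. by rewrite trmx_mul trmxK. Qed.

Definition extended k (t : T) (y : 'cV[R]_n) i : 'cV[R]_n := if (i < k)%N then Z i t else y.

(** If [y] destroys linear independence, then [svec (y y^T)] is a combination of the earlier rows
    and is orthogonal to every [u] they annihilate: [y] lies on the quadric of [smat u]. *)
Lemma row_free_step k t y : (k < sdim n)%N -> row_free (dyad_rows (fun i => Z i t) k) ->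
    ~~ row_free (dyad_rows (extended k t y) k.+1) ->
  forall u : 'cV[R]_(sdim n), dyad_rows (fun i => Z i t) k *m u = 0 ->
  qform (smat u) y = 0.
Proof.
move=> kD fk nfk u Vu.
have rowE i (ik : (i < k)%N) : row (Ordinal ik) (dyad_rows (fun i => Z i t) k) = (svec (Z i t *m (Z i t)^T))^T.
  by rewrite rowK.
have [c [c0 cV]] : exists c : 'rV[R]_k.+1, c != 0 /\ c *m dyad_rows (extended k t y) k.+1 = 0.
  move: nfk; rewrite -kermx_eq0 => /rowV0Pn[c /sub_kermxP cV c0].
  by exists c.
have e : \sum_(i < k) c 0 (widen_ord (leqnSn k) i) *: row i (dyad_rows (fun i => Z i t) k)
    + c 0 ord_max *: (svec (y *m y^T))^T = 0.
  rewrite -[RHS]cV mulmx_sum_row big_ord_recr /=; congr (_ + _).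
    by apply: eq_bigr => i _; rewrite !rowK /extended /= ltn_ord.
  by rewrite rowK /extended /= ltnn.
have cmax : c 0 ord_max != 0.
  apply: contra_neq c0 => c0; move: e; rewrite c0 scale0r addr0.
  pose c' : 'rV[R]_k := \row_i c 0 (widen_ord (leqnSn k) i).
  have -> : \sum_(i < k) c 0 (widen_ord (leqnSn k) i) *: row i (dyad_rows (fun i => Z i t) k) =
      c' *m dyad_rows (fun i => Z i t) k.
    by rewrite mulmx_sum_row; apply: eq_bigr => i _; rewrite mxE.
  rewrite -(mul0mx _ (dyad_rows (fun i => Z i t) k)) => /(row_free_inj fk) c'0.
  apply/rowP => i; rewrite mxE; have [j ->|->] := unliftP ord_max i.
    move/rowP/(_ j): c'0; rewrite !mxE => <-; congr (c 0 _).
    by apply: val_inj; rewrite /= /bump leqNgt ltn_ord.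
  exact: c0.
have : c 0 ord_max * ((svec (y *m y^T))^T *m u) 0 0 = 0.
  have := congr1 (fun M => (M *m u) 0 0) e; rewrite mulmxDl mulmx_suml big1 ?add0r.
    by rewrite mul0mx -scalemxAl mxE => ->; rewrite mxE.
  by move=> i _; rewrite -scalemxAl -row_mul Vu row0 scaler0.
move/eqP; rewrite mulf_eq0 (negbTE cmax) /= => /eqP.
rewrite -[in X in X -> _](svecK u) svec_dot ?dyad_sym ?smat_sym//.
by rewrite mxtrace_mulC trace_dyad.
Qed.

(** Given [k < sdim n] samples with independent dyads, the next one can spoil independence only on a
    proper quadric that they determine. By independence of the samples this quadric may be frozen,
    and it is null for the law of the next sample. *)
Lemma dyad_rows_free_ae k : (k <= sdim n)%N ->
  measurable [set t | ~~ row_free (dyad_rows (fun i => Z i t) k)] /\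
  P [set t | ~~ row_free (dyad_rows (fun i => Z i t) k)] = 0%E.
Proof.
pose B m := [set t | ~~ row_free (dyad_rows (fun i => Z i t) m)].
have mB m : measurable (B m).
  apply: measurable_not_row_free; apply: mxmeas_dyad_rows => i _; exact/measurable_mxP.
elim: k => [|k IH] kD.
  split; first exact: mB.
  rewrite (_ : [set t | _] = set0) ?measure0//; apply/seteqP; split=> // t /=.
  by rewrite row_free_gram det_mx00 oner_eq0.
split; first exact: mB.
have [_ Bk0] := IH (ltnW kD).
(* The identity from [T] to this coarser space is a random variable that carries the first [k]
   samples at once. *)
pose Tk := g_sigma_algebraType (F k).
have mF : <<s F k >> `<=` measurable.
  by apply: sub_sigma_measurable => S [i _ [C mC <-]]; exact: measurable_funPT.
pose D (p : Tk * 'cV[R]_n) := dyad_rows (extended k p.1 p.2) k.+1.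
have mZk i : (i < k)%N -> measurable_fun (setT : set Tk) (Z i : Tk -> 'cV[R]_n).
  move=> ik _ S mS; apply: sub_gen_smallest; exists i => //; exists S => //.
have mD : mxmeas D.
  apply: (@mxmeas_dyad_rows _ _ (fun i (p : Tk * 'cV[R]_n) => extended k p.1 p.2 i)) => i _.
  apply/measurable_mxP; have [ik|ik] := boolP (i < k)%N.
    rewrite (_ : (fun p => _) = Z i \o (fst : Tk * 'cV[R]_n -> Tk)); last first.
      by apply/funext => p; rewrite /extended ik.
    by apply: (measurableT_comp (mZk i ik)); exact: measurable_fst.
  rewrite (_ : (fun p => _) = snd); first exact: measurable_snd.
  by apply/funext => p; rewrite /extended (negbTE ik).
(* With [B k] removed, every slice is either empty or contained in a proper quadric. *)
pose C := [set p : Tk * 'cV[R]_n | ~~ row_free (D p)] `\` (B k `*` setT).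
have mC : measurable C.
  apply: measurableD; first exact: measurable_not_row_free.
  apply: measurableX => //; apply: (@measurable_not_row_free _ Tk).
  by apply: (@mxmeas_dyad_rows _ Tk Z) => i ik; apply/measurable_mxP; exact: mZk.
have mid : measurable_fun (setT : set T) (id : T -> Tk).
  by move=> _ S mS; rewrite setTI; exact: mF.
pose X : {RV P >-> Tk} := HB.pack (id : T -> Tk) (isMeasurableFun.Build _ _ _ _ _ mid).
have mCX : measurable [set t | C (t, Z k t)].
  rewrite -[X in measurable X]setTI.
  have mp : measurable_fun setT (fun t : T => (X t, Z k t)) by apply/measurable_fun_pairP.
  exact: mp.
have C0 : P [set t | C (t, Z k t)] = 0%E.
  transitivity (\int[P]_t (\1_C (X t, Z k t))%:E)%E.
    by rewrite -[X in P X]setIT -integral_indic.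
  rewrite (@indep_fubini_tonelli _ _ _ P _ _ _ _ X (Z k) (fun p => (\1_C p)%:E))//; last 2 first.
  - move=> S S' mS mS'; apply: (indZ kD) => //.
    by exists S' => //; rewrite setTI.
  - by apply/measurable_EFinP; exact: measurable_indic.
  apply: integral0_eq => t _.
  have mA : measurable [set s | C (t, Z k s)].
    rewrite -[X in measurable X]setTI.
    have mp : measurable_fun setT (fun s : T => ((t : Tk), Z k s)).
      by apply/measurable_fun_pairP; split; [exact: measurable_cst|exact: measurable_funPT].
    exact: mp.
  transitivity (P [set s | C (t, Z k s)]).
    by rewrite -[X in P X]setIT -integral_indic.
  have [Bt|nBt] := pselect (B k t).
    by rewrite (_ : [set s | _] = set0) ?measure0//; apply/seteqP; split=> // s [_]; case.
  have fk : row_free (dyad_rows (fun i => Z i t) k) by apply/negPn/negP.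
  have [u [u0 Vu]] : exists u : 'cV[R]_(sdim n), u != 0 /\ dyad_rows (fun i => Z i t) k *m u = 0.
    pose V := dyad_rows (fun i => Z i t) k.
    have : kermx V^T != 0.
      by rewrite -mxrank_eq0 mxrank_ker mxrank_tr (eqP fk) subn_eq0 -ltnNge.
    move=> /rowV0Pn[c /sub_kermxP cV c0]; exists c^T; split; first by rewrite trmx_eq0.
    by rewrite -[LHS]trmxK trmx_mul trmxK cV trmx0.
  have su : smat u != 0.
    apply: contra_neq u0 => u0; rewrite -[u]svecK u0.
    by apply/colP => i; rewrite svecE !mxE mulr0.
  apply/eqP; rewrite eq_le measure_ge0 andbT -(nullZ kD (smat_sym u) su).
  apply: le_measure; rewrite ?inE//.
    rewrite -[X in measurable X]setTI; apply: (measurable_funPT (Z k)) => //.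
    exact: measurable_quadric.
  by move=> s [/= Dts _]; exact: (row_free_step kD fk Dts Vu).
have sub : B k.+1 `<=` B k `|` [set t | C (t, Z k t)].
  move=> t bt; have [|nbt] := pselect (B k t); [by left|right; split; last by case].
  rewrite /= /D /=; move: bt; rewrite /B /=.
  have -> // : dyad_rows (extended k t (Z k t)) k.+1 = dyad_rows (fun i => Z i t) k.+1.
  apply/row_matrixP => i; rewrite !rowK /extended; case: ifP => // ik.
  by have -> : (i : nat) = k by apply/eqP; rewrite eqn_leq -ltnS ltn_ord leqNgt ik.
apply/eqP; rewrite eq_le measure_ge0 andbT.
apply: (le_trans (le_measure P _ _ sub)); rewrite ?inE; [exact: mB|exact: measurableU|].
apply: (le_trans (measureU2 _ (mB k) mCX)).
by rewrite [X in (X + _)%E]Bk0 [X in (_ + X)%E]C0 adde0.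
Qed.

Lemma dyads_generate (z : nat -> 'cV[R]_n) (X : 'M[R]_n) :
    row_free (dyad_rows z (sdim n)) -> X^T = X ->
  exists c : 'I_(sdim n) -> R, X = \sum_i c i *: (z i *m (z i)^T).
Proof.
rewrite row_free_unit => uV sX.
pose c := (svec X)^T *m invmx (dyad_rows z (sdim n)).
exists (c 0); apply: svec_inj_sym => //.
  rewrite linear_sum; apply: eq_bigr => i _.
  by rewrite [LHS]trmxZ dyad_sym.
rewrite svec_sum; apply: trmx_inj.
have -> : (svec X)^T = c *m dyad_rows z (sdim n) by rewrite mulmxKV.
rewrite mulmx_sum_row linear_sum; apply: eq_bigr => i _.
by rewrite rowK [RHS]trmxZ.
Qed.

End Genericity.

(** * Equivalence of the stochastic and the covariance-propagation problems *)

Section SecondMoments.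
Context {d : measure_display} {T : measurableType d} {R : realType}.
Variable P : probability T R.
Local Notation Ex f := (Rintegral P setT f).
Local Notation intg f := (P.-integrable setT (EFin \o f)).

(** Cross products are included, so that every entry of [second_moment] is a genuine expectation and
    not a default of [fine]. *)
Definition sqint n (X : T -> 'cV[R]_n) : Prop :=
  forall i j, intg (fun t => X t i 0 * X t j 0).

Lemma second_momentE n (X : T -> 'cV[R]_n) i j :
  second_moment P X i j = Ex (fun t => X t i 0 * X t j 0).
Proof. by rewrite mxE unlock. Qed.

Lemma second_moment_sym n (X : T -> 'cV[R]_n) : (second_moment P X)^T = second_moment P X.
Proof.
by apply/matrixP => i j; rewrite mxE !second_momentE; apply: Ex_eq => t; rewrite mulrC.
Qed.

Lemma sqint_square n (X : T -> 'cV[R]_n) : mxmeas X ->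
  (forall i, (\int[P]_t (X t i 0 ^+ 2)%:E < +oo)%E) -> sqint X.
Proof.
move=> mX fin i j.
have sqi k : intg (fun t => X t k 0 ^+ 2).
  apply/integrableP; split; first by apply/measurable_EFinP; apply: measurable_funX; exact: mX.
  rewrite (eq_integral (fun t => (X t k 0 ^+ 2)%:E))//.
  by move=> t _ /=; rewrite ger0_norm// sqr_ge0.
apply: (le_integrable measurableT _ _ (intgD (sqi i) (sqi j))).
  by apply/measurable_EFinP; apply: measurable_funM; exact: mX.
move=> t _ /=; rewrite lee_fin [leRHS]ger0_norm ?addr_ge0 ?sqr_ge0// normrM.
rewrite -(normr_id (X t i 0)) -[X in _ <= X + _]real_normK ?num_real//.
rewrite -[X in _ <= _ + X]real_normK ?num_real// normr_id.
have := normr_ge0 (X t i 0); have := normr_ge0 (X t j 0).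
set a := `|X t i 0|; set b := `|X t j 0| => b0 a0; clearbody a b; nra.
Qed.

Lemma qformE n (H : 'M[R]_n) (x : 'cV[R]_n) :
  qform H x = \sum_i \sum_j H j i * (x i 0 * x j 0).
Proof.
rewrite /qform mxE; apply: eq_bigr => i _; rewrite mxE mulr_suml.
by apply: eq_bigr => j _; rewrite mxE; ring.
Qed.

Lemma qform_second_moment n (H : 'M[R]_n) (X : T -> 'cV[R]_n) : sqint X ->
  intg (fun t => qform H (X t)) /\
  Ex (fun t => qform H (X t)) = \tr (second_moment P X *m H).
Proof.
move=> iX; have E t := qformE H (X t).
have i1 i : intg (fun t => \sum_j H j i * (X t i 0 * X t j 0)).
  by apply: intg_sum => j; apply: intgZ; exact: iX.
split; first by apply: (eq_intg (f := fun t => \sum_i \sum_j H j i * (X t i 0 * X t j 0))) => //; exact: intg_sum.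
rewrite (Ex_eq P E) Ex_sum// /mxtrace; apply: eq_bigr => i _.
rewrite Ex_sum ?mxE => [|j]; last by apply: intgZ; exact: iX.
apply: eq_bigr => j _; rewrite second_momentE [RHS]mulrC -ExZ//; exact: iX.
Qed.

Lemma second_moment_psd n (X : T -> 'cV[R]_n) : sqint X -> psdmx (second_moment P X).
Proof.
move=> iX; split=> [|y]; first exact: second_moment_sym.
rewrite -trace_dyad; have [yi <-] := qform_second_moment (y *m y^T) iX.
rewrite -(Ex_cst P 0); apply: Ex_le => //; first exact: intg_cst.
by move=> t; exact: (psdmx_dyad y).2.
Qed.

(** A product of two entries of linear images is itself a quadratic form, which reduces moments of
    linear images to [qform_second_moment]. *)
Lemma mul_entry_qform m n (M N : 'M[R]_(m, n)) (x : 'cV[R]_n) i j :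
  (M *m x) i 0 * (N *m x) j 0 = qform ((row i M)^T *m row j N) x.
Proof.
have -> : qform ((row i M)^T *m row j N) x = ((row i M *m x)^T *m (row j N *m x)) 0 0.
  by rewrite /qform trmx_mul !mulmxA.
by rewrite -!row_mul [RHS]mxE big_ord1 [_^T _ _]mxE 2![row _ _ _ _]mxE.
Qed.

Lemma trace_mul_row m n (S : 'M[R]_n) (M N : 'M[R]_(m, n)) i j : S^T = S ->
  \tr (S *m ((row i M)^T *m row j N)) = (M *m S *m N^T) i j.
Proof.
move=> sS; rewrite mulmxA mxtrace_mulC mulmxA /mxtrace big_ord1.
have -> : (M *m S *m N^T) i j = (N *m S *m M^T) j i.
  have -> : N *m S *m M^T = (M *m S *m N^T)^T by rewrite !trmx_mul trmxK sS mulmxA.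
  by rewrite [RHS]mxE.
rewrite -row_mul mxE [RHS]mxE; apply: eq_bigr => k _.
by rewrite [row _ (_ *m _) _ _]mxE; congr (_ * _); rewrite !mxE.
Qed.

Lemma second_moment_mul m n (M : 'M[R]_(m, n)) (X : T -> 'cV[R]_n) : sqint X ->
  sqint (fun t => M *m X t) /\
  second_moment P (fun t => M *m X t) = M *m second_moment P X *m M^T.
Proof.
move=> iX; have q i j := qform_second_moment ((row i M)^T *m row j M) iX.
have E i j t := mul_entry_qform M M (X t) i j.
split=> [i j|]; first by apply: (eq_intg (fun t => esym (E i j t))); have [] := q i j.
apply/matrixP => i j; rewrite second_momentE (Ex_eq P (E i j)).
by have [_ ->] := q i j; rewrite trace_mul_row//; exact: second_moment_sym.
Qed.

(** A product of two entries of the image is a sum of products of two noise entries with a quadratic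
    form in [z]; independence factors each expectation, leaving the terms of [moment_map]. *)
Lemma moment_step nx nu nw (A : 'I_nw -> 'M[R]_nx) (B : 'I_nw -> 'M[R]_(nx, nu))
    (F G : set (set T)) (om : T -> 'cV[R]_nw) (z : T -> 'cV[R]_(nx + nu)) :
    <<s F >> `<=` measurable -> <<s G >> `<=` measurable -> indep P <<s F >> <<s G >> ->
    mxmeas_on F om ->
    mxmeas_on G z ->
    sqint om -> sqint z ->
  sqint (fun t => model_at A B (z t) *m om t) /\
  second_moment P (fun t => model_at A B (z t) *m om t) =
    moment_map A B (second_moment P om) (second_moment P z).
Proof.
move=> mF mG FG mom mz iom iz.
pose q i j k l t := qform ((row i (model A B k))^T *m row j (model A B l)) (z t).
have pre (U : set (set T)) (f : T -> R) :
    measurable_fun (setT : set (g_sigma_algebraType U)) f ->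
    g_sigma_algebra_preimage f `<=` <<s U >>.
  by move=> mf _ [C mC <-]; exact: mf.
have E i j t : (model_at A B (z t) *m om t) i 0 * (model_at A B (z t) *m om t) j 0 =
    \sum_k \sum_l (om t k 0 * om t l 0) * q i j k l t.
  rewrite 2![in LHS]mxE mulr_suml; apply: eq_bigr => k _.
  rewrite mulr_sumr; apply: eq_bigr => l _.
  by rewrite /q -mul_entry_qform [model_at _ _ _ _ _]mxE [model_at _ _ _ j _]mxE; ring.
have kl i j k l : intg (fun t => (om t k 0 * om t l 0) * q i j k l t) /\
    Ex (fun t => (om t k 0 * om t l 0) * q i j k l t) =
    second_moment P om k l *
      (model A B k *m second_moment P z *m (model A B l)^T) i j.
  have [iq Eq] := qform_second_moment ((row i (model A B k))^T *m row j (model A B l)) iz.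
  have [] := @indep_Ex_mul _ _ _ P <<s F >> <<s G >> (fun t => om t k 0 * om t l 0) (q i j k l)
    mF mG FG _ _ (iom k l) iq.
  - by apply: pre; apply: measurable_funM; exact: mom.
  - apply: pre; rewrite /q /qform; apply: mxmeasM => //.
    by apply: mxmeasM; [exact: mxmeas_tr|exact: mxmeas_cst].
  move=> i1 ->; split=> //.
  by rewrite second_momentE /q Eq trace_mul_row//; exact: second_moment_sym.
have i2 i j k : intg (fun t => \sum_l (om t k 0 * om t l 0) * q i j k l t).
  by apply: intg_sum => l; have [] := kl i j k l.
split=> [i j|].
  by apply: (eq_intg (fun t => esym (E i j t))); exact: intg_sum.
apply/matrixP => i j; rewrite second_momentE (Ex_eq P (E i j)) Ex_sum//.
rewrite /moment_map summxE; apply: eq_bigr => k _.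
rewrite Ex_sum ?summxE => [|l]; last by have [] := kl i j k l.
by apply: eq_bigr => l _; have [_ ->] := kl i j k l; rewrite [RHS]mxE.
Qed.

End SecondMoments.

(** * Causal inputs and feasible moment trajectories *)

Section ControlEquivalence.
Context {d : measure_display} {T : measurableType d} {R : realType}.
Variable P : probability T R.
Local Notation Ex f := (Rintegral P setT f).
Local Notation intg f := (P.-integrable setT (EFin \o f)).
Context {nx nu nv nw : nat}.
Variables (At : 'I_nv -> 'M[R]_nx) (Bt : 'I_nv -> 'M[R]_(nx, nu)).
Variables (A : 'I_nw -> 'M[R]_nx) (B : 'I_nw -> 'M[R]_(nx, nu)).
Variables (C : 'M[R]_(nw, nv)) (W : 'M[R]_nw).
Variables (x0 : {RV P >-> 'cV[R]_nx}) (vs : nat -> {RV P >-> 'cV[R]_nv}).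
Variables (xi : nat -> {RV P >-> R}).
Variables (Q : 'M[R]_nx) (Ru : 'M[R]_nu).
Let F (i : option (nat + nat)) : set (set T) :=
  match i with
  | None => g_sigma_algebra_preimage x0
  | Some (inl s) => g_sigma_algebra_preimage (vs s)
  | Some (inr s) => g_sigma_algebra_preimage (xi s)
  end.
Hypothesis indF : mutually_independent P F.
Hypothesis dyn : forall y : 'cV[R]_nv, \sum_i y i 0 *: model At Bt i =
  \sum_k (C *m y) k 0 *: model A B k.
Hypotheses (sqv : forall s, sqint P (fun t => C *m vs s t))
  (momv : forall s, second_moment P (fun t => C *m vs s t) = W)
  (sq0 : sqint P x0) (psW : psdmx W) (pH : pdmx (block_mx Q 0 0 Ru)).
Local Notation H := (block_mx Q 0 0 Ru).
Local Notation state := (state At Bt x0 vs).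

Let F_measurable i : F i `<=` measurable.
Proof. by case: i => [[s|s]|] S [D mD <-]; exact: measurable_funPT. Qed.

Let F_sigma i : sigma_algebra setT (F i).
Proof.
by case: i => [[s|s]|]; apply: sigma_algebra_preimage; exact: sigma_algebra_measurable.
Qed.

(** The variables on which state and input at time [s] may depend: the state uses the noise up to
    [s - 1] only, whereas the input may use the randomization variable of time [s]. *)
Definition past s : set (option (nat + nat)) := [set i |
  match i with
  | None => True
  | Some (inl r) => (r < s)%N
  | Some (inr r) => (r <= s)%N
  end].

Definition past_sets s := \bigcup_(i in past s) F i.

Definition noise_sets s := \bigcup_(i in [set Some (inl s : nat + nat)]) F i.

Lemma past_measurable s : <<s past_sets s >> `<=` measurable.
Proof. by apply: sub_sigma_measurable => S [i _]; exact: F_measurable. Qed.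

Lemma noise_measurable s : <<s noise_sets s >> `<=` measurable.
Proof. by apply: sub_sigma_measurable => S [i _]; exact: F_measurable. Qed.

Lemma past_le s r : (s <= r)%N -> <<s past_sets s >> `<=` <<s past_sets r >>.
Proof.
move=> sr; apply: sub_sigma_algebra2 => S [i ip FS]; exists i => //.
case: i ip {FS} => [[k|k]|] //=; first by move=> ks; exact: leq_trans ks sr.
by move=> ks; exact: leq_trans ks sr.
Qed.

Lemma noise_past_indep s : indep P <<s noise_sets s >> <<s past_sets s >>.
Proof.
apply: mutual_indep_group => //; apply/seteqP; split=> // i [/= -> /=].
by rewrite ltnn.
Qed.

Lemma mul_model_at (A' : 'I_nw -> 'M[R]_nx) (B' : 'I_nw -> 'M[R]_(nx, nu)) z om :
  model_at A' B' z *m om = (\sum_k om k 0 *: model A' B' k) *m z.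
Proof.
apply/colP => i; rewrite mxE mulmx_suml summxE; apply: eq_bigr => k _.
by rewrite [model_at _ _ _ _ _]mxE -scalemxAl [RHS]mxE mulrC.
Qed.

Lemma stateS u s t : state u s.+1 t =
  model_at A B (col_mx (state u s t) (u s t)) *m (C *m vs s t).
Proof.
rewrite mul_model_at -dyn /= -mul_row_col; congr (_ *m _).
under [RHS]eq_bigr do rewrite /model scale_row_mx.
by elim/big_rec3: _ => [|i a b c _ <-]; rewrite ?row_mx0// add_row_mx.
Qed.

Let gen (U : set (set T)) n (X : T -> 'cV[R]_n) :
  g_sigma_algebra_preimage X `<=` <<s U >> ->
  mxmeas_on U X.
Proof.
by move=> h; apply/measurable_mxP => _ S mS; apply: h; exists S.
Qed.

Let gen_sub (U U' : set (set T)) n (X : T -> 'cV[R]_n) : <<s U >> `<=` <<s U' >> ->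
  mxmeas_on U X ->
  @mxmeas _ (g_sigma_algebraType U') R _ _ X.
Proof. by move=> UU mX i j; exact: measurable_funG_sub (mX i j). Qed.

Let gen_pre (U : set (set T)) n (X : T -> 'cV[R]_n) :
  mxmeas_on U X ->
  g_sigma_algebra_preimage X `<=` <<s U >>.
Proof.
by move=> /measurable_mxP mX S [D mD <-]; exact: (mX measurableT D mD).
Qed.

Lemma noise_mxmeas s : mxmeas_on (noise_sets s)
  (fun t => C *m vs s t).
Proof.
apply: mxmeasM; first exact: mxmeas_cst.
apply: gen => S FS; apply: sub_gen_smallest.
by exists (Some (inl s)).
Qed.

(** States and inputs are treated together: an input is measurable for the history generated by the
    states so far, and the next state for the noise and that input. *)
Lemma causal_mxmeas u : causal_input At Bt x0 vs xi u -> forall s,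
  mxmeas_on (past_sets s) (state u s) /\
  mxmeas_on (past_sets s) (u s).
Proof.
move=> cu.
have input s : (forall r, (r <= s)%N ->
    mxmeas_on (past_sets r) (state u r)) ->
  mxmeas_on (past_sets s) (u s).
  move=> ms; apply: gen; apply: subset_trans (cu s) _.
  apply: smallest_sub; first exact: smallest_sigma_algebra.
  move=> S [r /= rs [FS|FS]].
    by apply: (past_le rs); apply: (gen_pre (ms r rs)).
  by apply: sub_gen_smallest; exists (Some (inr r)).
have states s : forall r, (r <= s)%N ->
    mxmeas_on (past_sets r) (state u r).
  elim: s => [|s IH] r.
    rewrite leqn0 => /eqP ->; apply: gen => S FS; apply: sub_gen_smallest.
    by exists None.
  rewrite leq_eqVlt ltnS => /orP[/eqP ->|]; last exact: IH.
  have mx := IH s (leqnn s); have mu := input s IH.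
  have mv : mxmeas_on (past_sets s.+1) (vs s).
    by apply: gen => S FS; apply: sub_gen_smallest; exists (Some (inl s)) => //=.
  have step := gen_sub (past_le (leqnSn s)).
  have {}mx := step _ _ mx; have {}mu := step _ _ mu.
  apply: mxmeasD; apply: mxmeasM => //; apply: mxmeas_sum => i; apply: mxmeasZ;
    by [exact: mv|exact: mxmeas_cst].
by move=> s; split; [exact: states|apply: input => r _; exact: states].
Qed.

Definition joint u s t : 'cV[R]_(nx + nu) := col_mx (state u s t) (u s t).

Lemma joint_mxmeas u : causal_input At Bt x0 vs xi u -> forall s,
  mxmeas_on (past_sets s) (joint u s).
Proof.
move=> cu s i j; have [mx mu] := causal_mxmeas cu s.
rewrite /joint; case: (fintype.splitP i) => k ik.
  rewrite (_ : (fun t => _) = fun t => state u s t k j); first exact: mx.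
  by apply/funext => t; rewrite (_ : i = lshift _ k) ?col_mxEu//; exact: val_inj.
rewrite (_ : (fun t => _) = fun t => u s t k j); first exact: mu.
by apply/funext => t; rewrite (_ : i = rshift _ k) ?col_mxEd//; exact: val_inj.
Qed.

Lemma state_second_moment u s : causal_input At Bt x0 vs xi u -> sqint P (joint u s) ->
  sqint P (state u s.+1) /\
  second_moment P (state u s.+1) = moment_map A B W (second_moment P (joint u s)).
Proof.
move=> cu iz; rewrite (_ : state u s.+1 = fun t => model_at A B (joint u s t) *m (C *m vs s t)).
  rewrite -(momv s); apply: (@moment_step _ _ _ P nx nu nw A B (noise_sets s) (past_sets s)) => //.
  - exact: noise_measurable.
  - exact: past_measurable.
  - exact: noise_past_indep.
  - exact: noise_mxmeas.
  - exact: joint_mxmeas.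
by apply/funext => t; exact: stateS.
Qed.

Lemma stage_costE x u : qform Q x + qform Ru u = qform H (col_mx x u).
Proof.
rewrite /qform tr_col_mx mul_row_block mul_row_col !mulmx0 addr0 add0r.
by rewrite [RHS]mxE.
Qed.

Lemma input_costE u : causal_input At Bt x0 vs xi u ->
  (\int[P]_t \sum_(0 <= s <oo) (qform Q (state u s t) + qform Ru (u s t))%:E =
   \sum_(0 <= s <oo) \int[P]_t (qform H (joint u s t))%:E)%E.
Proof.
move=> cu; rewrite -integral_nneseries//.
- by apply: eq_integral => t _; apply: eq_eseriesr => s _; rewrite stage_costE.
- move=> s; apply/measurable_EFinP.
  have mz : mxmeas (joint u s).
    by move=> i j; apply: measurable_funG (@past_measurable s) _; exact: joint_mxmeas.
  by apply: mxmeasM => //; apply: mxmeasM; [exact: mxmeas_tr|exact: mxmeas_cst].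
- by move=> s t _; rewrite lee_fin; exact: (pdmx_psdmx pH).2.
Qed.

(** An infinite cost leaves nothing to prove. A finite one makes every stage cost integrable, and as
    [H] dominates a positive multiple of the identity, all second moments exist; they form a
    feasible trajectory of equal cost. *)
Lemma val_LQRcp_le_SLQR :
  (val_LQRcp A B W H (second_moment P x0) <= val_SLQR P At Bt x0 vs xi Q Ru)%E.
Proof.
apply: le_ereal_inf_tmp => _ [u cu ->]; rewrite input_costE//.
have [->|cfin] := eqVneq (\sum_(0 <= s <oo) \int[P]_t (qform H (joint u s t))%:E)%E (+oo)%E.
  exact: leey.
have pos s t : 0 <= qform H (joint u s t) by exact: (pdmx_psdmx pH).2.
have sq s : sqint P (joint u s).
  have mz : mxmeas (joint u s).
    by move=> i j; apply: measurable_funG (@past_measurable s) _; exact: joint_mxmeas.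
  have fin : (\int[P]_t (qform H (joint u s t))%:E < +oo)%E.
    rewrite ltey; apply: contra_neq cfin => E; apply: (@nneseries_pinfty _ _ _ s) => // r _.
    by apply: integral_ge0 => t _; rewrite lee_fin.
  have [e e0 eH] := pdmx_lower_bound pH.
  apply: sqint_square => // i.
  have le t : (joint u s t i 0) ^+ 2 <= e^-1 * qform H (joint u s t).
    rewrite mulrC ler_pdivlMr// mulrC.
    have := eH.2 (joint u s t); rewrite qformD qformN qform_scalar subr_ge0.
    apply: le_trans; rewrite ler_pM2l// dot_sumE (bigD1 i)//= -expr2 lerDl.
    by apply: sumr_ge0 => k _; rewrite -expr2; exact: sqr_ge0.
  have mq : measurable_fun setT (fun t => qform H (joint u s t)).
    by apply: mxmeasM => //; apply: mxmeasM; [exact: mxmeas_tr|exact: mxmeas_cst].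
  apply: le_lt_trans (_ : (e^-1%:E * \int[P]_t (qform H (joint u s t))%:E < +oo)%E).
    rewrite -ge0_integralZl//; last 3 first.
    - exact/measurable_EFinP.
    - by move=> t _; rewrite lee_fin.
    - by rewrite lee_fin invr_ge0 ltW.
    apply: ge0_le_integral => //.
    - by move=> t _; rewrite lee_fin sqr_ge0.
    - by apply/measurable_EFinP; apply: measurable_funX; exact: mz.
    - by apply/measurable_EFinP; apply: measurable_funM.
    - by move=> t _; rewrite -EFinM lee_fin.
  by apply: lte_mul_pinfty => //; rewrite lee_fin invr_ge0 ltW.
apply: ereal_inf_lbound.
exists (fun s => second_moment P (state u s)), (fun s => second_moment P (joint u s)).
split; last first.
  apply: eq_eseriesr => s _; have [iH <-] := qform_second_moment H (sq s).
  exact: Ex_fin.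
split=> // s; split; [exact: second_moment_psd| |by have [] := state_second_moment cu (sq s)].
apply/matrixP => i j; rewrite mxE [LHS]mxE !second_momentE.
by apply: Ex_eq => t; rewrite !col_mxEu.
Qed.

(** Under the feedback with the gains of [psdmx_gain], the second moments of the state stay below
    the given [X s] by monotonicity of the moment map, so that no stage costs more than [Z s]. *)
Lemma val_SLQR_le_LQRcp :
  (val_SLQR P At Bt x0 vs xi Q Ru <= val_LQRcp A B W H (second_moment P x0))%E.
Proof.
apply: le_ereal_inf_tmp => _ [X [Z [[X00 XZ] ->]]].
pose K s : 'M[R]_(nu, nx) := xget 0 [set L | loewner_le (Pimx L (X s)) (Z s)].
have hK s : loewner_le (Pimx (K s) (X s)) (Z s).
  have [L hL] : exists L, loewner_le (Pimx L (X s)) (Z s).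
    by have [pZ <- _] := XZ s; exact: psdmx_gain.
  exact: (xgetI (0 : 'M[R]_(nu, nx)) (P := [set L | loewner_le (Pimx L (X s)) (Z s)]) hL).
(* The closed loop is defined on its own, because [state] takes the input as an argument while this
   input depends on the state. *)
pose x := fix x s t : 'cV[R]_nx := if s is r.+1 then
    (\sum_i vs r t i 0 *: At i) *m x r t + (\sum_i vs r t i 0 *: Bt i) *m (K r *m x r t)
  else x0 t.
pose u s t := K s *m x s t.
have xE s t : state u s t = x s t by elim: s => [//|s IH] /=; rewrite IH.
have jE s : joint u s = fun t => col_mx 1%:M (K s) *m state u s t.
  by apply/funext => t; rewrite /joint mul_col_mx mul1mx /u xE.
have cu : causal_input At Bt x0 vs xi u.
  move=> s; rewrite /history.
  have -> : u s = fun t => K s *m state u s t by apply/funext => t; rewrite /u xE.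
  apply: gen_pre; apply: mxmeasM; first exact: mxmeas_cst.
  by apply: gen => S FS; apply: sub_gen_smallest; exists s => //=; left.
have PiE s : sqint P (state u s) -> sqint P (joint u s) /\
    second_moment P (joint u s) = Pimx (K s) (second_moment P (state u s)).
  move=> sx; rewrite jE; have [] := second_moment_mul (col_mx 1%:M (K s)) sx.
  by rewrite tr_col_mx tr_scalar_mx.
have main s : sqint P (state u s) /\ loewner_le (second_moment P (state u s)) (X s).
  elim: s => [|s [sx le]]; first by split=> //; rewrite X00; exact: loewner_refl.
  have [sj jm] := PiE s sx; have [sS ->] := state_second_moment cu sj; split=> //.
  have [_ _ ->] := XZ s; rewrite jm; apply: moment_map_le => //.
  by apply: loewner_trans (hK s); exact: Pimx_le.
apply: le_trans (_ : (\sum_(0 <= s <oo) \int[P]_t (qform H (joint u s t))%:E <= _)%E).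
  by rewrite -input_costE//; apply: ereal_inf_lbound; exists u.
apply: lee_nneseries => [s _ _|s _].
  by apply: integral_ge0 => t _; rewrite lee_fin; exact: (pdmx_psdmx pH).2.
have [sx le] := main s; have [sj jm] := PiE s sx.
have [iH EH] := qform_second_moment H sj.
rewrite (Ex_fin iH) EH lee_fin jm -subr_ge0 -raddfB -mulmxBl.
apply: trace_mul_psd_ge0; last exact: pdmx_psdmx.
by apply: loewner_trans (hK s); exact: Pimx_le.
Qed.

Lemma val_LQRcp_SLQR :
  val_LQRcp A B W H (second_moment P x0) = val_SLQR P At Bt x0 vs xi Q Ru.
Proof.
by apply/eqP; rewrite eq_le val_LQRcp_le_SLQR val_SLQR_le_LQRcp.
Qed.

End ControlEquivalence.

(** * The least-squares estimate and its null space *)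

Section LeastSquares.
Context {R : realType} {nx nu nw : nat}.
Variables (A : 'I_nw -> 'M[R]_nx) (B : 'I_nw -> 'M[R]_(nx, nu)).
Local Notation mom := (moment_map A B).

(** The rank conditions place the rows of [V] in the row space of [M], so [M^T] times its
    pseudo-inverse fixes [V^T]: the reduced noise generates the same system matrices as [y]. *)
Lemma noise_identity nv (At : 'I_nv -> 'M[R]_nx) (Bt : 'I_nv -> 'M[R]_(nx, nu)) :
    \rank (unfold3 (model A B)) = nw ->
    \rank (col_mx (unfold3 (model A B)) (unfold3 (model At Bt))) = nw ->
  forall y : 'cV[R]_nv, \sum_i y i 0 *: model At Bt i =
    \sum_k (mpinv (unfold3 (model A B))^T *m (unfold3 (model At Bt))^T *m y) k 0 *: model A B k.
Proof.
set M := unfold3 (model A B); set V := unfold3 (model At Bt) => rM rMV y.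
have VM : (V <= M)%MS.
  have : (M <= col_mx M V)%MS by rewrite -addsmxE addsmxSl.
  move/mxrank_leqif_sup => [_]; rewrite rM rMV eqxx => /esym.
  by rewrite -addsmxE addsmx_sub => /andP[].
have [D VD] := submxP VM.
have MV : M^T *m (mpinv M^T *m V^T) = V^T.
  by rewrite VD trmx_mul !mulmxA; have [-> _ _ _] := mpinvP M^T.
have vec_comb n (C : 'I_n -> 'M[R]_(nx, nx + nu)) (c : 'cV[R]_n) :
    (unfold3 C)^T *m c = vec (\sum_i c i 0 *: C i).
  apply/colP => l; rewrite !mxE summxE; apply: eq_bigr => i _.
  by rewrite !mxE mulrC.
have : vec (\sum_i y i 0 *: model At Bt i) =
    vec (\sum_k (mpinv M^T *m V^T *m y) k 0 *: model A B k).
  by rewrite -!vec_comb -/M -/V mulmxA MV.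
move=> /colP e; apply/matrixP => i j.
by have := e (mxtens_index (j, i)); rewrite ![vec _ _ _]mxE mxtens_indexK.
Qed.

Lemma model_at_cong z W :
  model_at A B z *m W *m (model_at A B z)^T = mom W (z *m z^T).
Proof.
apply/matrixP => i j.
transitivity (\sum_k \sum_l W k l * ((model A B k *m z) i 0 * (model A B l *m z) j 0)).
  rewrite mxE exchange_big; apply: eq_bigr => l _; rewrite mxE mulr_suml.
  apply: eq_bigr => k _.
  by rewrite [model_at A B z i k]mxE [_^T _ _]mxE [model_at A B z j l]mxE; ring.
rewrite summxE; apply: eq_bigr => k _; rewrite summxE; apply: eq_bigr => l _.
rewrite [RHS]mxE mulmxA -[_ *m _ *m _^T]mulmxA -trmx_mul.
by rewrite [X in _ = _ * X]mxE big_ord1 [_^T _ _]mxE.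
Qed.

Lemma smat_sum n I (r : seq I) (u : I -> 'cV[R]_(sdim n)) :
  smat (\sum_(i <- r) u i) = \sum_(i <- r) smat (u i).
Proof.
elim: r => [|i r IH].
  by rewrite !big_nil /smat big1// => k _; rewrite mxE scale0r.
by rewrite !big_cons -IH -[in LHS](scale1r (u i)) smat_linear scale1r.
Qed.

Lemma svec0 n : svec (0 : 'M[R]_n) = 0.
Proof. by apply/colP => k; rewrite svecE !mxE mulr0. Qed.

Section Samples.
Variables (N : nat).
Implicit Types (zs : 'I_N -> 'cV[R]_(nx + nu)).
Local Notation gram zs := (\sum_j ls_gram A B zs j).

Definition spans zs : Prop := forall X : 'M[R]_(nx + nu), X^T = X ->
  exists c : 'I_N -> R, X = \sum_i c i *: (zs i *m (zs i)^T).

Lemma gram_sym zs : (gram zs)^T = gram zs.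
Proof.
by rewrite linear_sum; apply: eq_bigr => i _; rewrite /= /ls_gram trmx_mul trmxK.
Qed.

(** [u^T G u] is a sum of squared norms, one for each sample, and vanishes only if all of them
    do. *)
Lemma gram_mul_eq0 zs u : gram zs *m u = 0 <-> forall i, mom (smat u) (zs i *m (zs i)^T) = 0.
Proof.
have skE i : skron (model_at A B (zs i)) *m u = svec (mom (smat u) (zs i *m (zs i)^T)).
  by rewrite -model_at_cong -skronE ?smat_sym// svecK.
split=> [Gu i|h]; last first.
  rewrite mulmx_suml big1// => i _; rewrite /ls_gram -mulmxA skE h.
  by rewrite svec0 mulmx0.
have S0 : \sum_i ((skron (model_at A B (zs i)) *m u)^T *m (skron (model_at A B (zs i)) *m u)) 0 0 = 0.
  have := congr1 (fun M => (u^T *m M) 0 0) Gu; rewrite mulmx0 [RHS]mxE => e.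
  rewrite -[RHS]e mulmx_suml mulmx_sumr summxE; apply: eq_bigr => j _.
  by rewrite /ls_gram trmx_mul !mulmxA.
have /allP : all (fun j => (((skron (model_at A B (zs j)) *m u)^T *m (skron (model_at A B (zs j)) *m u)) 0 0 == 0)) (index_enum 'I_N).
  have /eqP := S0; rewrite psumr_eq0//.
  by move=> j _; exact: dot_ge0.
move=> /(_ i (mem_index_enum _)); rewrite dot_eq0 skE => /eqP.
rewrite -[X in _ = X -> _]svec0; apply: svec_inj_sym; last by rewrite trmx0.
by rewrite -model_at_cong !trmx_mul trmxK smat_sym mulmxA.
Qed.

(** Once the dyads span, membership in the kernel no longer refers to the samples; the kernel is
    therefore common to all spanning designs. *)
Lemma gram_kernel zs u : spans zs ->
  (gram zs *m u = 0 <-> forall X, X^T = X -> mom (smat u) X = 0).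
Proof.
move=> sz; rewrite gram_mul_eq0; split=> h => [X /sz[c ->]|i]; last by rewrite h// trmx_mul trmxK.
have lin a Z Z' : mom (smat u) (a *: Z + Z') = a *: mom (smat u) Z + mom (smat u) Z'.
  exact: moment_mapDZ.
have m0 : mom (smat u) 0 = 0.
  by have := lin (-1) 0 0; rewrite scaler0 addr0 scaleN1r addNr.
elim: (index_enum _) => [|i r IH]; first by rewrite big_nil.
by rewrite big_cons lin IH h scaler0 addr0.
Qed.

Definition null_proj zs : 'M[R]_(sdim nw) := 1%:M - mpinv (gram zs) *m gram zs.

Lemma null_proj_sym zs : (null_proj zs)^T = null_proj zs.
Proof.
have [_ _ _ g4] := mpinvP (gram zs).
by rewrite /null_proj trmxB tr_scalar_mx g4.
Qed.

Lemma null_proj_idem zs : null_proj zs *m null_proj zs = null_proj zs.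
Proof.
have [g1 _ _ _] := mpinvP (gram zs).
rewrite /null_proj mulmxBl mul1mx mulmxBr mulmx1 -!mulmxA (mulmxA _ (mpinv _)) g1.
by rewrite subrr subr0.
Qed.

Lemma gram_null_proj zs zs' : spans zs -> spans zs' -> gram zs *m null_proj zs' = 0.
Proof.
move=> sz sz'; apply/matrixP => i j.
have h : gram zs *m col j (null_proj zs') = 0.
  apply/(gram_kernel _ sz)/(gram_kernel _ sz').
  rewrite colE mulmxA /null_proj mulmxBr mulmx1 mulmxA.
  by have [-> _ _ _] := mpinvP (gram zs'); rewrite subrr mul0mx.
by move: h; rewrite colE mulmxA -colE => /colP/(_ i); rewrite mxE => ->; rewrite !mxE.
Qed.

(** Each projector fixes the range of the other; transposing one of these identities makes the two
    coincide. *)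
Lemma null_proj_eq zs zs' : spans zs -> spans zs' -> null_proj zs = null_proj zs'.
Proof.
have key x y : spans x -> spans y -> null_proj x *m null_proj y = null_proj y.
  move=> sx sy; rewrite /null_proj mulmxBl mul1mx -mulmxA.
  by rewrite -/(null_proj y) gram_null_proj// mulmx0 subr0.
move=> sz sz'; rewrite -[LHS](key zs' zs)// -[in LHS]null_proj_sym -[null_proj zs in LHS]null_proj_sym.
by rewrite -trmx_mul key// null_proj_sym.
Qed.

Lemma mpinv_gramE zs zs' : spans zs -> spans zs' ->
  gram zs + null_proj zs' \in unitmx /\
  mpinv (gram zs) = invmx (gram zs + null_proj zs') - null_proj zs'.
Proof.
move=> sz sz'; apply: mpinv_kernel.
- exact: gram_sym.
- exact: null_proj_sym.
- exact: null_proj_idem.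
- by rewrite -(null_proj_eq sz sz') /null_proj opprB addrC subrK.
Qed.

Lemma W_hatE zs (xs : 'I_N -> 'cV[R]_nx) (om : 'I_N -> 'cV[R]_nw) :
    (forall i, xs i = model_at A B (zs i) *m om i) ->
  W_hat A B zs xs = \sum_i ls_weight A B zs i (om i *m (om i)^T).
Proof.
move=> xsE; rewrite /W_hat mpinv_gram.
rewrite -smat_sum; congr smat.
have -> : (ls_design A B zs)^T *m ls_design A B zs = gram zs.
  by rewrite /ls_design tr_mxcol mul_mxrow_mxcol.
rewrite -mulmxA /ls_design tr_mxcol mul_mxrow_mxcol mulmx_sumr.
apply: eq_bigr => i _; rewrite /ls_gram -[RHS]mulmxA; congr (_ *m _).
rewrite -[RHS]mulmxA; congr (_ *m _).
rewrite xsE trmx_mul mulmxA -(mulmxA _ (om i)) -skronE//.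
by rewrite trmx_mul trmxK.
Qed.

(** In [svec] coordinates, the orthogonal projection of [W] off the kernel of the Gram matrix. For
    the true second moment this is the mean of the estimate given the samples. *)
Definition W_proj zs (W : 'M[R]_nw) : 'M[R]_nw := \sum_i ls_weight A B zs i W.

Lemma W_projE zs W : W_proj zs W = smat (mpinv (gram zs) *m gram zs *m svec W).
Proof.
rewrite /W_proj /ls_weight -smat_sum; congr smat.
by rewrite mulmx_sumr mulmx_suml.
Qed.

Lemma W_proj_sym zs W : (W_proj zs W)^T = W_proj zs W.
Proof. by rewrite W_projE smat_sym. Qed.

Lemma moment_map_W_proj zs W X : spans zs -> W^T = W -> X^T = X ->
  mom (W_proj zs W) X = mom W X.
Proof.
move=> sz sW sX; apply/eqP; rewrite -subr_eq0 -moment_mapBW; apply/eqP.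
rewrite W_projE -{2}(smatK sW) -smatB.
apply: (iffLR (gram_kernel _ sz)) => //.
by rewrite mulmxBr !mulmxA; have [-> _ _ _] := mpinvP (gram zs); rewrite subrr.
Qed.

End Samples.
End LeastSquares.

(** * Concentration of the weighted noise *)

Section WeightedNoise.
Context {d : measure_display} {T : measurableType d} {R : realType}.
Variables (P : probability T R) (n N : nat) (F : 'I_N + 'I_N -> set (set T)).
Variables (L : 'I_N -> T -> 'M[R]_(sdim n)) (D : 'I_N -> T -> 'M[R]_n) (c : R).
Local Notation Ex f := (Rintegral P setT f).
Local Notation sums J := (\bigcup_(i in J) F i).
Hypotheses (indF : mutually_independent P F)
  (sF : forall i, sigma_algebra setT (F i)) (mF : forall i, F i `<=` measurable)
  (mL : forall i, mxmeas_on (sums (range inl)) (L i))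
  (mD : forall i, mxmeas_on (F (inr i)) (D i))
  (sD : forall i t, (D i t)^T = D i t)
  (c0 : 0 <= c) (Dc : forall i t, specnorm (D i t) <= c)
  (ED : forall i p q, Ex (fun t => D i t p q) = 0).

Definition noise_norm i t : R := sym_opnorm (svec_map (L i t)).

Definition noise_total t : R := Num.sqrt (\sum_i noise_norm i t ^+ 2).

(** Division by [c * noise_total] produces summands whose squared norm bounds add up to at most 1.
    If the total vanishes, all ratios and terms are zero because [0^-1 = 0]. *)
Let ratio i t := noise_norm i t / noise_total t.
Let scale t := (c * noise_total t)^-1.
Let term i t : 'M[R]_n := scale t *: svec_map (L i t) (D i t).
(** All samples, tagged [inl], and the first [k] noise vectors, tagged [inr]: the whole design is
    known at time 0. *)
Let pastJ k : set ('I_N + 'I_N) := [set i : 'I_N + 'I_N | if i is inr j then (j < k)%N else true].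
Let G k : set (set T) := sums (pastJ k).

Let norm_ge0 i t : 0 <= noise_norm i t. Proof. exact: sym_opnorm_ge0. Qed.

Let sum_sq_ge0 t : 0 <= \sum_i noise_norm i t ^+ 2.
Proof. by apply: sumr_ge0 => i _; exact: sqr_ge0. Qed.

Let norm_le_total i t : noise_norm i t <= noise_total t.
Proof.
rewrite -(ler_pXn2r (ltn0Sn 1)) ?nnegrE ?sqrtr_ge0//.
rewrite sqr_sqrtr// (bigD1 i)//= lerDl.
by apply: sumr_ge0 => j _; exact: sqr_ge0.
Qed.

Let ratio_ge0 i t : 0 <= ratio i t.
Proof. by rewrite divr_ge0 ?norm_ge0 ?sqrtr_ge0. Qed.

Let ratio_le1 i t : ratio i t <= 1.
Proof.
have [z0|z0] := eqVneq (noise_total t) 0; first by rewrite /ratio z0 invr0 mulr0.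
by rewrite ler_pdivrMr ?mul1r// lt_neqAle eq_sym z0 sqrtr_ge0.
Qed.

Let ratio_sum t : \sum_i ratio i t ^+ 2 <= 1.
Proof.
under eq_bigr do rewrite expr_div_n.
rewrite -mulr_suml /noise_total sqr_sqrtr//.
by have [->|z0] := eqVneq (\sum_i noise_norm i t ^+ 2) 0; rewrite ?mul0r// mulfV.
Qed.

Let svec_map_scale i t X : X^T = X -> specnorm (scale t *: svec_map (L i t) X) <= c^-1 * (ratio i t * specnorm X).
Proof.
move=> sX; apply: le_trans (specnormZ_le _ _) _.
rewrite /scale ger0_norm ?invr_ge0 ?mulr_ge0 ?sqrtr_ge0// invfM -mulrA.
apply: ler_wpM2l; first by rewrite invr_ge0.
rewrite /ratio (mulrC (noise_norm i t)) -mulrA; apply: ler_wpM2l.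
  by rewrite invr_ge0 sqrtr_ge0.
exact: sym_opnorm_bound.
Qed.

Let term_le i t : specnorm (term i t) <= ratio i t.
Proof.
apply: le_trans (svec_map_scale i t (sD i t)) _.
have [->|cn] := eqVneq c 0; first by rewrite invr0 mul0r.
have cp : 0 < c by rewrite lt_neqAle eq_sym cn.
by rewrite mulrC ler_pdivrMr// ler_wpM2l.
Qed.

Let G_measurable k : <<s G k >> `<=` measurable.
Proof. by apply: sub_sigma_measurable => S [i _]; exact: mF. Qed.

Let G_le k l : (k <= l)%N -> <<s G k >> `<=` <<s G l >>.
Proof.
move=> kl; apply: sub_sigma_algebra2 => S [i ip FS]; exists i => //.
by case: i ip {FS} => //= j jk; exact: leq_trans jk kl.
Qed.

Let L_past k i : mxmeas_on (G k) (L i).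
Proof.
move=> p q; apply: measurable_funG_sub (mL i p q).
by apply: sub_sigma_algebra2 => S [j [j' _ <-] FS]; exists (inl j').
Qed.

Let D_past k (i : 'I_N) : (i < k)%N -> mxmeas_on (G k) (D i).
Proof.
move=> ik p q; apply: measurable_funG_sub (@mD i p q).
by apply: sub_sigma_algebra2 => S FS; exists (inr i).
Qed.

Let norm_past k i : measurable_fun (setT : set (g_sigma_algebraType (G k))) (noise_norm i).
Proof.
apply: (@measurable_lipschitz_mx _ (g_sigma_algebraType (G k)) R _ _
  (fun M => sym_opnorm (svec_map M)) (\sum_k 2 * specnorm (symbasis R k : 'M[R]_n)) _ _ _ (@L_past k i)).
  by apply: sumr_ge0 => j _; rewrite mulr_ge0// specnorm_ge0.
move=> M M'.
have gain (X : 'M[R]_(sdim n)) : smat_gain X <= (\sum_k 2 * specnorm (symbasis R k : 'M[R]_n)) * \sum_i \sum_j `|X i j|.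
  rewrite /smat_gain [leRHS]mulr_suml.
  apply: ler_sum => j _.
  rewrite -mulr_suml -mulrA mulrC; apply: ler_wpM2l; first by rewrite mulr_ge0// specnorm_ge0.
  rewrite [leRHS](bigD1 j)//= lerDl; apply: sumr_ge0 => l _.
  by apply: sumr_ge0.
have gN (X : 'M[R]_(sdim n)) : smat_gain (- X) = smat_gain X.
  apply: eq_bigr => j _; congr (_ * _); apply: eq_bigr => l _.
  by rewrite mxE normrN.
have e : \sum_i0 \sum_j `|M i0 j - M' i0 j| = \sum_i0 \sum_j `|(M - M') i0 j|.
  by apply: eq_bigr => p _; apply: eq_bigr => q _; rewrite !mxE.
rewrite e ler_norml; apply/andP; split.
  rewrite lerNl opprB lerBlDl; apply: le_trans (sym_opnorm_triangle M' M) _.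
  by rewrite lerD2l -opprB gN.
by rewrite lerBlDl; apply: le_trans (sym_opnorm_triangle M M') _; rewrite lerD2l.
Qed.

Let total_past k : measurable_fun (setT : set (g_sigma_algebraType (G k))) noise_total.
Proof.
rewrite (_ : noise_total = fun t => (\sum_i noise_norm i t ^+ 2) `^ 2^-1); last first.
  by apply/funext => t; rewrite powR12_sqrt.
apply: (measurableT_comp (measurable_powR _)); apply: measurable_sum => i.
by apply: measurable_funX; exact: norm_past.
Qed.

Let ratio_past k i : measurable_fun (setT : set (g_sigma_algebraType (G k))) (ratio i).
Proof. by apply: measurable_funM; [exact: norm_past|exact: measurable_inv]. Qed.

Let scale_past k : measurable_fun (setT : set (g_sigma_algebraType (G k))) scale.
Proof.
apply: measurable_inv; apply: measurable_funM; first exact: measurable_cst.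
exact: total_past.
Qed.

Let term_past k (i : 'I_N) : (i < k)%N -> mxmeas_on (G k) (term i).
Proof.
move=> ik; apply: mxmeasZ; first exact: scale_past.
by apply: mxmeas_smat; apply: mxmeasM; [exact: L_past|apply: mxmeas_svec; exact: D_past].
Qed.

Let D_bmeas i p q : bmeas (fun t => D i t p q).
Proof.
split; last by exists c => t; exact: le_trans (entry_le_specnorm _ _ _) (Dc i t).
by apply: measurable_funG (@mD i p q); exact: sub_sigma_measurable.
Qed.

(** In the symmetric basis the term is a sum of centred coordinates of [D i] times coefficients
    known at time [i], so independence factors the expectation. The normalisation keeps these
    coefficients bounded. *)
Let term_mean (i : 'I_N) g p q : bmeasG (G i) g -> Ex (fun t => g t * term i t p q) = 0.
Proof.
move=> bg.
pose s (m : 'I_(sdim n)) t := svec (D i t) m 0.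
pose h m t := g t * (scale t *: svec_map (L i t) (symbasis R m)) p q.
have E t : g t * term i t p q = \sum_m s m t * h m t.
  have -> : term i t = \sum_m s m t *: (scale t *: svec_map (L i t) (symbasis R m)).
    rewrite /term /svec_map -[in LHS](smatK (sD i t)) svec_sum mulmx_sumr smat_sum scaler_sumr.
    by apply: eq_bigr => m _; rewrite -scalemxAr smatZ !scalerA mulrC.
  by rewrite summxE mulr_sumr; apply: eq_bigr => m _; rewrite mxE mulrCA.
have bh m : bmeasG (G i) (h m).
  apply: bmeasM => //; split.
    apply: mxmeasZ; first exact: scale_past.
    by apply: mxmeas_smat; apply: mxmeasM; [exact: L_past|exact: mxmeas_cst].
  exists (c^-1 * specnorm (symbasis R m : 'M[R]_n)) => t.
  apply: le_trans (entry_le_specnorm _ _ _) _.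
  apply: le_trans (svec_map_scale i t (symbasis_sym R m)) _.
  apply: ler_wpM2l; first by rewrite invr_ge0.
  by rewrite ler_piMl ?specnorm_ge0.
pose r (m : 'I_(sdim n)) : R := if (enum_val m).1 == (enum_val m).2 then 1 else Num.sqrt 2.
have sE m t : s m t = r m * D i t (enum_val m).2 (enum_val m).1 by rewrite /s svecE.
have bs m : bmeas (s m).
  by apply: eq_bmeas (bmeasZ (r m) (D_bmeas i _ _)) => t; rewrite sE.
have sm m : Ex (s m) = 0.
  by rewrite (Ex_eq P (sE m)) ExZ ?ED ?mulr0//; exact: bmeas_intg.
have mFi : <<s F (inr i) >> `<=` measurable by exact: sub_sigma_measurable.
have iFG : indep P <<s F (inr i) >> <<s G i >>.
  have dis : [set inr i] `&` pastJ i = set0.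
    by apply/seteqP; split=> // j [/= ->]; rewrite /pastJ /= ltnn.
  apply: indep_sub (mutual_indep_group indF sF mF dis) => //.
  by apply: sub_sigma_algebra2 => S FS; exists (inr i).
have sh m : P.-integrable setT (EFin \o (fun t => s m t * h m t)) /\ Ex (fun t => s m t * h m t) = 0.
  have [] := @indep_Ex_mul _ _ _ P <<s F (inr i) >> <<s G i >> (s m) (h m) mFi (@G_measurable i) iFG.
  - move=> _ [S mS <-]; exact: (mxmeas_svec (@mD i)).
  - by move=> _ [S mS <-]; have [mh _] := bh m; exact: mh.
  - exact: bmeas_intg.
  - by apply: bmeas_intg; exact: bmeasG_bmeas (bh m).
  by move=> ? ->; split=> //; rewrite sm mul0r.
rewrite (Ex_eq P E) Ex_sum => [|m]; last by have [] := sh m.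
by apply: big1 => m _; have [_ ->] := sh m.
Qed.

Lemma weighted_noise_bound delta : 0 < delta < 1 ->
  exists E : set T, [/\ measurable E, ((1 - delta)%:E <= P E)%E &
    forall t, E t ->
    let b := c * noise_total t * Num.sqrt (2 * ln (2 * n%:R / delta)) in
    loewner_le (- b%:M) (\sum_i svec_map (L i t) (D i t)) /\
    loewner_le (\sum_i svec_map (L i t) (D i t)) b%:M].
Proof.
(* The Hoeffding bound assumes a positive dimension; in dimension 0 every matrix is positive
   semidefinite. *)
move=> hdelta; have [n0|npos] := posnP n.
  exists setT; split=> //; first by rewrite probability_setT lee_fin; move: hdelta; lra.
  have triv (M : 'M[R]_n) : psdmx M.
    split; first by apply/matrixP => i; have := ltn_ord i; rewrite [X in (_ < X)%N]n0.
    by move=> x; rewrite /qform mxE big1// => i; have := ltn_ord i; rewrite [X in (_ < X)%N]n0.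
  by move=> t _; split; exact: triv.
pose X k t : 'M[R]_n := if insub k is Some i then term i t else 0.
pose a k t : R := if insub k is Some i then ratio i t else 0.
have XE (i : 'I_N) t : X i t = term i t by rewrite /X valK.
have aE (i : 'I_N) t : a i t = ratio i t by rewrite /a valK.
have GS k : <<s G k >> `<=` <<s G k.+1 >> by exact: G_le.
have bX k p q : bmeasG (G k.+1) (fun t => X k t p q).
  rewrite /X; case: insubP => [i ik <-|_]; last exact: bmeas_cst.
  split; first exact: term_past.
  exists 1 => t; apply: le_trans (entry_le_specnorm _ _ _) _.
  exact: le_trans (term_le i t) (ratio_le1 i t).
have sX k t : (X k t)^T = X k t.
  rewrite /X; case: insubP => [i ik _|_]; last by rewrite trmx0.
  by rewrite /term trmxZ smat_sym.
have ba k : bmeasG (G 0%N) (a k).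
  rewrite /a; case: insubP => [i ik _|_]; last exact: bmeas_cst.
  split; first exact: ratio_past.
  by exists 1 => t; rewrite ger0_norm.
have Xa k t : specnorm (X k t) <= a k t.
  rewrite /X /a; case: insubP => [i ik _|_]; first exact: term_le.
  by rewrite specnorm0.
have X0 k g p q : bmeasG (G k) g -> Ex (fun t => g t * X k t p q) = 0.
  rewrite /X; case: insubP => [i ik <-|_ _]; first exact: term_mean.
  by rewrite (Ex_eq P (g := fun=> 0)) ?Ex_cst// => t; rewrite mxE mulr0.
have aN t : \sum_(i < N) a i t ^+ 2 <= 1.
  apply: le_trans (ratio_sum t).
  by apply: ler_sum => i _; rewrite aE.
have [E [mE PE EP]] := matrix_hoeffding GS G_measurable bX sX ba Xa X0 npos hdelta aN.
exists E; split=> // t /EP.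
set b := Num.sqrt _; have -> : \sum_(i < N) X i t = \sum_i term i t by apply: eq_bigr => i _; exact: XE.
have cz : 0 <= c * noise_total t by rewrite mulr_ge0 ?sqrtr_ge0.
have -> : \sum_i svec_map (L i t) (D i t) = (c * noise_total t) *: \sum_i term i t.
  rewrite scaler_sumr; apply: eq_bigr => i _; rewrite /term scalerA.
  (* When the scale is zero, the normalisation has erased the summand, but the original summand is
     zero as well. *)
  have [z0|z0] := eqVneq (c * noise_total t) 0; last by rewrite mulfV// scale1r.
  rewrite z0 mul0r scale0r; apply: specnorm_eq0; apply/eqP.
  rewrite eq_le specnorm_ge0 andbT -z0 (le_trans (sym_opnorm_bound _ (sD i t)))//.
  rewrite [leRHS]mulrC; apply: ler_pM => //; first exact: norm_ge0.
    exact: specnorm_ge0.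
  exact: norm_le_total.
move=> [lo hi]; rewrite /= -scale_scalar_mx -scalerN; split.
  by rewrite /loewner_le -scalerBr; exact: psdmxZ.
by rewrite /loewner_le -scalerBr; exact: psdmxZ.
Qed.

End WeightedNoise.

(** * The bounded noise and the generic samples *)

Section BoundedNoise.
Context {d : measure_display} {T : measurableType d} {R : realType}.
Variable P : probability T R.
Local Notation Ex f := (Rintegral P setT f).
Local Notation intg f := (P.-integrable setT (EFin \o f)).

Lemma Ex_same_law d' (T' : measurableType d') (X Y : {RV P >-> T'}) (f : T' -> R) :
    same_law P X Y -> measurable_fun setT f -> intg (fun t => f (Y t)) ->
  intg (fun t => f (X t)) /\ Ex (fun t => f (X t)) = Ex (fun t => f (Y t)).
Proof.
move=> XY mf fY.
have law (g : T' -> \bar R) : (\int[distribution P X]_y g y = \int[distribution P Y]_y g y)%E.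
  by apply: eq_measure_integral => S mS _; exact: XY.
have mfE : measurable_fun setT (EFin \o f) by exact/measurable_EFinP.
have fX : intg (fun t => f (X t)).
  apply/integrableP; split; first exact: (measurableT_comp mfE).
  have [_] := integrableP _ _ _ fY; apply: le_lt_trans.
  have mabs := measurableT_comp (@abse_measurable R setT) mfE.
  have abs0 y : (0 <= (abse \o (EFin \o f)) y)%E by exact: abse_ge0.
  have eX := ge0_integral_distribution X mabs abs0.
  have eY := ge0_integral_distribution Y mabs abs0.
  suff -> : (\int[P]_t `|(EFin \o (fun t => f (X t))) t| =
    \int[P]_t `|(EFin \o (fun t => f (Y t))) t|)%E by [].
  exact: etrans (esym eX) (etrans (law _) eY).
split=> //; rewrite /Rintegral; congr fine.
have := integral_distribution mfE fX; have := integral_distribution mfE fY.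
by move=> <- <-; exact: law.
Qed.

(** The noise is bounded almost surely only, whereas the martingale bounds are required at every
    point. The truncated noise satisfies them everywhere and agrees with the noise almost surely. *)
Definition trunc n (r : R) (y : 'cV[R]_n) : 'cV[R]_n := if enorm y <= r then y else 0.

Lemma enorm_trunc n r (y : 'cV[R]_n) : 0 <= r -> enorm (trunc r y) <= r.
Proof. by rewrite /trunc; case: ifP => // _; rewrite enorm0. Qed.

Lemma measurable_enorm_le n r : 0 <= r -> measurable [set y : 'cV[R]_n | enorm y <= r].
Proof.
move=> r0; have mi := @mxmeas_id R n 1.
rewrite (_ : [set y | _] = setT `&` [set y | (y^T *m y) 0 0 <= r ^+ 2]).
  apply: measurable_fun_ler => //.
  exact: (mxmeasM (mxmeas_tr mi) mi).
by rewrite setTI; apply/seteqP; split=> y /=; rewrite -enorm_sq ler_pXn2r ?nnegrE ?enorm_ge0.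
Qed.

Lemma measurable_trunc n r : 0 <= r -> measurable_fun setT (@trunc n r).
Proof.
move=> r0; have mi := @mxmeas_id R n 1.
apply/measurable_mxP; apply: (eq_mxmeas (X := fun y => \1_[set y : 'cV[R]_n | enorm y <= r] y *: y)).
  move=> y; rewrite /trunc indicE; case: ifP => yr; first by rewrite mem_set// scale1r.
  by rewrite memNset ?scale0r//= yr.
by apply: mxmeasZ => //; apply: measurable_indic; exact: measurable_enorm_le.
Qed.

Lemma qform_outer_le n (w x : 'cV[R]_n) r : 0 <= r -> enorm w <= r ->
  qform (w *m w^T) x <= r ^+ 2 * (x^T *m x) 0 0.
Proof.
move=> r0 wr; rewrite qform_dyad -enorm_sq -exprMn -[leLHS]ger0_norm ?sqr_ge0// normrX.
rewrite ler_pXn2r ?nnegrE ?mulr_ge0 ?enorm_ge0//.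
by apply: le_trans (cauchy_schwarz w x) _; rewrite ler_wpM2r ?enorm_ge0.
Qed.

Lemma entry_le_enorm n (y : 'cV[R]_n) k : `|y k 0| <= enorm y.
Proof.
rewrite -(ler_pXn2r (ltn0Sn 1)) ?nnegrE ?enorm_ge0// enorm_sq dot_sumE.
rewrite (bigD1 k)//= -normrX ger0_norm ?sqr_ge0// expr2 lerDl.
by apply: sumr_ge0 => i _; rewrite -expr2 sqr_ge0.
Qed.

Variables (n : nat) (w : {RV P >-> 'cV[R]_n}) (r : R).
Hypothesis wr : {ae P, forall t, enorm (w t) <= r}.

Lemma ae_bound_ge0 : 0 <= r.
Proof.
have [S [mS S0 hS]] := wr.
have [t nSt] : exists t, ~ S t.
  apply: contrapT => h; have ST : S = setT.
    by apply/seteqP; split=> // t _; apply: contrapT => nt; apply: h; exists t.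
  by move: S0; rewrite ST probability_setT => -[] /eqP; rewrite oner_eq0.
apply: le_trans (enorm_ge0 (w t)) _.
by apply: contrapT => h; apply: nSt; apply: hS.
Qed.

Let r0 := ae_bound_ge0.

Lemma sqint_trunc (Y : {RV P >-> 'cV[R]_n}) : sqint P (fun t => trunc r (Y t)).
Proof.
move=> i j; apply: bmeas_intg; split.
  have mY : mxmeas (fun t => trunc r (Y t)).
    by apply/measurable_mxP; apply: (measurableT_comp (@measurable_trunc n r r0)).
  by apply: measurable_funM; exact: mY.
exists (r * r) => t; rewrite normrM.
have le k : `|trunc r (Y t) k 0| <= r.
  exact: le_trans (entry_le_enorm _ _) (enorm_trunc _ r0).
by rewrite ler_pM.
Qed.

Let w_measurable : mxmeas w. Proof. exact/measurable_mxP. Qed.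

Let trunc_w_measurable : mxmeas (fun t => trunc r (w t)).
Proof. by apply/measurable_mxP; apply: (measurableT_comp (@measurable_trunc n r r0)). Qed.

Let trunc_ae (g : 'cV[R]_n -> \bar R) : ae_eq P setT (fun t => g (trunc r (w t))) (g \o w).
Proof.
case: wr => S [mS S0 hS]; exists S; split=> // t /= h; apply: hS => /= wt; apply: h => _.
by rewrite /trunc wt.
Qed.

Lemma trunc_moment : second_moment P (fun t => trunc r (w t)) = second_moment P w.
Proof.
apply/matrixP => i j; rewrite !second_momentE /Rintegral; congr fine.
apply: ae_eq_integral => //.
- by apply/measurable_EFinP; apply: measurable_funM; exact: trunc_w_measurable.
- by apply/measurable_EFinP; apply: measurable_funM; exact: w_measurable.
exact: (trunc_ae (fun y => (y i 0 * y j 0)%:E)).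
Qed.

Lemma same_law_trunc_moment (Y : {RV P >-> 'cV[R]_n}) : same_law P Y w ->
  second_moment P (fun t => trunc r (Y t)) = second_moment P w.
Proof.
move=> Yw; rewrite -trunc_moment; apply/matrixP => i j; rewrite !second_momentE.
have [] := @Ex_same_law _ _ Y w (fun y => trunc r y i 0 * trunc r y j 0) Yw _ (sqint_trunc w i j).
  have mt : mxmeas (@trunc n r) by apply/measurable_mxP; exact: measurable_trunc.
  by apply: measurable_funM; exact: mt.
by [].
Qed.

Lemma sqint_ae_bounded : sqint P w.
Proof.
move=> i j; have /integrableP[mt ft] := sqint_trunc w i j.
apply/integrableP; split.
  by apply/measurable_EFinP; apply: measurable_funM; exact: w_measurable.
suff <- : (\int[P]_t `|(EFin \o (fun t => trunc r (w t) i 0 * trunc r (w t) j 0)%R) t| =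
  \int[P]_t `|(EFin \o (fun t => w t i 0 * w t j 0)%R) t|)%E by [].
apply: ae_eq_integral => //.
- exact: measurableT_comp.
- apply: measurableT_comp => //.
  by apply/measurable_EFinP; apply: measurable_funM; exact: w_measurable.
exact: (trunc_ae (fun y => `|(y i 0 * y j 0)%R%:E|%E)).
Qed.

Lemma second_moment_le : loewner_le (second_moment P w) (r ^+ 2)%:M.
Proof.
rewrite -trunc_moment; have iw := sqint_trunc w.
split.
  by rewrite trmxB tr_scalar_mx second_moment_sym.
move=> y; rewrite qformD qformN qform_scalar subr_ge0 -trace_dyad.
have [iy <-] := qform_second_moment (y *m y^T) iw.
rewrite -[leRHS](Ex_cst P); apply: Ex_le => //; first exact: intg_cst.
move=> t; rewrite qform_dyad dotC -qform_dyad.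
exact: qform_outer_le (enorm_trunc _ r0).
Qed.

Definition noise_dev (Y : T -> 'cV[R]_n) t : 'M[R]_n :=
  trunc r (Y t) *m (trunc r (Y t))^T - second_moment P w.

Lemma noise_dev_sym Y t : (noise_dev Y t)^T = noise_dev Y t.
Proof. by rewrite trmxB trmx_mul trmxK second_moment_sym. Qed.

Lemma noise_dev_le Y t : specnorm (noise_dev Y t) <= r ^+ 2.
Proof.
apply: specnorm_sym_le; [exact: sqr_ge0|exact: noise_dev_sym|move=> x].
have [_ hi] := second_moment_le; have := hi x.
rewrite qformD qformN qform_scalar subr_ge0 => Wx.
have Wx0 : 0 <= qform (second_moment P w) x.
  by rewrite -trunc_moment; have [_] := second_moment_psd (sqint_trunc w); apply.
have tx := qform_outer_le x r0 (enorm_trunc (Y t) r0).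
have tx0 : 0 <= qform (trunc r (Y t) *m (trunc r (Y t))^T) x by exact: (psdmx_dyad _).2.
rewrite /noise_dev qformD qformN ler_norml.
by move: Wx Wx0 tx tx0; set a := _ * _; set b := qform _ _; set c := qform _ _; lra.
Qed.

Lemma noise_dev_mean (Y : {RV P >-> 'cV[R]_n}) p q : same_law P Y w ->
  Ex (fun t => noise_dev Y t p q) = 0.
Proof.
move=> Yw; have iY := sqint_trunc Y p q.
rewrite (Ex_eq P (g := fun t => trunc r (Y t) p 0 * trunc r (Y t) q 0 + - second_moment P w p q)).
  rewrite ExD ?Ex_cst//; last exact: intg_cst.
  by rewrite -second_momentE same_law_trunc_moment// subrr.
move=> t; rewrite mxE [X in _ + X]mxE; congr (_ + _).
by rewrite mxE big_ord1 [_^T _ _]mxE.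
Qed.

Lemma noise_dev_mxmeas (Y : {RV P >-> 'cV[R]_n}) :
  mxmeas_on (g_sigma_algebra_preimage Y) (noise_dev Y).
Proof.
have mY : measurable_fun (setT : set (g_sigma_algebraType (g_sigma_algebra_preimage Y)))
    (Y : g_sigma_algebraType (g_sigma_algebra_preimage Y) -> 'cV[R]_n).
  by move=> _ S mS; apply: sub_gen_smallest; exists S.
have mt : mxmeas_on (g_sigma_algebra_preimage Y) (fun t => trunc r (Y t)).
  by apply/measurable_mxP; apply: (measurableT_comp (@measurable_trunc n r r0)).
apply: mxmeasB; last exact: mxmeas_cst.
by apply: mxmeasM => //; exact: mxmeas_tr.
Qed.

End BoundedNoise.

(** * Almost sure genericity of the design *)

Section GenericSamples.
Context {d : measure_display} {T : measurableType d} {R : realType}.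
Variables (P : probability T R) (nx nu N : nat).
Variables (z : {RV P >-> 'cV[R]_(nx + nu)}) (zs : 'I_N -> {RV P >-> 'cV[R]_(nx + nu)}).
Variable (F : 'I_N + 'I_N -> set (set T)).
Hypotheses (hN : (sdim (nx + nu) <= N)%N) (hz : ac_lebesgue P z)
  (hzs : forall i, same_law P (zs i) z) (indF : mutually_independent P F)
  (sF : forall i, sigma_algebra setT (F i)) (mF : forall i, F i `<=` measurable)
  (FE : forall i, F (inl i) = g_sigma_algebra_preimage (zs i)).
Local Notation sums J := (\bigcup_(i in J) F i).
Local Notation n := (nx + nu)%N.

(** Padding with [z] extends the finite family to all natural indices; the generic event reads only
    those below [sdim n], which is at most [N]. *)
Let Z k : {RV P >-> 'cV[R]_n} := if insub k is Some i then zs i else z.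

Let ZE (i : 'I_N) : Z i = zs i. Proof. by rewrite /Z valK. Qed.

Definition generic : set T := [set t | row_free (dyad_rows (fun k => Z k t) (sdim n))].

Lemma generic_spans t : generic t -> spans (fun i => zs i t).
Proof.
move=> gt X sX; have [c ->] := dyads_generate gt sX.
pose f k := (if insub k is Some i then c i else 0) *: (Z k t *m (Z k t)^T).
exists (fun i : 'I_N => if insub (i : nat) is Some k then c k else 0).
transitivity (\sum_(k < sdim n) f k); first by apply: eq_bigr => i _; rewrite /f valK.
rewrite (big_ord_widen N f hN) big_mkcond; apply: eq_bigr => i _.
rewrite /f ZE; case: insubP => [j ij _|nij]; first by rewrite ij.
by rewrite (negbTE nij) scale0r.
Qed.

Let Z_sums k : (k < sdim n)%N ->
  mxmeas_on (sums (range inl)) (Z k).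
Proof.
move=> kn; apply/measurable_mxP => _ S mS; apply: sub_gen_smallest.
have kN := leq_trans kn hN; exists (inl (Ordinal kN)); first by exists (Ordinal kN).
by rewrite FE -(ZE (Ordinal kN)); exists S.
Qed.

Lemma generic_measurable : <<s sums (range inl) >> generic.
Proof.
rewrite (_ : generic = ~` [set t | ~~ row_free (dyad_rows (fun k => Z k t) (sdim n))]); last first.
  by apply/seteqP; split=> t; rewrite /generic /=; [move=> ->|move/negP; rewrite negbK].
apply: (@measurableC _ (g_sigma_algebraType (sums (range inl)))).
apply: (@measurable_not_row_free R _ (g_sigma_algebraType (sums (range inl)))).
exact: (@mxmeas_dyad_rows R _ _ (g_sigma_algebraType (sums (range inl))) Z).
Qed.

Lemma generic_ae : measurable generic /\ P generic = 1%E.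
Proof.
have [||mB B0] := @dyad_rows_free_ae _ _ _ P n Z _ _ (sdim n) (leqnn _).
- move=> k kn; have kN := leq_trans kn hN.
  have dis : [set i : 'I_N + 'I_N | exists2 j : 'I_N, (j < k)%N & i = inl j] `&` [set inl (Ordinal kN)] = set0.
    by apply/seteqP; split=> // i [[j jk ->]] /= [] jE; move: jk; rewrite jE /= ltnn.
  apply: indep_sub (mutual_indep_group indF sF mF dis).
    apply: sub_sigma_algebra2 => S [j /= jk]; have jN := ltn_trans jk kN.
    rewrite -[j]/(val (Ordinal jN)) ZE -FE => FS.
    by exists (inl (Ordinal jN)) => //; exists (Ordinal jN).
  rewrite -[k]/(val (Ordinal kN)) ZE -FE => S FS.
  by apply: sub_gen_smallest; exists (inl (Ordinal kN)).
- move=> k S kn sS S0; have kN := leq_trans kn hN.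
  have mq := measurable_quadric S.
  rewrite -[k]/(val (Ordinal kN)) ZE hzs//; apply: hz => //.
  rewrite -[RHS](@quadric_lebesgue0 R n S 0 0 sS); last by case=> S00; rewrite S00 eqxx in S0.
  congr lebesgue_cV; apply/seteqP; split=> y /=; by rewrite trmx0 mul0mx mxE !addr0.
have -> : generic = ~` [set t | ~~ row_free (dyad_rows (fun i => Z i t) (sdim n))].
  by apply/seteqP; split=> t; rewrite /generic /=; [move=> ->|move/negP; rewrite negbK].
by split; [exact: measurableC|rewrite probability_setC// B0 sube0].
Qed.

End GenericSamples.

Lemma probability_setI1 d (T : measurableType d) (R : realType) (P : probability T R) (S S' : set T) :
  measurable S -> measurable S' -> P S' = 1%E -> P (S `&` S') = P S.
Proof.
move=> mS mS' S1; rewrite [RHS](measureDI P mS mS').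
rewrite [X in (X + _)%E](_ : _ = 0%E) ?add0e//.
have C0 : P (~` S') = 0%E by rewrite probability_setC// S1 subee.
apply/eqP; rewrite eq_le measure_ge0 andbT -C0.
by apply: le_measure; rewrite ?inE; [exact: measurableD|exact: measurableC|move=> t []].
Qed.

(** * The confidence interval of the least-squares estimate *)

Section EstimateConcentration.
Context {d : measure_display} {T : measurableType d} {R : realType}.
Variables (P : probability T R) (nx nu nw N : nat).
Variables (A : 'I_nw -> 'M[R]_nx) (B : 'I_nw -> 'M[R]_(nx, nu)).
Variables (w : {RV P >-> 'cV[R]_nw}) (rw : R).
Variables (z : {RV P >-> 'cV[R]_(nx + nu)}) (zs : 'I_N -> {RV P >-> 'cV[R]_(nx + nu)}).
Variables (ws : 'I_N -> {RV P >-> 'cV[R]_nw}).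
Hypotheses (hrw : {ae P, forall t, enorm (w t) <= rw})
  (hN : (sdim (nx + nu) <= N)%N) (hz : ac_lebesgue P z)
  (hzs : forall i, same_law P (zs i) z) (hws : forall i, same_law P (ws i) w).
Let F (i : 'I_N + 'I_N) : set (set T) :=
  match i with
  | inl i => g_sigma_algebra_preimage (zs i)
  | inr i => g_sigma_algebra_preimage (ws i)
  end.
Hypothesis hzw : mutually_independent P F.
Local Notation sums J := (\bigcup_(i in J) F i).
Local Notation gram zs := (\sum_j ls_gram A B zs j).

Let F_measurable i : F i `<=` measurable.
Proof. by case: i => i S [D mD <-]; exact: measurable_funPT. Qed.

Let F_sigma i : sigma_algebra setT (F i).
Proof.
by case: i => i; apply: sigma_algebra_preimage; exact: sigma_algebra_measurable.
Qed.

Let sample t i := zs i t.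
Let Gam := generic z zs.

Let Gam_sums : <<s sums (range inl) >> Gam.
Proof. exact: (@generic_measurable _ _ _ P nx nu N z zs F hN). Qed.

Let Gam_ae : measurable Gam /\ P Gam = 1%E.
Proof. exact: (@generic_ae _ _ _ P nx nu N z zs F hN hz hzs hzw F_sigma F_measurable). Qed.

Let Gam_spans t : Gam t -> spans (sample t).
Proof. exact: (@generic_spans _ _ _ P nx nu N z zs hN). Qed.

Let gram_mxmeas i : mxmeas_on (sums (range inl))
  (fun t => ls_gram A B (sample t) i).
Proof.
have mz : mxmeas_on (sums (range inl)) (zs i).
  apply/measurable_mxP => _ S mS; apply: sub_gen_smallest.
  by exists (inl i) => //; exists S.
have mm : mxmeas_on (sums (range inl))
    (fun t => model_at A B (zs i t)).
  move=> p k; rewrite (_ : (fun t => _) = fun t => (model A B k *m zs i t) p 0); last first.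
    by apply/funext => t; rewrite mxE.
  by apply: mxmeasM => //; exact: mxmeas_cst.
have ms := mxmeas_skron mm.
by apply: mxmeasM => //; exact: mxmeas_tr.
Qed.

(* Off the generic event the weights are set to zero; on it the pseudo-inverse
   is a rational function of the samples, because the null space of the Gram
   matrix is the same for all generic samples. *)
Lemma measurable_weights : exists L : 'I_N -> T -> 'M[R]_(sdim nw),
  (forall i, mxmeas_on (sums (range inl)) (L i)) /\
  (forall t, Gam t -> forall i,
     L i t = mpinv (gram (sample t)) *m ls_gram A B (sample t) i).
Proof.
have [t0 G0] : exists t, Gam t.
  apply: contrapT => h; have GT : Gam = set0.
    by apply/seteqP; split=> // t Gt; apply: h; exists t.
  by have [_] := Gam_ae; rewrite GT measure0 => -[] /eqP; rewrite eq_sym oner_eq0.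
pose Pi := null_proj A B (sample t0).
pose one t : R := \1_Gam t.
pose U t := one t *: (gram (sample t) + Pi) + (1 - one t) *: 1%:M.
have m1 : measurable_fun (setT : set (g_sigma_algebraType (sums (range inl)))) one.
  by apply: measurable_indic; exact: Gam_sums.
have mU : mxmeas_on (sums (range inl)) U.
  apply: mxmeasD; last by apply: mxmeasZ; [exact: measurable_funB|exact: mxmeas_cst].
  apply: mxmeasZ => //.
  by apply: mxmeasD; [exact: mxmeas_sum|exact: mxmeas_cst].
have oneE t : one t = (t \in Gam)%:R by rewrite /one indicE.
have UE t : Gam t -> U t = gram (sample t) + Pi.
  by move=> Gt; rewrite /U oneE mem_set// subrr scale1r scale0r addr0.
have uU t : U t \in unitmx.
  have [Gt|nGt] := pselect (Gam t).
    by rewrite UE//; have [] := mpinv_gramE A B (Gam_spans Gt) (Gam_spans G0).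
  by rewrite /U oneE memNset// subr0 scale0r add0r scale1r unitmx1.
exists (fun i t => one t *: ((invmx (U t) - Pi) *m ls_gram A B (sample t) i)); split=> [i|t Gt i].
  apply: mxmeasZ => //; apply: mxmeasM => //.
  by apply: mxmeasB; [exact: mxmeas_inv|exact: mxmeas_cst].
rewrite oneE mem_set// scale1r UE//.
by have [_ ->] := mpinv_gramE A B (Gam_spans Gt) (Gam_spans G0).
Qed.

Lemma estimate_concentration delta : 0 < delta < 1 ->
  exists E : set T, [/\ measurable E, ((1 - delta)%:E <= P E)%E &
    forall t, E t -> spans (sample t) /\
    forall xs : 'I_N -> 'cV[R]_nx, (forall i, xs i = model_at A B (zs i t) *m ws i t) ->
    let dev := W_hat A B (sample t) xs - W_proj A B (sample t) (second_moment P w) in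
    loewner_le (- (betaW A B (sample t) rw delta)%:M) dev /\
    loewner_le dev (betaW A B (sample t) rw delta)%:M].
Proof.
move=> hdelta; have [L [mL LE]] := measurable_weights.
have rw0 := ae_bound_ge0 hrw.
have [E [mE PE EP]] := @weighted_noise_bound _ _ _ P nw N F L
  (fun i => noise_dev w rw (ws i)) (rw ^+ 2) hzw F_sigma F_measurable mL
  (fun i => @noise_dev_mxmeas _ _ _ _ _ _ _ hrw (ws i)) (fun i t => noise_dev_sym w rw (ws i) t)
  (sqr_ge0 rw) (fun i t => noise_dev_le hrw (ws i) t)
  (fun i p q => noise_dev_mean hrw p q (hws i)) delta hdelta.
(* On this event of probability one, truncation leaves every noise sample unchanged. *)
pose bounded := [set t | forall i, enorm (ws i t) <= rw].
have [mb Pb] : measurable bounded /\ P bounded = 1%E.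
  have mball : measurable [set y : 'cV[R]_nw | enorm y <= rw] by exact: measurable_enorm_le.
  have one i : measurable [set t | enorm (ws i t) <= rw] /\ P [set t | enorm (ws i t) <= rw] = 1%E.
    split.
      by have := measurable_funPT (ws i) measurableT _ mball; rewrite setTI.
    transitivity (P [set t | enorm (w t) <= rw]); first exact: (hws i mball).
    have mw : measurable [set t | enorm (w t) <= rw].
      by have := measurable_funPT w measurableT _ mball; rewrite setTI.
    rewrite -[X in P X]setCK probability_setC; last exact: measurableC.
    suff -> : P (~` [set t | enorm (w t) <= rw]) = 0%E by rewrite sube0.
    have [S [mS S0 hS]] := hrw; apply/eqP; rewrite eq_le measure_ge0 andbT -S0.
    by apply: le_measure; rewrite ?inE//; exact: measurableC.
  have all_seq (r : seq 'I_N) : measurable [set t | forall i, i \in r -> enorm (ws i t) <= rw] /\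
      P [set t | forall i, i \in r -> enorm (ws i t) <= rw] = 1%E.
    elim: r => [|i r [mr Pr]].
      rewrite (_ : [set t | _] = setT); last by apply/seteqP; split.
      by rewrite probability_setT.
    have [mi Pi] := one i.
    rewrite (_ : [set t | _] = [set t | enorm (ws i t) <= rw] `&`
        [set t | forall j, j \in r -> enorm (ws j t) <= rw]).
      by split; [exact: measurableI|rewrite probability_setI1].
    apply/seteqP; split=> t /=.
      by move=> h; split=> [|j jr]; apply: h; rewrite inE ?eqxx// jr orbT.
    by move=> [hi hr] j; rewrite inE => /predU1P[->//|]; exact: hr.
  rewrite (_ : bounded = [set t | forall i, i \in enum 'I_N -> enorm (ws i t) <= rw]) //.
  by apply/seteqP; split=> t /= h i; have := h i; rewrite mem_enum //; exact.
have [mG PG] := Gam_ae.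
exists (E `&` Gam `&` bounded); split.
- by apply: measurableI => //; exact: measurableI.
- by rewrite !probability_setI1//; exact: measurableI.
move=> t [[Et Gt] bt]; split; first exact: Gam_spans.
move=> xs xsE dev; have devE : dev = \sum_i svec_map (L i t) (noise_dev w rw (ws i) t).
  rewrite /dev (W_hatE xsE) /W_proj -sumrB; apply: eq_bigr => i _.
  rewrite /noise_dev /trunc bt /svec_map LE// svecB mulmxBr smatB.
  by [].
(* On the generic event the measurable [L] are the true weights, so the random normalisation is
   exactly [zetaW]. *)
have zE : zetaW A B (sample t) = noise_total L t.
  have nE i : sym_opnorm (ls_weight A B (sample t) i) = noise_norm L i t by rewrite /noise_norm LE.
  by rewrite /zetaW; under eq_bigr do rewrite nE.
by rewrite devE /betaW zE; exact: EP.
Qed.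

End EstimateConcentration.

(** A single event serves both conclusions: on it the samples span and the projected second moment
    lies in the confidence interval. From there on the arguments for (i) and for the inequality are
    deterministic. *)
Theorem mainTheorem5
  (R : realType) (d : measure_display) (T : measurableType d)
  (P : probability T R)
  (nx nu nv nw N : nat)
  (At : 'I_nv -> 'M[R]_nx) (Bt : 'I_nv -> 'M[R]_(nx, nu))
  (A : 'I_nw -> 'M[R]_nx) (B : 'I_nw -> 'M[R]_(nx, nu))
  (hM : \rank (unfold3 (model A B)) = nw)
  (hMV : \rank (col_mx (unfold3 (model A B)) (unfold3 (model At Bt))) = nw)
  (v : {RV P >-> 'cV[R]_nv}) (w : {RV P >-> 'cV[R]_nw}) (rw : R)
  (hw : forall t, w t = mpinv (unfold3 (model A B))^T
                          *m (unfold3 (model At Bt))^T *m v t)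
  (hrw : {ae P, forall t, enorm (w t) <= rw})
  (z : {RV P >-> 'cV[R]_(nx + nu)})
  (zs : 'I_N -> {RV P >-> 'cV[R]_(nx + nu)})
  (ws : 'I_N -> {RV P >-> 'cV[R]_nw})
  (xs : 'I_N -> T -> 'cV[R]_nx)
  (hN : ((nx + nu) * (nx + nu).+1 %/ 2 <= N)%N)
  (hz : ac_lebesgue P z)
  (hzs : forall i, same_law P (zs i) z)
  (hws : forall i, same_law P (ws i) w)
  (hzw : mutually_independent P (fun i : 'I_N + 'I_N =>
     match i with
     | inl i => g_sigma_algebra_preimage (zs i)
     | inr i => g_sigma_algebra_preimage (ws i)
     end))
  (hxs : forall i t, xs i t = model_at A B (zs i t) *m ws i t)
  (x0 : {RV P >-> 'cV[R]_nx}) (vs : nat -> {RV P >-> 'cV[R]_nv})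
  (xi : nat -> {RV P >-> R})
  (hx0 : forall i, ('E_P[fun t => (x0 t i 0 ^+ 2)%R] < +oo)%E)
  (hvs : forall s, same_law P (vs s) v)
  (hxi : forall s (S : set R), measurable S ->
     P (xi s @^-1` S) = uniform_prob (@ltr01 R) S)
  (hctrl : mutually_independent P (fun i : option (nat + nat) =>
     match i with
     | None => g_sigma_algebra_preimage x0
     | Some (inl s) => g_sigma_algebra_preimage (vs s)
     | Some (inr s) => g_sigma_algebra_preimage (xi s)
     end))
  (Q : 'M[R]_nx) (Ru : 'M[R]_nu) (hH : pdmx (block_mx Q 0 0 Ru))
  (delta : R) (hdelta : 0 < delta < 1) :
  let H := block_mx Q 0 0 Ru in
  let Wstar := second_moment P w in
  let X0 := second_moment P x0 in
  let Wlo t := W_low A B (fun i => zs i t) (fun i => xs i t) rw delta in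
  let Whi t := W_high A B (fun i => zs i t) (fun i => xs i t) rw delta in
  exists E : set T, [/\ measurable E, ((1 - delta)%:E <= P E)%E &
    forall t, E t ->
    (exists K : 'M[R]_(nu, nx), forall W : 'M[R]_nw, W^T = W ->
       loewner_le (Wlo t) W -> loewner_le W (Whi t) ->
       sym_specrad (closed_map A B K W) < 1) ->
    (forall Pbar : 'M[R]_nx, pdmx Pbar ->
       Pbar = riccati A B Q Ru (Whi t) Pbar ->
       let Kbar := riccati_gain A B Ru (Whi t) Pbar in
       sym_specrad (fun X => moment_map A B Wstar (Pimx Kbar X)) < 1) /\
    ((val_LQRcp A B Wstar H X0 <= val_DR A B (Wlo t) (Whi t) H X0)%E /\
     val_LQRcp A B Wstar H X0 = val_SLQR P At Bt x0 vs xi Q Ru)].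
Proof.
move=> H Wstar X0 Wlo Whi.
have rw0 := ae_bound_ge0 hrw.
have hN' : (sdim (nx + nu) <= N)%N by rewrite sdimE.
have [E [mE PE EP]] := @estimate_concentration _ _ _ P nx nu nw N A B w rw z zs ws
  hrw hN' hz hzs hws hzw delta hdelta.
have sqw := sqint_ae_bounded hrw.
have pW : psdmx Wstar by exact: second_moment_psd.
have sW : Wstar^T = Wstar by have [] := pW.
have mx0 : mxmeas x0 by exact/measurable_mxP.
have sq0 : sqint P x0.
  apply: sqint_square => // i; have := hx0 i; by rewrite unlock.
exists E; split=> // t Et _; have [sp conc] := EP t Et.
have [lo hi] := conc (fun i => xs i t) (fun i => hxs i t).
set Wp := W_proj _ _ _ _ in lo hi.
have sWp : Wp^T = Wp by exact: W_proj_sym.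
have same Z : Z^T = Z -> moment_map A B Wp Z = moment_map A B Wstar Z.
  by move=> sZ; exact: moment_map_W_proj.
(* The upper deviation bound yields the lower end of the interval, and the lower one its upper
   end. *)
have loW : loewner_le (Wlo t) Wp.
  move: hi; rewrite /loewner_le /Wlo /W_low; congr psdmx.
  by rewrite !opprB addrCA.
have hiW : loewner_le Wp (Whi t).
  move: lo; rewrite /loewner_le /Whi /W_high; congr psdmx.
  by rewrite opprK addrAC.
have sWhi : (Whi t)^T = Whi t.
  by rewrite /Whi /W_high trmxD tr_scalar_mx /W_hat smat_sym.
split; last split.
- move=> Pbar pP PE' /=; apply: (closed_loop_stable sWhi _ _ hH) => //.
    by move=> Z pZ; exact: moment_map_psd.
  by move=> Z pZ; rewrite -same; [exact: moment_map_leW|have [] := pZ].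
- apply: (@val_LQRcp_le_DR _ _ _ _ _ _ _ Wp) => //; exact: second_moment_psd.
have dyn := noise_identity hM hMV.
(* [C] carries [v] to [w]; the moments of [C *m vs s] are those of [w] because [vs s] and [v] have
   the same law. *)
pose C := mpinv (unfold3 (model A B))^T *m (unfold3 (model At Bt))^T.
have wE s : same_law P (vs s) v := hvs s.
have mom s i j : P.-integrable setT (EFin \o (fun t => (C *m vs s t) i 0 * (C *m vs s t) j 0)) /\
    Rintegral P setT (fun t => (C *m vs s t) i 0 * (C *m vs s t) j 0) = Wstar i j.
  have fE t' : w t' i 0 * w t' j 0 = (C *m v t') i 0 * (C *m v t') j 0 by rewrite hw.
  have mi : mxmeas (fun y : 'cV[R]_nv => C *m y).
    by apply: mxmeasM; [exact: mxmeas_cst|exact: mxmeas_id].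
  have mf : measurable_fun setT (fun y : 'cV[R]_nv => (C *m y) i 0 * (C *m y) j 0).
    by apply: measurable_funM; exact: mi.
  have [iv ->] := Ex_same_law (wE s) mf (eq_intg fE (sqw i j)).
  by split=> //; rewrite -(Ex_eq P fE) -second_momentE.
apply: (@val_LQRcp_SLQR _ _ _ P nx nu nv nw At Bt A B C Wstar x0 vs xi Q Ru) => //.
- by move=> s i j; have [] := mom s i j.
- move=> s; apply/matrixP => i j; rewrite second_momentE.
  by have [_ ->] := mom s i j.
Qed.
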